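(* Let $0<p<2$ and let $\omega\in\mathcal{I}nv$ be such that the polynomials are dense in $A^p_\omega$. Let $0<p_1\le2<p_2<\infty$ be such that $\frac1p=\frac1{p_1}+\frac1{p_2}$ and $p_2\ge2p$. If $f\in A^p_\omega$, then there exist $f_1\in A^{p_1}_\omega$ and $f_2\in A^{p_2}_\omega$ such that $f=f_1\cdot f_2$ and $$\|f_1\|_{A^{p_1}_\omega}\cdot\|f_2\|_{A^{p_2}_\omega}\le C\|f\|_{A^p_\omega}$$ for some constant $C=C(p_1,\omega)>0$ (depending only on $p_1$ and $\omega$).
   Context: $\mathbb{D}$ is the open unit disc of $\mathbb{C}$ and $dA=\frac{dx\,dy}{\pi}$. A weight is a function $\omega:\mathbb{D}\to(0,\infty)$ integrable over $\mathbb{D}$ (not necessarily radial or continuous). $A^p_\omega$ consists of analytic functions $f$ in $\mathbb{D}$ with $\|f\|_{A^p_\omega}^p=\int_{\mathbb{D}}|f|^p\omega\,dA<\infty$. For $a\in\mathbb{D}$ let $\varphi_a(z)=\frac{a-z}{1-\overline{a}z}$, and for $r\in(0,1)$ let $\Delta(a,r)=\{z\in\mathbb{D}:|\varphi_a(z)|<r\}$. The class $\mathcal{I}nv$ of invariant weights consists of weights $\omega$ such that for some (equivalently for all) $r\in(0,1)$ there is a constant $C=C(r)\ge1$ with $C^{-1}\omega(a)\le\omega(z)\le C\omega(a)$ for all $a\in\mathbb{D}$ and $z\in\Delta(a,r)$. *)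

(* Defs.v *)
From HB Require Import structures.
From mathcomp Require Import all_boot all_order all_algebra.
From mathcomp Require Import all_classical all_reals all_analysis.
From mathcomp Require Import complex.
Import Order.TTheory GRing.Theory Num.Theory.
Import numFieldNormedType.Exports.
Import ComplexField.Normc.

Set Implicit Arguments.
Unset Strict Implicit.
Unset Printing Implicit Defensive.

Local Open Scope classical_set_scope.
Local Open Scope ring_scope.
Local Open Scope complex_scope.

(* [normc z : R] is the modulus of [z : R[i]]; the norm [`|z|] of the library
   has values in [R[i]]. *)
Definition disc (R : realType) : set R[i] := [set z | normc z < 1].

Definition of_plane (R : realType) (u : R * R) : R[i] := u.1 +i* u.2.

Notation plane_measure := (lebesgue_measure \x lebesgue_measure)%E.

Definition plane_disc (R : realType) : set (R * R) :=
  [set u | disc (of_plane u)].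

(* The integral over the unit disc with respect to dA = dx dy / pi.  It is only
   used for F >= 0; the library's integral is then the supremum of the integrals
   of the Borel simple functions below F, so it is also the Lebesgue integral
   when F is merely Lebesgue measurable. *)
Definition area_integral (R : realType) (F : R[i] -> \bar R) : \bar R :=
  ((pi^-1 : R)%:E *
    \int[plane_measure]_(u in @plane_disc R) F (of_plane u))%E.

(* A measurable function is Borel in the library; a Lebesgue integrable function
   is one that agrees almost everywhere with a Borel integrable one. *)
Definition weight (R : realType) (w : R[i] -> R) : Prop :=
  (forall z, disc z -> 0 < w z) /\
  exists2 g : R * R -> R,
    plane_measure.-integrable (@plane_disc R) (EFin \o g) &
    {ae plane_measure, forall u, plane_disc u -> w (of_plane u) = g u}.

(* Differentiability is over R[i], i.e. f is complex differentiable. *)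
Definition analytic_on_disc (R : realType) (f : R[i] -> R[i]) : Prop :=
  forall z, disc z -> derivable (f : R[i]^o -> R[i]^o) z 1.

Definition bergman_integral (R : realType) (p : R) (w : R[i] -> R)
    (f : R[i] -> R[i]) : \bar R :=
  area_integral (fun z => (normc (f z) `^ p * w z)%:E).

Definition bergman_norm (R : realType) (p : R) (w : R[i] -> R)
    (f : R[i] -> R[i]) : \bar R :=
  (bergman_integral p w f `^ p^-1)%E.

Definition bergman (R : realType) (p : R) (w : R[i] -> R) :
    set (R[i] -> R[i]) :=
  [set f | analytic_on_disc f /\ (bergman_integral p w f < +oo)%E].

(* Polynomials belong to every A^p_w because w is integrable. *)
Definition polynomials_dense (R : realType) (p : R) (w : R[i] -> R) : Prop :=
  forall f, bergman p w f -> forall e : R, 0 < e ->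
    exists q : {poly R[i]}, (bergman_norm p w (fun z => f z - q.[z])%R < e%:E)%E.

Definition mobius (R : realType) (a z : R[i]) : R[i] :=
  (a - z) / (1 - conjc a * z).

Definition pseudohyperbolic_disc (R : realType) (a : R[i]) (r : R) :
    set R[i] :=
  [set z | disc z /\ normc (mobius a z) < r].

Definition invariant_weight (R : realType) (w : R[i] -> R) : Prop :=
  weight w /\
  exists r : R, [/\ 0 < r, r < 1 &
    exists2 C : R, 1 <= C &
      forall a z, disc a -> pseudohyperbolic_disc a r z ->
        C^-1 * w a <= w z /\ w z <= C * w a].

(* Main.v *)
Require Import Defs.
From HB Require Import structures.
From mathcomp Require Import all_boot all_order all_algebra.
From mathcomp Require Import cyclic separable cyclotomic.
From mathcomp Require Import all_classical all_reals all_analysis.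
From mathcomp Require Import complex.
From mathcomp Require Import ring lra.
Import Order.TTheory GRing.Theory Num.Theory.
Import numFieldNormedType.Exports.
Import ComplexField.Normc.
Import measurable_realfun.

Set Implicit Arguments.
Unset Strict Implicit.
Unset Printing Implicit Defensive.

Local Open Scope classical_set_scope.
Local Open Scope ring_scope.
Local Open Scope complex_scope.

(** The proof is the probabilistic factorization of Horowitz, in a form that
    applies to invariant weights which need not be radial.

    Let q be a polynomial with zeros z_k in the disc.  Write q as an outer part,
    without zeros in the disc, times the product of the Blaschke factors of the
    z_k.  The outer part is split deterministically into powers p/p1 and p/p2,
    whereas every Blaschke factor is given to one of the two factors at random,
    to the first with probability p/p1.  The expectation of |f1|^p1 is then a
    product over the zeros ([expected_split_fun]), and the point is to bound its
    weighted integral by a constant times that of |q|^p; the same bound for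
    |f2|^p2 follows by symmetry, and some choice of the zeros satisfies both up
    to a factor 2 ([poly_factorization]).

    The bound is [main_inequality].  The expected factor of a zero at
    pseudohyperbolic distance s is 1 - p/p1 + (p/p1) s^p1, which is at most
    exp(-(p/p1)(1 - s^p1)), and the exponent is p times the mean of
    ln max(s, rho) for a radius rho with rho^p1 uniformly distributed in [0, 1].
    By Jensen's formula the integrand is thus below a geometric mean of |q|^p
    over pseudohyperbolic circles, hence below an arithmetic mean of
    |q(phi_a(b))|^p over points b of the disc.  For fixed b the weighted integral
    in a of this quantity is bounded in terms of the weighted integral of |q|^p,
    with a power of 1 - |b| lost in two ways: in the change of the area
    ([integral_mobius_point_le]), and in passing from the weight at a to the
    weight at phi_a(b), which are joined by a chain of small pseudohyperbolic
    steps ([invariant_weight_growth]).  Inserting these powers of 1 - |b| as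
    weights in the geometric mean only costs a constant, polynomial in p1.

    Jensen's formula is used in finite form: a circle is replaced by the N-th
    roots of unity, over which the product of |z - om w| is |z^N - w^N|, and
    Fatou's lemma takes care of the limit.  The same device gives the sub-mean
    value property of |q|^p ([submean_poly]) and Cauchy's estimates
    ([cauchy_estimate]).  The powers of the outer part come from the binomial
    series of (1 - z)^g ([normc_binom_fun]), so that both factors are locally
    uniform limits of polynomials.

    For f in the Bergman space, polynomials q_n that converge to f in mean are
    factored in this way.  Their factors are locally bounded, so [montel] gives
    limits f1 and f2 along a subsequence; Fatou's lemma transfers the bounds and
    shows that f1 f2 = f ([weighted_factorization]).  The given weight is
    replaced throughout by a comparable Borel one
    ([borel_comparable_weight]).  Finally the constant of the second factor is
    polynomial in p2, so that its root of order p2 is bounded independently of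
    p2 ([growth_root_le]). *)

(** * Moduli and disc automorphisms *)

Section ComplexModulus.
Variable R : realType.
Implicit Types (a b c z : R[i]) (x y : R).

Lemma normc_ge0 z : 0 <= normc z.
Proof. by case: z => x y; rewrite /= sqrtr_ge0. Qed.

Lemma normc_sqr z : normc z ^+ 2 = complex.Re z ^+ 2 + complex.Im z ^+ 2.
Proof. by case: z => x y; rewrite /= sqr_sqrtr// addr_ge0 ?sqr_ge0. Qed.

Lemma normcC z : normc z^* = normc z.
Proof. by case: z => x y; rewrite /= sqrrN. Qed.

Lemma normc_distC a b : normc (a - b) = normc (b - a).
Proof. by rewrite -opprB normcN. Qed.

Lemma normc_real x : normc x%:C = `|x|.
Proof. by rewrite /= expr0n addr0 sqrtr_sqr. Qed.

Lemma normcX z n : normc (z ^+ n) = normc z ^+ n.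
Proof.
elim: n => [|n IHn]; first by rewrite !expr0 normc1.
by rewrite !exprS normcM IHn.
Qed.

Lemma normc_prod (I : Type) (r : seq I) (P : pred I) (F : I -> R[i]) :
  normc (\prod_(i <- r | P i) F i) = \prod_(i <- r | P i) normc (F i).
Proof.
by elim/big_rec2: _ => [|i y1 y2 _ <-]; rewrite ?normc1 ?normcM.
Qed.

Lemma normc_sum (I : Type) (r : seq I) (P : pred I) (F : I -> R[i]) :
  normc (\sum_(i <- r | P i) F i) <= \sum_(i <- r | P i) normc (F i).
Proof.
elim/big_rec2: _ => [|i y1 y2 _ h]; first by rewrite normc0.
by rewrite (le_trans (le_normcD _ _))// lerD2l.
Qed.

Lemma normc_eq0 z : (normc z == 0) = (z == 0).
Proof. by apply/eqP/eqP => [/eq0_normc//|->]; rewrite normc0. Qed.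

Lemma normc_gt0 z : (0 < normc z) = (z != 0).
Proof. by rewrite lt_def normc_eq0 normc_ge0 andbT. Qed.

Lemma le_normcB a b : normc (a - b) <= normc a + normc b.
Proof. by rewrite (le_trans (le_normcD _ _))// normcN. Qed.

Lemma lerB_normcD a b : normc a - normc b <= normc (a + b).
Proof.
by rewrite lerBlDr -{1}(addrK b a) (le_trans (le_normcB _ _)).
Qed.

Lemma lerB_normc a b : normc a - normc b <= normc (a - b).
Proof. by rewrite -(normcN b); exact: lerB_normcD. Qed.

Lemma ler_Re z : `|complex.Re z| <= normc z.
Proof.
by rewrite -(@ler_pXn2r _ 2)// ?nnegrE ?normc_ge0// normc_sqr real_normK ?num_real// lerDl sqr_ge0.
Qed.

Lemma ler_Im z : `|complex.Im z| <= normc z.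
Proof.
by rewrite -(@ler_pXn2r _ 2)// ?nnegrE ?normc_ge0// normc_sqr real_normK ?num_real// lerDr sqr_ge0.
Qed.

Lemma normc_le_ReIm z : normc z <= `|complex.Re z| + `|complex.Im z|.
Proof.
rewrite -(@ler_pXn2r _ 2)// ?nnegrE ?normc_ge0 ?addr_ge0//.
rewrite normc_sqr sqrrD !real_normK ?num_real// lerD2r lerDl.
by rewrite mulrn_wge0// mulr_ge0.
Qed.

Lemma normc_lt_sqr a b : (normc a < normc b) = (normc a ^+ 2 < normc b ^+ 2).
Proof. by rewrite ltr_pXn2r// nnegrE normc_ge0. Qed.

Lemma normc_le_sqr a b : (normc a <= normc b) = (normc a ^+ 2 <= normc b ^+ 2).
Proof. by rewrite ler_pXn2r// nnegrE normc_ge0. Qed.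

Lemma normcE_norm z : `|z| = (normc z)%:C.
Proof. by case: z => x y; rewrite normc_def. Qed.

(** The two squared moduli in a disc automorphism differ by a product; every
    comparison between [normc (a - z)] and [normc (1 - a^* * z)] is the sign of
    that product. *)
Lemma mobius_sqrB a z :
  normc (1 - a^* * z) ^+ 2 - normc (a - z) ^+ 2 =
  (1 - normc a ^+ 2) * (1 - normc z ^+ 2).
Proof.
by rewrite !normc_sqr; case: a => a1 a2; case: z => z1 z2 /=; ring.
Qed.

Lemma sub1_conjM_neq0 a z : normc a * normc z < 1 -> 1 - a^* * z != 0.
Proof.
move=> az; rewrite subr_eq0; apply/eqP => e.
by move: az; rewrite -(normcC a) -normcM -e normc1 ltxx.
Qed.

Lemma disc_sub1_neq0 a z : disc a -> disc z -> 1 - a^* * z != 0.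
Proof.
rewrite /disc/= => ha hz; apply: sub1_conjM_neq0.
by rewrite mulr_ilt1 ?normc_ge0.
Qed.

Lemma disc_mobius a z : disc a -> disc z -> disc (mobius a z).
Proof.
rewrite /disc/= => ha hz.
have den := disc_sub1_neq0 ha hz.
rewrite /mobius normcM normcV ltr_pdivrMr ?normc_gt0// mul1r normc_lt_sqr.
rewrite -subr_gt0 mobius_sqrB mulr_gt0// subr_gt0 expr_lt1 ?normc_ge0//.
Qed.

(** The numerator is affine in [b], so that its product over roots of unity
    [b] is a difference of two powers. *)
Lemma mobiusB a b c : disc a -> disc b ->
  mobius a b - c = ((a - c) - b * (1 - c * a^*)) / (1 - a^* * b).
Proof.
move=> ha hb; have := disc_sub1_neq0 ha hb.
by rewrite /mobius => den; field.
Qed.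

Lemma mobius0 a : mobius a 0 = a.
Proof. by rewrite /mobius mulr0 !subr0 divr1. Qed.

Lemma mobius_0l b : mobius 0 b = - b.
Proof. by rewrite /mobius conjc0 mul0r !subr0 sub0r divr1. Qed.

Lemma disc0 : disc (0 : R[i]).
Proof. by rewrite /disc /mkset normc0 ltr01. Qed.

Lemma normc_mobius_mobius a b c : disc a -> disc b -> disc c ->
  normc (mobius (mobius a b) (mobius a c)) = normc (mobius b c).
Proof.
move=> ha hb hc.
have d1 := disc_sub1_neq0 ha hb; have d2 := disc_sub1_neq0 ha hc.
have d3 := disc_sub1_neq0 hb hc.
have d4 := disc_sub1_neq0 ha ha.
have d1' : 1 - a * b^* != 0.
  by rewrite -conjc_eq0 rmorphB rmorph1 rmorphM /= conjcK.
have -> : mobius (mobius a b) (mobius a c) =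
    - ((1 - a * b^*) / (1 - a^* * b)) * mobius b c.
  rewrite {1}/mobius /mobius rmorphM rmorphB fmorphV rmorphB rmorph1 rmorphM /= conjcK.
  field; rewrite d1' d3 d1 d2 /=.
  rewrite (_ : _ - _ = (1 - a^* * a) * (1 - b^* * c)) ?mulf_neq0//; ring.
rewrite normcM normcN normcM normcV (_ : normc (1 - a * b^*) = normc (1 - a^* * b)).
  by rewrite divff ?mul1r// gt_eqF// normc_gt0.
by rewrite -normcC rmorphB rmorph1 rmorphM /= conjcK.
Qed.

End ComplexModulus.

(** * Geometric means over roots of unity *)

Section RootsOfUnity.
Variable R : realType.
Implicit Types (b c x y z : R[i]).

(** The factorization of [x ^+ N - y ^+ N] evaluates geometric means over
    equidistant points of a circle; the limit of large [N] plays the part of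
    Jensen's formula. *)
Lemma unity_roots_exist (N : nat) : (0 < N)%N ->
  exists om : 'I_N -> R[i],
    (forall i, om i ^+ N = 1) /\
    (forall x y, \prod_i (x - om i * y) = x ^+ N - y ^+ N).
Proof.
move=> N0.
have [r er] := closed_field_poly_normal ('X^N - 1 : {poly R[i]}).
rewrite (monicP (monicXnsubC _ N0)) scale1r in er.
have szr : size r = N.
  by apply/eq_add_S; rewrite -(size_prod_XsubC r id) -er (size_XnsubC _ N0).
have rootr z : z \in r -> z ^+ N = 1.
  move=> zr; apply/eqP; rewrite -subr_eq0.
  have : root ('X^N - 1 : {poly R[i]}) z by rewrite er root_prod_XsubC.
  by rewrite /root !hornerE.
exists (fun i => r`_i); split => [i|x y]; first by rewrite rootr// mem_nth// szr.
have -> : \prod_(i < N) (x - r`_i * y) = \prod_(z <- r) (x - z * y).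
  by rewrite (big_nth 0) szr big_mkord.
have [->|y0] := eqVneq y 0.
  rewrite expr0n gtn_eqF// subr0 -szr.
  under eq_bigr do rewrite mulr0 subr0.
  by rewrite big_const_seq count_predT iter_mulr_1.
have -> : x ^+ N - y ^+ N = y ^+ N * ('X^N - 1 : {poly R[i]}).[x / y].
  by rewrite !hornerE expr_div_n mulrBr mulr1 mulrCA divff ?mulr1// expf_neq0.
rewrite er horner_prod -[in y ^+ N]szr -(count_predT r) -iter_mulr_1.
rewrite -big_const_seq -big_split /=; apply: eq_bigr => z _.
by rewrite hornerXsubC mulrBr mulrCA divff// mulr1 mulrC.
Qed.

Lemma normc_unity_root (N : nat) z : (0 < N)%N -> z ^+ N = 1 -> normc z = 1.
Proof.
move=> N0 zN; apply/eqP; rewrite -(@pexpr_eq1 _ _ N)// ?normc_ge0//.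
by rewrite -normcX zN normc1.
Qed.

(** Off the circle [normc b = normc c] the two powers cannot cancel: the
    larger one wins, up to a factor that disappears under the [N]-th root. *)
Lemma normc_expB_ge b c : normc b != normc c ->
  exists2 k : R, 0 < k & forall N, (0 < N)%N ->
    Num.max (normc b) (normc c) ^+ N * k <= normc (b ^+ N - c ^+ N).
Proof.
wlog lt_cb : b c / normc c < normc b.
  move=> H bc; move: (bc); rewrite neq_lt => /orP[cb|cb]; last exact: H.
  have [|k k0 kN] := H c b cb; first by rewrite eq_sym.
  by exists k => // N N0; rewrite maxC normc_distC kN.
move=> _; have b0 : 0 < normc b := le_lt_trans (normc_ge0 _) lt_cb.
exists (1 - normc c / normc b).
  by rewrite subr_gt0 ltr_pdivrMr// mul1r.
move=> N N0; rewrite max_l ?(ltW lt_cb)//.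
apply: le_trans (lerB_normc _ _); rewrite !normcX mulrBr mulr1 lerD2l lerN2.
case: N N0 => // N _; rewrite [normc b ^+ _]exprSr.
rewrite -mulrA (mulrCA (normc b)) divff ?gt_eqF// mulr1.
by rewrite exprSr ler_wpM2r ?normc_ge0// lerXn2r ?nnegrE ?normc_ge0// ltW.
Qed.

Lemma normc_expB1_le b (N : nat) : normc b <= 1 -> normc (1 - b ^+ N) <= 2.
Proof.
move=> b1; rewrite (le_trans (le_normcB _ _))// normc1 normcX.
by rewrite -[leRHS]/(1 + 1) lerD2l exprn_ile1 ?normc_ge0.
Qed.

(** A geometric mean is usually known up to a factor [k] that does not depend
    on the number of terms; its root of that order tends to 1. *)
Lemma AGM_ge (I : finType) (x : I -> R) (G k : R) : (0 < #|I|)%N ->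
  (forall i, 0 <= x i) -> 0 <= G -> 0 <= k ->
  G ^+ #|I| * k <= \prod_i x i ->
  G * k `^ (#|I|%:R^-1) <= (\sum_i x i) / #|I|%:R.
Proof.
move=> I0 x0 G0 k0 h.
have n0 : (0 : R) < #|I|%:R by rewrite ltr0n.
have s0 : 0 <= (\sum_i x i) / #|I|%:R by rewrite divr_ge0 ?sumr_ge0 ?ltW.
rewrite -(@ler_pXn2r _ #|I|)// ?nnegrE ?mulr_ge0 ?powR_ge0//.
rewrite exprMn -(powR_mulrn #|I| (powR_ge0 _ _)) -powRrM mulVf ?gt_eqF//.
rewrite powRr1// (le_trans h)//.
have := @leif_AGM R I xpredT x (fun i _ => x0 i).
by case.
Qed.

End RootsOfUnity.

(** * Borel measurable complex functions *)

Section ComplexMeasurable.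
Context {d : measure_display} {T : measurableType d} {R : realType}.
Implicit Types (D : set T) (f g : T -> R[i]).

Definition cmeasurable D f :=
  measurable_fun D (fun t => complex.Re (f t)) /\
  measurable_fun D (fun t => complex.Im (f t)).

Lemma cmeasurable_cst D (z : R[i]) : cmeasurable D (fun=> z).
Proof. by split; exact: measurable_cst. Qed.

Lemma cmeasurableD D f g :
  cmeasurable D f -> cmeasurable D g -> cmeasurable D (fun t => f t + g t).
Proof.
move=> [f1 f2] [g1 g2]; split.
  by rewrite (_ : (fun _ => _) = (fun t => complex.Re (f t) + complex.Re (g t)));
    [exact: measurable_funD | apply/funext => t; case: (f t); case: (g t)].
by rewrite (_ : (fun _ => _) = (fun t => complex.Im (f t) + complex.Im (g t)));
  [exact: measurable_funD | apply/funext => t; case: (f t); case: (g t)].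
Qed.

Lemma cmeasurableM D f g :
  cmeasurable D f -> cmeasurable D g -> cmeasurable D (fun t => f t * g t).
Proof.
move=> [f1 f2] [g1 g2]; split.
  rewrite (_ : (fun _ => _) = (fun t => complex.Re (f t) * complex.Re (g t)
      - complex.Im (f t) * complex.Im (g t))).
    by apply: measurable_funB; exact: measurable_funM.
  by apply/funext => t; case: (f t); case: (g t).
rewrite (_ : (fun _ => _) = (fun t => complex.Re (f t) * complex.Im (g t)
    + complex.Im (f t) * complex.Re (g t))).
  by apply: measurable_funD; exact: measurable_funM.
by apply/funext => t; case: (f t); case: (g t) => * /=; rewrite addrC.
Qed.

Lemma cmeasurableN D f : cmeasurable D f -> cmeasurable D (fun t => - f t).
Proof.
move=> mf; rewrite (_ : (fun _ => _) = (fun t => (-1) * f t)).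
  by apply: cmeasurableM => //; exact: cmeasurable_cst.
by apply/funext => t; rewrite mulN1r.
Qed.

Lemma cmeasurableB D f g :
  cmeasurable D f -> cmeasurable D g -> cmeasurable D (fun t => f t - g t).
Proof. by move=> mf /cmeasurableN mg; exact: cmeasurableD. Qed.

Lemma cmeasurable_conj D f : cmeasurable D f -> cmeasurable D (fun t => (f t)^*).
Proof.
move=> [f1 f2]; split.
  by rewrite (_ : (fun _ => _) = (fun t => complex.Re (f t)))//;
    apply/funext => t; case: (f t).
rewrite (_ : (fun _ => _) = (\- (fun t => complex.Im (f t)))).
  exact: measurableT_comp.
by apply/funext => t /=; case: (f t).
Qed.

Lemma measurable_sqr_normc D f : cmeasurable D f ->
  measurable_fun D (fun t => normc (f t) ^+ 2).
Proof.
move=> [f1 f2].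
rewrite (_ : (fun _ => _) =
    (fun t => complex.Re (f t) ^+ 2 + complex.Im (f t) ^+ 2)).
  by apply: measurable_funD; exact: measurable_funX.
by apply/funext => t; rewrite normc_sqr.
Qed.

Lemma measurable_normc D f : cmeasurable D f ->
  measurable_fun D (fun t => normc (f t)).
Proof.
move=> /measurable_sqr_normc mf.
rewrite (_ : (fun _ => _) = (fun t => (normc (f t) ^+ 2) `^ (2^-1))).
  by apply: (measurableT_comp (measurable_powR _)).
apply/funext => t.
by rewrite -powR_mulrn ?normc_ge0// -powRrM mulfV// powRr1// normc_ge0.
Qed.

Lemma cmeasurableV D f : cmeasurable D f -> cmeasurable D (fun t => (f t)^-1).
Proof.
move=> mf; have [c1 c2] := cmeasurable_conj mf.
have mn : cmeasurable D (fun t => ((normc (f t) ^+ 2) `^ (-1))%:C).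
  split; last exact: measurable_cst.
  apply: (measurableT_comp (measurable_powR _)); exact: measurable_sqr_normc.
rewrite (_ : (fun _ => _) =
    (fun t => ((normc (f t) ^+ 2) `^ (-1))%:C * (f t)^*)).
  by apply: cmeasurableM => //; exact: cmeasurable_conj.
apply/funext => t; rewrite powR_inv1 ?sqr_ge0//.
by rewrite invc_norm normcE_norm fmorphV rmorphXn.
Qed.

Lemma cmeasurable_horner D f (q : {poly R[i]}) :
  cmeasurable D f -> cmeasurable D (fun t => q.[f t]).
Proof.
move=> mf; elim/poly_ind: q => [|q c IH].
  under eq_fun do rewrite horner0; exact: cmeasurable_cst.
under eq_fun do rewrite hornerMXaddC.
apply: cmeasurableD; last exact: cmeasurable_cst.
exact: cmeasurableM.
Qed.

Lemma cmeasurable_mobius D f g :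
  cmeasurable D f -> cmeasurable D g -> cmeasurable D (fun t => mobius (f t) (g t)).
Proof.
move=> mf mg; apply: cmeasurableM; first exact: cmeasurableB.
apply: cmeasurableV; apply: cmeasurableB; first exact: cmeasurable_cst.
by apply: cmeasurableM => //; exact: cmeasurable_conj.
Qed.

End ComplexMeasurable.

Section PlaneMeasurable.
Variable R : realType.

Definition to_plane (z : R[i]) : R * R := (complex.Re z, complex.Im z).

Lemma of_planeK : cancel (@of_plane R) to_plane.
Proof. by case. Qed.

Lemma to_planeK : cancel to_plane (@of_plane R).
Proof. by case. Qed.

Lemma cmeasurable_of_plane D : cmeasurable D (@of_plane R).
Proof.
by split; apply: measurable_funS measurableT _ _ => //;
  [exact: measurable_fst | exact: measurable_snd].
Qed.

Lemma measurable_to_plane d (T : measurableType d) (f : T -> R[i]) :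
  cmeasurable setT f -> measurable_fun setT (fun t => to_plane (f t)).
Proof. by move=> [f1 f2]; apply/measurable_fun_pairP; split. Qed.

Lemma measurable_lt_set d (T : measurableType d) (f g : T -> R) :
  measurable_fun setT f -> measurable_fun setT g ->
  measurable [set t | f t < g t].
Proof.
move=> mf mg; have := measurable_fun_ltr mf mg.
move=> /(_ measurableT [set true] I); rewrite setTI.
by congr measurable; apply/seteqP; split => t /=.
Qed.

Lemma measurable_plane_disc : measurable (@plane_disc R).
Proof.
apply: measurable_lt_set; last exact: measurable_cst.
exact/measurable_normc/cmeasurable_of_plane.
Qed.

End PlaneMeasurable.

(** * Area integrals: Fatou's lemma, rotations, negligible curves *)

Section Fatou.
Context {d : measure_display} {T : measurableType d} {R : realType}.
Variables (mu : {measure set T -> \bar R}) (D : set T) (mD : measurable D).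

(** Comparing with a pointwise lower bound [h] of [f] makes the lemma
    applicable to arithmetic means whose geometric means converge to [g]. *)
Lemma fatou_bound (f : nat -> T -> R) (g : T -> R) (c : \bar R) :
  (forall n, measurable_fun D (f n)) -> (forall n x, D x -> 0 <= f n x) ->
  measurable_fun D g -> (forall x, D x -> 0 <= g x) ->
  {ae mu, forall x, D x ->
    exists2 h : nat -> R, h @ \oo --> g x & forall n, h n <= f n x} ->
  (forall n, (\int[mu]_(x in D) (f n x)%:E <= c)%E) ->
  (\int[mu]_(x in D) (g x)%:E <= c)%E.
Proof.
move=> mf f0 mg g0 fg fc.
have mfE n : measurable_fun D (EFin \o f n) by exact/measurable_EFinP.
apply: (@le_trans _ _ (\int[mu]_(x in D) limn_einf (fun n => (f n x)%:E))%E).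
  apply: ae_ge0_le_integral => //.
  - exact/measurable_EFinP.
  - move=> x Dx; rewrite limn_einf_lim; apply: lime_ge; first exact: is_cvg_einfs.
    apply: nearW => n; apply: le_ereal_inf_tmp => _ [k /= _ <-].
    by rewrite lee_fin f0.
  - rewrite /limn_einf; apply: (measurableT_comp (@oppe_measurable R setT)).
    apply: (@measurable_fun_limn_esup _ _ _ _ (fun n x => - (f n x)%:E)%E) => n.
    exact: (measurableT_comp (@oppe_measurable R setT) (mfE n)).
  - apply: filterS fg => x fg Dx; have [h hg hf] := fg Dx.
    have hgE : (h n)%:E @[n --> \oo] --> (g x)%:E by apply: cvg_EFin; [exact: nearW|exact: hg].
    have [<- _] := cvg_limn_einf_sup hgE.
    rewrite !limn_einf_lim; apply: lee_lim; [exact: is_cvg_einfs..|].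
    apply: nearW => n; apply: le_ereal_inf_tmp => _ [k /= nk <-].
    apply: le_trans (_ : (h k)%:E <= _)%E; last by rewrite lee_fin.
    by apply: ereal_inf_lbound; exists k.
have fE0 n x : D x -> (0 <= (EFin \o f n) x)%E by move=> Dx; rewrite lee_fin f0.
apply: (le_trans (fatou mu mD mfE fE0)).
rewrite limn_einf_lim; apply: lime_le; first exact: is_cvg_einfs.
apply: nearW => n; apply: le_trans (fc n).
by apply: ereal_inf_lbound; exists n => /=.
Qed.

Lemma integral_average_le (I : finType) (f : I -> T -> R) (c : \bar R) :
  (0 < #|I|)%N -> (forall i, measurable_fun D (f i)) -> (forall i x, 0 <= f i x) ->
  (forall i, (\int[mu]_(x in D) (f i x)%:E <= c)%E) ->
  (\int[mu]_(x in D) ((\sum_i f i x) / #|I|%:R)%:E <= c)%E.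
Proof.
move=> I0 mf f0 fc.
have n0 : (0 : R) < #|I|%:R by rewrite ltr0n.
have mfE i : measurable_fun D (fun x => (f i x)%:E) by exact/measurable_EFinP.
have fE0 i x : D x -> (0 <= (f i x)%:E)%E by rewrite lee_fin.
have mS : measurable_fun D (fun x => (\sum_i (f i x)%:E)%E).
  by apply: emeasurable_sum.
have S0 x : D x -> (0 <= \sum_i (f i x)%:E)%E by move=> Dx; apply: sume_ge0 => i _; exact: fE0.
have n0' : (0 <= (#|I|%:R^-1 : R)%:E)%E by rewrite lee_fin invr_ge0 ltW.
rewrite (eq_integral (fun x => (#|I|%:R^-1 : R)%:E * \sum_i (f i x)%:E)%E); last first.
  by move=> x _; rewrite mulrC EFinM sumEFin.
rewrite (ge0_integralZl mu mD mS S0 n0') (ge0_integral_sum mu mD mfE fE0).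
have c0 : (0 <= c)%E.
  have /card_gt0P[i _] := I0; apply: le_trans (fc i).
  by apply: integral_ge0 => x Dx; exact: fE0.
apply: (@le_trans _ _ ((#|I|%:R^-1 : R)%:E * \sum_(i : I) (1%:E * c))%E).
  by rewrite lee_wpmul2l//; apply: lee_sum => i _; rewrite mul1e.
rewrite -ge0_sume_distrl; last by move=> *; exact: lee01.
by rewrite sumEFin sumr_const muleA -EFinM mulVf ?mul1e// gt_eqF.
Qed.

End Fatou.

Section Plane.
Variable R : realType.
Local Notation mu := (@lebesgue_measure R).
Local Notation mu2 := (@lebesgue_measure R \x @lebesgue_measure R)%E.
Implicit Types F : R * R -> \bar R.

Lemma ge0_integral_translate (f : R -> \bar R) (a : R) :
  measurable_fun setT f -> (forall x, (0 <= f x)%E) ->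
  (\int[mu]_x f (x + a)%R = \int[mu]_x f x)%E.
Proof.
move=> mf f0; pose phi (x : measurableTypeR R) : measurableTypeR R := x + a.
have mphi : measurable_fun setT phi.
  by apply: measurable_funD => //; exact: measurable_cst.
transitivity (\int[pushforward mu phi]_x f x)%E.
  by rewrite (ge0_integral_pushforward mphi)// preimage_setT.
apply: eq_measure_integral => A mA _; apply/esym.
apply: (@lebesgue_measure_unique _ (pushforward mu phi)) => //= _ [[x y] _ <-].
rewrite /pushforward /=.
have -> : phi @^-1` `]x, y]%classic = `]x - a, y - a]%classic.
  by apply/seteqP; split => z /=; rewrite !in_itv/= /phi ltrBlDr lerBrDr.
rewrite !lebesgue_measure_itv/= !lte_fin ltrD2r.
by case: ifP => // _; rewrite -!EFinB opprB addrA subrK.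
Qed.

Lemma measurable_pair (f g : R * R -> R) :
  measurable_fun setT f -> measurable_fun setT g ->
  measurable_fun setT (fun u => (f u, g u)).
Proof. by move=> mf mg; apply/measurable_fun_pairP; split. Qed.

Lemma ge0_integral_shear1 F (c : R) :
  measurable_fun setT F -> (forall u, (0 <= F u)%E) ->
  (\int[mu2]_u F ((u.1 + c * u.2)%R, u.2) = \int[mu2]_u F u)%E.
Proof.
move=> mF F0.
have mS : measurable_fun setT (fun u : R * R => (u.1 + c * u.2, u.2)).
  apply: measurable_pair; last exact: measurable_snd.
  apply: measurable_funD; first exact: measurable_fst.
  by apply: measurable_funM; [exact: measurable_cst|exact: measurable_snd].
rewrite !fubini_tonelli2//; last exact: measurableT_comp mF mS.
rewrite /fubini_G; apply: eq_integral => y _ /=.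
apply: (@ge0_integral_translate (fun x => F (x, y))) => //.
exact: measurable_fun_pair1.
Qed.

Lemma ge0_integral_shear2 F (c : R) :
  measurable_fun setT F -> (forall u, (0 <= F u)%E) ->
  (\int[mu2]_u F (u.1, (u.2 + c * u.1)%R) = \int[mu2]_u F u)%E.
Proof.
move=> mF F0.
have mS : measurable_fun setT (fun u : R * R => (u.1, u.2 + c * u.1)).
  apply: measurable_pair; first exact: measurable_fst.
  apply: measurable_funD; first exact: measurable_snd.
  by apply: measurable_funM; [exact: measurable_cst|exact: measurable_fst].
rewrite !fubini_tonelli1//; last exact: measurableT_comp mF mS.
rewrite /fubini_F; apply: eq_integral => x _ /=.
apply: (@ge0_integral_translate (fun y => F (x, y))) => //.
exact: measurable_fun_pair2.
Qed.

Definition rotate (c s : R) (u : R * R) : R * R :=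
  (c * u.1 - s * u.2, s * u.1 + c * u.2).

Lemma measurable_rotate c s : measurable_fun setT (rotate c s).
Proof.
apply: measurable_pair; [apply: measurable_funB|apply: measurable_funD];
  by apply: measurable_funM; [exact: measurable_cst|];
     first [exact: measurable_fst|exact: measurable_snd].
Qed.

(** Away from the half turn a rotation is a product of three shears; the half
    turn is the square of a quarter turn. *)
Lemma ge0_integral_rotate F (c s : R) : c ^+ 2 + s ^+ 2 = 1 ->
  measurable_fun setT F -> (forall u, (0 <= F u)%E) ->
  (\int[mu2]_u F (rotate c s u) = \int[mu2]_u F u)%E.
Proof.
move=> cs1 mF F0.
have gen c' s' G : c' ^+ 2 + s' ^+ 2 = 1 -> c' != -1 ->
    measurable_fun setT G -> (forall u, (0 <= G u)%E) ->
    (\int[mu2]_u G (rotate c' s' u) = \int[mu2]_u G u)%E.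
  move=> e c1 mG G0; pose k := - (s' / (1 + c')).
  have c0 : 1 + c' != 0 by rewrite addrC addr_eq0.
  have mSh (f : R * R -> R * R) : measurable_fun setT f ->
    measurable_fun setT (fun u => G (f u)) by move=> mf; exact: measurableT_comp mG mf.
  have mS1 (k' : R) : measurable_fun setT (fun u : R * R => (u.1 + k' * u.2, u.2)).
    apply: measurable_pair; last exact: measurable_snd.
    apply: measurable_funD; first exact: measurable_fst.
    by apply: measurable_funM; [exact: measurable_cst|exact: measurable_snd].
  have mS2 (k' : R) : measurable_fun setT (fun u : R * R => (u.1, u.2 + k' * u.1)).
    apply: measurable_pair; first exact: measurable_fst.
    apply: measurable_funD; first exact: measurable_snd.
    by apply: measurable_funM; [exact: measurable_cst|exact: measurable_fst].
  rewrite -[RHS](@ge0_integral_shear1 _ k)//.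
  rewrite -[RHS](@ge0_integral_shear2 _ s')//; last exact: mSh.
  rewrite -[RHS](@ge0_integral_shear1 _ k)//; last first.
    exact: (mSh _ (measurableT_comp (mS1 k) (mS2 s'))).
  apply: eq_integral => u _ /=; congr G; rewrite /rotate.
  have ks : 1 + k * s' = c'.
    rewrite /k mulNr mulrAC -expr2 (_ : s' ^+ 2 = (1 - c') * (1 + c')).
      by rewrite mulfK// opprB addrC subrK.
    by rewrite (_ : s' ^+ 2 = 1 - c' ^+ 2); [ring|rewrite -e; ring].
  have kk : k + c' * k = - s'.
    by rewrite /k mulrN -opprD -{1}[s' / _]mul1r -mulrDl mulrC divfK.
  have -> : u.2 + s' * (u.1 + k * u.2) = s' * u.1 + c' * u.2 by rewrite -ks; ring.
  congr (_, _); rewrite -mulNr -kk -ks; ring.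
have [c1|] := eqVneq c (-1); last by move=> c1; exact: gen.
have s0 : s = 0.
  by apply/eqP; rewrite -sqrf_eq0; apply/eqP; move: cs1; rewrite c1; lra.
have q1 : (0 : R) ^+ 2 + 1 ^+ 2 = 1 by rewrite expr0n expr1n add0r.
have q2 : (0 : R) != -1 by rewrite eq_sym oppr_eq0 oner_eq0.
rewrite -[RHS](gen 0 1)// -[RHS](gen 0 1)//; last first.
  exact: measurableT_comp mF (measurable_rotate _ _).
apply: eq_integral => u _; congr F.
by rewrite /rotate c1 s0 /=; congr (_, _); ring.
Qed.

(** On each vertical line the curve has at most two points. *)
Lemma quadratic_curve_null (A : R) (B C : R -> R) : A != 0 ->
  measurable_fun setT B -> measurable_fun setT C ->
  mu2 [set u | A * u.2 ^+ 2 + B u.1 * u.2 + C u.1 == 0] = 0%E.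
Proof.
move=> A0 mB mC; set E := [set u | _].
have mE : measurable E.
  pose f (u : R * R) := A * u.2 ^+ 2 + B u.1 * u.2 + C u.1.
  have mf : measurable_fun setT f.
    apply: measurable_funD.
      apply: measurable_funD; apply: measurable_funM.
      - exact: measurable_cst.
      - by apply: measurable_funX; exact: measurable_snd.
      - exact: measurableT_comp mB measurable_fst.
      - exact: measurable_snd.
    exact: measurableT_comp mC measurable_fst.
  have := mf measurableT [set 0] (measurable_set1 _); rewrite setTI.
  by congr measurable; apply/seteqP; split => u /= /eqP.
rewrite /product_measure1 /=; apply: integral0_eq => x _ /=.
apply: countable_lebesgue_measure0.
have [[y0 Ey0]|noE] := pselect (exists y, xsection E x y); last first.
  rewrite (_ : xsection E x = set0); first exact: countable0.
  by apply/seteqP; split => y // Ey; apply: noE; exists y.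
apply: finite_set_countable.
apply: (@sub_finite_set _ _ [set y0; - (B x / A) - y0]); last exact: finite_set2.
move=> y; move: Ey0; rewrite /xsection /= !inE /E /= => /eqP e0 /eqP e.
have [->|yy0] := eqVneq y y0; [by left|right].
apply: (mulfI A0); apply/eqP; rewrite -subr_eq0 mulrBr mulrN (mulrC A (_ / _)) divfK//.
have yy0' : y - y0 != 0 by rewrite subr_eq0.
rewrite -(mulrI_eq0 _ (mulfI yy0')); apply/eqP; rewrite -[RHS](subrr 0) -{1}e -e0 /=; ring.
Qed.

Lemma area_sigma_finite : sigma_finite setT mu2.
Proof.
have /sigma_finiteP[F [TF ndF Foo]] := sigma_finiteT mu.
exists (fun n => F n `*` F n).
  rewrite -setXTT TF predeqE => -[x y]; split.
    move=> [/= [n _ Fnx] [k _ Gky]]; exists (maxn n k) => //; split.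
    - by move: x Fnx; exact/subsetPset/ndF/leq_maxl.
    - by move: y Gky; exact/subsetPset/ndF/leq_maxr.
  by move=> [n _ []/= ? ?]; split; exists n.
move=> k; have [? ?] := Foo k.
split; first exact: measurableX.
by rewrite product_measure1E// lte_mul_pinfty// ge0_fin_numE.
Qed.

(** The product measure with its sigma-finite structure, for which Tonelli's
    theorem holds on pairs of points of the plane. *)
Definition area : {sigma_finite_measure set _ -> \bar R} :=
  HB.pack_for {sigma_finite_measure set _ -> \bar R} mu2
    (Measure_isSigmaFinite.Build _ _ _ mu2 area_sigma_finite).

Lemma area_tonelli (K : (R * R) * (R * R) -> \bar R) :
  measurable_fun setT K -> (forall t, 0 <= K t)%E ->
  [/\ measurable_fun setT (fun a => \int[mu2]_z K (a, z))%E,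
      measurable_fun setT (fun z => \int[mu2]_a K (a, z))%E &
    (\int[mu2]_a \int[mu2]_z K (a, z) = \int[mu2]_z \int[mu2]_a K (a, z))%E].
Proof.
move=> mK K0; split.
- exact: (measurable_fun_fubini_tonelli_F (m2 := area) K mK K0).
- exact: (measurable_fun_fubini_tonelli_G (m1 := area) K mK K0).
- exact: (fubini_tonelli (m1 := area) (m2 := area) K mK K0).
Qed.

End Plane.

(** * The sub-mean value property of polynomials *)

Section SubMean.
Variable R : realType.
Local Notation mu := (@lebesgue_measure R).
Local Notation mu2 := (@lebesgue_measure R \x @lebesgue_measure R)%E.
Implicit Types (F : R * R -> \bar R) (q : {poly R[i]}).

Lemma ge0_integral_translate2 F (a : R * R) :
  measurable_fun setT F -> (forall u, (0 <= F u)%E) ->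
  (\int[mu2]_u F (u.1 + a.1, u.2 + a.2)%R = \int[mu2]_u F u)%E.
Proof.
move=> mF F0.
have mS : measurable_fun setT (fun u : R * R => (u.1 + a.1, u.2 + a.2)).
  by apply: measurable_pair; apply: measurable_funD;
    first [exact: measurable_cst|exact: measurable_fst|exact: measurable_snd].
rewrite !fubini_tonelli1//; last exact: measurableT_comp mF mS.
rewrite /fubini_F /=.
rewrite (ge0_integral_translate (f := fun x => \int[mu]_y F (x, y + a.2)%R)%E).
- apply: eq_integral => x _.
  by rewrite (ge0_integral_translate (f := fun y => F (x, y)))//; exact: measurable_fun_pair2.
- rewrite (_ : (fun _ => _) = (fun x => \int[mu]_y F (x, y))%E).
    exact: measurable_fun_fubini_tonelli_F.
  apply/funext => x.
  by rewrite (ge0_integral_translate (f := fun y => F (x, y)))//; exact: measurable_fun_pair2.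
- by move=> x; apply: integral_ge0 => y _.
Qed.

Definition square (c : R * R) (h : R) : set (R * R) :=
  `]c.1 - h, c.1 + h[%classic `*` `]c.2 - h, c.2 + h[%classic.

Lemma measurable_square c h : measurable (square c h).
Proof. by apply: measurableX; exact: measurable_itv. Qed.

Lemma area_square c h : 0 <= h -> mu2 (square c h) = ((2 * h) ^+ 2)%:E.
Proof.
move=> h0; rewrite product_measure1E; [|exact: measurable_itv..].
have l x : mu `]x - h, x + h[%classic = (2 * h)%:E.
  rewrite lebesgue_measure_itv/= lte_fin.
  case: ifPn => [_|]; first by rewrite -EFinB; congr EFin; ring.
  by rewrite -leNgt => xh; congr EFin; move: xh h0; lra.
rewrite expr2 EFinM; congr (_ * _)%E; exact: l.
Qed.

Lemma measurable_normc_lt d (T : measurableType d) (f : T -> R[i]) (g : T -> R) :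
  cmeasurable setT f -> measurable_fun setT g ->
  measurable [set u | normc (f u) < g u].
Proof. by move=> mf mg; apply: measurable_lt_set => //; exact: measurable_normc. Qed.

Definition plane_ball (c : R[i]) (r : R) : set (R * R) :=
  [set u | normc (of_plane u - c) < r].

Lemma measurable_plane_ball c r : measurable (plane_ball c r).
Proof.
apply: measurable_normc_lt; last exact: measurable_cst.
by apply: cmeasurableB; [exact: cmeasurable_of_plane|exact: cmeasurable_cst].
Qed.

(** The ball contains a square of side [r]. *)
Lemma area_plane_ball_ge c r : 0 < r -> ((r ^+ 2)%:E <= mu2 (plane_ball c r))%E.
Proof.
move=> r0; have h0 : 0 <= r / 2 by rewrite divr_ge0// ltW.
have -> : r ^+ 2 = (2 * (r / 2)) ^+ 2 by congr (_ ^+ 2); rewrite mulrC divfK.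
rewrite -(area_square (to_plane c) h0).
apply: le_measure; rewrite ?inE; [exact: measurable_square|exact: measurable_plane_ball|].
move=> -[x y]; case: c => c1 c2; rewrite /square /= !in_itv/= => -[/andP[x1 x2] /andP[y1 y2]].
rewrite /plane_ball /=.
rewrite -(@ltr_pXn2r _ 2)// ?nnegrE ?sqrtr_ge0 ?ltW// sqr_sqrtr ?addr_ge0 ?sqr_ge0//.
have hx : (x - c1) ^+ 2 < (r / 2) ^+ 2.
  rewrite -real_normK ?num_real// ltr_pXn2r ?nnegrE// ltr_norml; move: x1 x2; lra.
have hy : (y - c2) ^+ 2 < (r / 2) ^+ 2.
  rewrite -real_normK ?num_real// ltr_pXn2r ?nnegrE// ltr_norml; move: y1 y2; lra.
have r2 : 0 < r ^+ 2 by rewrite exprn_gt0.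
by move: hx hy; rewrite expr_div_n; lra.
Qed.

Lemma powR_prod (I : Type) (s : seq I) (f : I -> R) (p : R) :
  (forall i, 0 <= f i) ->
  \prod_(i <- s) f i `^ p = (\prod_(i <- s) f i) `^ p.
Proof.
move=> f0; elim: s => [|i s IH]; first by rewrite !big_nil powR1.
by rewrite !big_cons IH powRM// prodr_ge0.
Qed.

Lemma powRXn (x p : R) n : 0 <= x -> (x `^ p) ^+ n = (x ^+ n) `^ p.
Proof.
move=> x0; elim: n => [|n IH]; first by rewrite !expr0 powR1.
by rewrite !exprS IH powRM// exprn_ge0.
Qed.

Lemma ae_notin (E : set (R * R)) : measurable E -> mu2 E = 0%E ->
  {ae mu2, forall u, ~ E u}.
Proof. by move=> mE E0; exists E; split => // u /= /contrapT. Qed.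

#[global] Instance plane_ae_filter : Filter (nbhs (almost_everywhere mu2)) :=
  ae_filter_ringOfSetsType _.

Lemma ae_all_seq (I : eqType) (s : seq I) (P : I -> R * R -> Prop) :
  (forall i, i \in s -> {ae mu2, forall u, P i u}) ->
  {ae mu2, forall u, forall i, i \in s -> P i u}.
Proof.
elim: s => [|i s IH] H; first by apply: aeW => u i.
have h1 := H i (mem_head _ _).
have h2 := IH (fun j js => H j (mem_behead (s := i :: s) js)).
apply: filterS2 h1 h2 => u Pi Ps j; rewrite inE => /predU1P[->|]; [exact: Pi|exact: Ps].
Qed.

Lemma ae_normc_neq (r : R) : {ae mu2, forall u, normc (of_plane u) != r}.
Proof.
have m2 : measurable_fun setT (fun x : R => x ^+ 2 - r ^+ 2).
  apply: measurable_funB; last exact: measurable_cst.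
  by apply: measurable_funX; exact: measurable_id.
have := @quadratic_curve_null R 1 (fun=> 0) _ (oner_neq0 _) (measurable_cst _) m2.
set E := [set u | _] => E0.
have mE : measurable E.
  rewrite (_ : E = (fun u : R * R => 1 * u.2 ^+ 2 + 0 * u.1 + (u.1 ^+ 2 - r ^+ 2)) @^-1` [set 0]).
    rewrite -[X in measurable X]setTI; apply: (_ : measurable_fun setT _) => //.
    repeat first [apply: measurable_funD | apply: measurable_funB
      | apply: measurable_funM | apply: measurable_funX
      | exact: measurable_cst | exact: measurable_fst | exact: measurable_snd].
  by apply/seteqP; split => u; rewrite /E /= !mul0r => /eqP.
apply: filterS (ae_notin mE E0) => u nE; apply/negP => /eqP nr; apply: nE.
by rewrite /E /mkset -nr normc_sqr; apply/eqP => /=; ring.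
Qed.

Lemma ge0_integral_rotate_ball F (r : R) (om : R[i]) : normc om = 1 ->
  measurable_fun setT F -> (forall u, (0 <= F u)%E) ->
  (\int[mu2]_(u in plane_ball 0%R r) F (to_plane (om * of_plane u)%R) =
   \int[mu2]_(u in plane_ball 0%R r) F u)%E.
Proof.
move=> om1 mF F0; rewrite integral_mkcond [RHS]integral_mkcond.
rewrite -[RHS](@ge0_integral_rotate _ _ (complex.Re om) (complex.Im om)).
- apply: eq_integral => u _; rewrite !patchE.
  have -> : rotate (complex.Re om) (complex.Im om) u = to_plane (om * of_plane u).
    by case: u; case: om {om1} => c s x y; rewrite /rotate /to_plane /= [X in (_, X)]addrC.
  have -> : (to_plane (om * of_plane u) \in plane_ball 0 r) = (u \in plane_ball 0 r).
    by apply/idP/idP; rewrite !inE /plane_ball /mkset !subr0 to_planeK normcM om1 mul1r.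
  by [].
- by rewrite -normc_sqr om1 expr1n.
- by apply/(measurable_restrictT _ (measurable_plane_ball _ _)); exact: measurable_funS mF.
- by move=> u; rewrite patchE; case: ifP.
Qed.

(** By the roots of unity, the geometric mean of [normc q.[z + om * u]] over
    [om ^+ N = 1] is explicit: each root of [q] contributes the [N]-th root of
    a difference of two [N]-th powers, whose limit is a maximum. *)
Lemma poly_unity_mean_ge q (p : R) (z : R[i]) (u : R[i]) : 0 < p ->
  (forall c, root q c -> normc u != normc (c - z)) ->
  exists2 k : R, 0 < k & forall (N : nat) (om : 'I_N -> R[i]), (0 < N)%N ->
    (forall x y, \prod_i (x - om i * y) = x ^+ N - y ^+ N) ->
    normc q.[z] `^ p * k `^ N%:R^-1 <=
      (\sum_i normc q.[z + om i * u] `^ p) / N%:R.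
Proof.
move=> p0 qu.
have [q0|q0] := eqVneq q 0.
  exists 1 => // N om N0 _; rewrite q0 horner0 normc0 powR0 ?gt_eqF// mul0r.
  by rewrite divr_ge0// sumr_ge0// => i _; exact: powR_ge0.
have [rs Eq] := closed_field_poly_normal q.
have lead0 : lead_coef q != 0 by rewrite lead_coef_eq0.
have Hq x : q.[x] = lead_coef q * \prod_(c <- rs) (x - c).
  by rewrite {1}Eq hornerZ horner_prod; under eq_bigr do rewrite hornerXsubC.
have rrs c : c \in rs -> root q c by rewrite Eq rootZ// root_prod_XsubC.
have [k k0 hk] : exists2 k : R, 0 < k & forall N, (0 < N)%N ->
    (\prod_(c <- rs) normc (z - c)) ^+ N * k <=
    \prod_(c <- rs) normc ((c - z) ^+ N - u ^+ N).
  have {}qu c : c \in rs -> normc (c - z) != normc u.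
    by move=> /rrs/qu; rewrite eq_sym.
  elim: {Eq Hq rrs} rs qu => [|c rs IH] qu.
    by exists 1 => // N _; rewrite !big_nil expr1n mul1r.
  have [|k1 k10 hk1] := IH; first by move=> d ds; rewrite qu// inE ds orbT.
  have [k2 k20 hk2] := normc_expB_ge (qu c (mem_head _ _)).
  exists (k2 * k1) => [|N N0]; first exact: mulr_gt0.
  rewrite !big_cons exprMn mulrACA; apply: ler_pM.
  - by rewrite mulr_ge0 ?exprn_ge0 ?normc_ge0// ltW.
  - by rewrite mulr_ge0 ?exprn_ge0 ?prodr_ge0// ?ltW// => i _; exact: normc_ge0.
  - apply: le_trans (hk2 N N0); rewrite ler_wpM2r ?(ltW k20)//.
    by rewrite lerXn2r ?nnegrE ?normc_ge0 ?le_max ?normc_ge0//= normc_distC lexx.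
  - exact: hk1.
exists (k `^ p) => [|N om N0 omE]; first exact: powR_gt0.
have := @AGM_ge R 'I_N (fun i => normc q.[z + om i * u] `^ p) (normc q.[z] `^ p) (k `^ p).
rewrite card_ord; apply; rewrite ?powR_ge0//=.
  by move=> i; exact: powR_ge0.
have -> : \prod_i normc q.[z + om i * u] `^ p =
    (\prod_i normc q.[z + om i * u]) `^ p.
  by apply: powR_prod => i; exact: normc_ge0.
have -> : \prod_i normc q.[z + om i * u] =
    normc (lead_coef q) ^+ N * \prod_(c <- rs) normc ((c - z) ^+ N - u ^+ N).
  under eq_bigr do rewrite Hq normcM normc_prod.
  rewrite big_split /= prodr_const card_ord; congr (_ * _).
  rewrite exchange_big /=; apply: eq_bigr => d _.
  rewrite -omE normc_prod; apply: eq_bigr => i _.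
  by rewrite normc_distC; congr normc; ring.
rewrite powRXn ?normc_ge0//.
rewrite -powRM ?exprn_ge0 ?normc_ge0 ?(ltW k0)//.
apply: ge0_ler_powR; rewrite ?nnegrE ?(ltW p0) ?mulr_ge0 ?exprn_ge0 ?normc_ge0 ?(ltW k0)//.
  by rewrite prodr_ge0// => i _; exact: normc_ge0.
rewrite Hq normcM normc_prod exprMn -mulrA ler_wpM2l ?exprn_ge0 ?normc_ge0//.
exact: hk.
Qed.

Lemma cvg_powR_invn (k : R) : 0 < k -> k `^ (n.+1%:R^-1) @[n --> \oo] --> (1 : R).
Proof.
move=> k0.
rewrite (_ : (fun _ => _) = (fun n : nat => expR (n.+1%:R^-1 * ln k))); last first.
  by apply/funext => n; rewrite /powR gt_eqF.
rewrite -[X in _ --> X]expR0 -[X in expR X](mul0r (ln k)).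
apply: continuous_cvg; first exact: continuous_expR.
by apply: cvgM; [exact: cvg_harmonic|exact: cvg_cst].
Qed.

(** The mean of [normc q `^ p] over the ball is also the mean of its averages
    over the [N]-th roots of unity around [z], which dominate geometric means;
    by Fatou's lemma the limit of large [N] gives [normc q.[z] `^ p]. The
    factor [r ^+ 2] stands for the area of the ball. *)
Lemma submean_poly q (p r : R) (z : R[i]) : 0 < p -> 0 < r ->
  ((r ^+ 2 * normc q.[z] `^ p)%:E <=
   \int[mu2]_(u in plane_ball z r) (normc q.[of_plane u] `^ p)%:E)%E.
Proof.
move=> p0 r0.
have mN (f : R * R -> R[i]) : cmeasurable setT f ->
    measurable_fun setT (fun u => normc q.[f u] `^ p).
  move=> mf; apply: (measurableT_comp (measurable_powR _)).
  exact/measurable_normc/cmeasurable_horner.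
have mtr : cmeasurable setT (fun u => z + of_plane u : R[i]).
  by apply: cmeasurableD; [exact: cmeasurable_cst|exact: cmeasurable_of_plane].
have -> : (\int[mu2]_(u in plane_ball z r) (normc q.[of_plane u] `^ p)%:E)%E =
    (\int[mu2]_(u in plane_ball 0%R r) (normc q.[z + of_plane u] `^ p)%:E)%E.
  rewrite integral_mkcond [RHS]integral_mkcond.
  rewrite -(ge0_integral_translate2 (to_plane z)).
  - apply: eq_integral => u _; rewrite !patchE.
    have -> : (u.1 + (to_plane z).1, u.2 + (to_plane z).2) = to_plane (z + of_plane u).
      by case: z {mtr} => z1 z2; rewrite /to_plane /= addrC [X in (_, X)]addrC.
    rewrite to_planeK.
    have -> // : (to_plane (z + of_plane u) \in plane_ball z r) = (u \in plane_ball 0 r).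
    by apply/idP/idP; rewrite !inE /plane_ball /mkset subr0 to_planeK addrC addKr.
  - apply/(measurable_restrictT _ (measurable_plane_ball _ _)).
    by apply/measurable_EFinP; apply: measurable_funS (mN _ (cmeasurable_of_plane _)).
  - by move=> u; rewrite patchE; case: ifP => // _; rewrite lee_fin powR_ge0.
have mB := measurable_plane_ball 0 r.
apply: (@le_trans _ _ (\int[mu2]_(u in plane_ball 0%R r) (normc q.[z] `^ p)%:E)%E).
  rewrite integral_cst// muleC EFinM lee_wpmul2r ?lee_fin ?powR_ge0//.
  exact: area_plane_ball_ge.
pose om n := sval (cid (@unity_roots_exist R n.+1 (ltn0Sn n))).
have omP n := svalP (cid (@unity_roots_exist R n.+1 (ltn0Sn n))).
have nom n i : normc (om n i) = 1.
  by apply: (@normc_unity_root _ n.+1) => //; case: (omP n) => + _; apply.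
pose f n u := (\sum_(i < n.+1) normc q.[z + om n i * of_plane u] `^ p) / n.+1%:R.
have mterm (a : R[i]) : measurable_fun setT (fun u => normc q.[z + a * of_plane u] `^ p).
  apply: mN; apply: cmeasurableD; first exact: cmeasurable_cst.
  by apply: cmeasurableM; [exact: cmeasurable_cst|exact: cmeasurable_of_plane].
have f0 n u : 0 <= f n u.
  by rewrite divr_ge0// sumr_ge0// => i _; exact: powR_ge0.
apply: (@fatou_bound _ _ _ mu2 _ mB f (fun=> normc q.[z] `^ p)) => //.
- move=> n; apply: measurable_funS measurableT _ _ => //.
  apply: measurable_funM; last exact: measurable_cst.
  by apply: measurable_sum => i; exact: mterm.
- by move=> u _; exact: powR_ge0.
- have [->|q0] := eqVneq q 0.
    apply: aeW => u _; exists (fun=> 0) => //.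
    by rewrite horner0 normc0 powR0 ?gt_eqF//; exact: cvg_cst.
  have [rs Eq] := closed_field_poly_normal q.
  (* The limit of the geometric means is only known when no root of [q] lies
     on the circle through [z + u]. *)
  have : {ae mu2, forall u, forall c, c \in rs -> normc (of_plane u) != normc (c - z)}.
    by apply: ae_all_seq => c _; exact: ae_normc_neq.
  apply: filterS => u hu _.
  have [|k k0 hk] := @poly_unity_mean_ge q p z (of_plane u) p0.
    by move=> c; rewrite Eq rootZ ?lead_coef_eq0// root_prod_XsubC; exact: hu.
  exists (fun n => normc q.[z] `^ p * k `^ n.+1%:R^-1) => [|n].
    rewrite -[X in _ --> X]mulr1; apply: cvgM; first exact: cvg_cst.
    exact: cvg_powR_invn.
  by apply: hk => //; case: (omP n).
- move=> n; rewrite /f.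
  have := @integral_average_le _ _ _ mu2 _ mB 'I_n.+1
    (fun i u => normc q.[z + om n i * of_plane u] `^ p)
    (\int[mu2]_(u in plane_ball 0%R r) (normc q.[z + of_plane u] `^ p)%:E)%E.
  rewrite card_ord; apply; first by [].
  + by move=> i; apply: measurable_funS measurableT _ _ => //; exact: mterm.
  + by move=> i u; exact: powR_ge0.
  move=> i.
  rewrite -(@ge0_integral_rotate_ball (fun u => (normc q.[z + of_plane u] `^ p)%:E) r _ (nom n i)).
  + by rewrite le_eqVlt; apply/orP; left; apply/eqP; apply: eq_integral => u _; rewrite to_planeK.
  + by apply/measurable_EFinP; exact: mN.
  + by move=> u; rewrite lee_fin powR_ge0.
Qed.

End SubMean.

(** * Invariant weights *)

Section InvariantWeight.
Variable R : realType.
Local Notation mu2 := (@lebesgue_measure R \x @lebesgue_measure R)%E.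
Implicit Types (w W : R[i] -> R) (a b z : R[i]).

(** A general invariant weight is only comparable to a weight of this form;
    being Borel, the latter turns the means of analytic functions into
    integrals of Borel functions, to which the convergence theorems and
    Tonelli's theorem apply. *)
Record borel_invariant W (r C : R) : Prop := BorelInvariant {
  binv_meas : measurable_fun setT (fun u : R * R => W (of_plane u));
  binv_ge0 : forall z, 0 <= W z;
  binv_gt0 : forall z, disc z -> 0 < W z;
  binv_r0 : 0 < r;
  binv_r12 : r <= 2^-1;
  binv_C1 : 1 <= C;
  binv_le : forall a z, disc a -> pseudohyperbolic_disc a r z -> W a <= C * W z }.

Lemma measurable_countable_cover d (T : measurableType d) d' (U : measurableType d')
    (F : nat -> set T) (f : T -> U) :
  (forall n, measurable (F n)) -> \bigcup_n F n = setT ->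
  (forall n t t', F n t -> F n t' -> f t = f t') -> measurable_fun setT f.
Proof.
move=> mF FT Fc _ Y mY; rewrite -FT setI_bigcupl.
apply: bigcup_measurable => n _.
have [[t [Ft fY]]|no] := pselect (exists t, F n t /\ Y (f t)).
  rewrite (_ : _ `&` _ = F n)//; apply/seteqP; split => [s []//|s Fs]; split => //.
  by rewrite /preimage /= (Fc n s t).
rewrite (_ : _ `&` _ = set0)//; apply/seteqP; split => // s [Fs Ys].
by apply: no; exists s.
Qed.

(** [W z] is the value of [w] at the first rational point that is
    pseudohyperbolically close to [z]: a function with countably many values,
    each taken on a Borel set. *)
Lemma borel_comparable_weight w : invariant_weight w ->
  exists W r C, borel_invariant W r C /\
    forall z, disc z -> w z <= C * W z /\ W z <= C * w z.
Proof.
move=> [[w0 _] [r1 [r10 r11 [C C1 Cw]]]].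
pose r := Num.min r1 2^-1.
have r0 : 0 < r by rewrite lt_min r10 invr_gt0 ltr0n.
have rr1 : r <= r1 by rewrite ge_min lexx.
have r12 : r <= 2^-1 by rewrite ge_min lexx orbT.
have C0 : 0 < C := lt_le_trans ltr01 C1.
have Cinv a z : disc a -> pseudohyperbolic_disc a r z -> w a <= C * w z /\ w z <= C * w a.
  move=> ha [hz az]; have [|h1 h2] := Cw a z ha; first by split => //; exact: lt_le_trans rr1.
  by split => //; rewrite -ler_pdivrMl.
pose d (n : nat) : R[i] :=
  if unpickle n is Some (x, y) then (ratr x : R) +i* (ratr y : R) else 0.
pose good n z := disc (d n) /\ pseudohyperbolic_disc (d n) r z.
have goodP z : disc z -> exists n, good n z.
  rewrite /disc/= => hz; pose e := r * (1 - normc z) / 2.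
  have e0 : 0 < e by rewrite /e divr_gt0// mulr_gt0// subr_gt0.
  have rat1 (x : R) : exists q : rat, `|ratr q - x| < e.
    have [|q] := @rat_in_itvoo R (x - e) (x + e); first by rewrite ltrD2l gtrN.
    rewrite in_itv/= => /andP[q1 q2]; exists q.
    by rewrite ltr_distl q1 q2.
  have [q1 hq1] := rat1 (complex.Re z); have [q2 hq2] := rat1 (complex.Im z).
  exists (pickle (q1, q2)); rewrite /good /d pickleK.
  set c := _ +i* _; have cz : normc (c - z) < r * (1 - normc z).
    apply: le_lt_trans (normc_le_ReIm _) _.
    rewrite [ltRHS](_ : _ = e + e); first by rewrite ltrD//; case: (z) hq1 hq2.
    by rewrite /e; field.
  have r1' : r < 1 by apply: le_lt_trans r12 _; lra.
  have hc : disc c.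
    have := le_normcD (c - z) z; rewrite subrK => cz'; apply: le_lt_trans cz' _.
    rewrite -ltrBrDr; apply: lt_le_trans cz _.
    by rewrite ler_piMl ?subr_ge0 ?(ltW hz)// ltW.
  split => //; split => //; rewrite /mobius normcM normcV.
  have den : 1 - normc z <= normc (1 - c^* * z).
    apply: le_trans (lerB_normc _ _); rewrite normc1 lerD2l lerN2 normcM normcC.
    by rewrite ler_piMl ?normc_ge0// ltW.
  have den0 : 0 < normc (1 - c^* * z) by apply: lt_le_trans den; rewrite subr_gt0.
  by rewrite ltr_pdivrMr// (lt_le_trans cz)// ler_wpM2l// ltW.
have /choice[idx idxP] : forall z, exists o : option nat,
    if o is Some n then good n z /\ (forall m, good m z -> (n <= m)%N)
    else forall n, ~ good n z.
  move=> z; have [ex|nex] := pselect (exists n, good n z).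
    by have [n [gn hn]] := nat_has_minimum ex; exists (Some n).
  by exists None => n gn; apply: nex; exists n.
pose W z := oapp (fun n => w (d n)) 0 (idx z).
have WP z : disc z -> exists2 n, good n z & W z = w (d n).
  move=> /goodP[n gn]; rewrite /W; move: (idxP z).
  by case: (idx z) => [m [gm _]|/(_ n)//]; exists m.
have W_w z : disc z -> w z <= C * W z /\ W z <= C * w z.
  move=> /WP[n [dn gn] ->]; have [h1 h2] := Cinv _ _ dn gn; by split.
pose G n := [set u : R * R | good n (of_plane u)].
have mG n : measurable (G n).
  have [dn|ndn] := pselect (disc (d n)); last first.
    by rewrite (_ : G n = set0)//; apply/seteqP; split => u // [].
  rewrite (_ : G n = @plane_disc R `&` [set u | normc (mobius (d n) (of_plane u)) < r]).
    apply: measurableI; first exact: measurable_plane_disc.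
    apply: measurable_normc_lt; last exact: measurable_cst.
    by apply: cmeasurable_mobius; [exact: cmeasurable_cst|exact: cmeasurable_of_plane].
  by apply/seteqP; split => u; [case=> _ []|case].
pose F n := if n is m.+1 then G m `\` \bigcup_(k < m) G k else ~` \bigcup_k G k.
have idxF0 u : F 0%N u -> idx (of_plane u) = None.
  move=> nG; move: (idxP (of_plane u)); case: (idx _) => // n [gn _].
  by exfalso; apply: nG; exists n.
have idxFS n u : F n.+1 u -> idx (of_plane u) = Some n.
  move=> [gn nG]; move: (idxP (of_plane u)); case: (idx _) => [m [gm hm]|/(_ n)//].
  congr Some; apply/eqP; rewrite eqn_leq hm//= leqNgt; apply/negP => mn.
  by apply: nG; exists m.
exists W, r, (C * C * C); split; last first.
  have CC : C <= C * C * C by rewrite -mulrA ler_peMr ?(ltW C0)// mulr_ege1.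
  move=> z hz; have [h1 h2] := W_w z hz; split.
    by apply: le_trans h1 _; rewrite ler_wpM2r//; have [n [dn _] ->] := WP z hz; exact/ltW/w0.
  by apply: le_trans h2 _; rewrite ler_wpM2r//; exact/ltW/w0.
split => //.
- apply: (@measurable_countable_cover _ _ _ _ F).
  + move=> [|n]; rewrite /F.
      by apply: measurableC; apply: bigcup_measurable => k _; exact: mG.
    by apply: measurableD => //; apply: bigcup_measurable => k _; exact: mG.
  + apply/seteqP; split => // u _; move: (idxP (of_plane u)).
    case: (idx _) => [n [gn hn]|nG].
      by exists n.+1 => //; split => // -[k /= kn gk]; move: (hn k gk); rewrite leqNgt kn.
    by exists 0%N => // -[k _ gk]; exact: (nG k).
  + move=> [|n] t t'; first by move=> /idxF0 h /idxF0 h'; rewrite /W h h'.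
    by move=> /idxFS h /idxFS h'; rewrite /W h h'.
- move=> z; rewrite /W; move: (idxP z); case: (idx z) => [n [[dn _] _]|_] //=.
  exact/ltW/w0.
- by move=> z /WP[n [dn _] ->]; exact: w0.
- by rewrite !mulr_ege1// mulr_ege1.
- move=> a z ha az; have hz : disc z by case: az.
  have [_ h1] := W_w a ha; have [h2 _] := Cinv a z ha az; have [h3 _] := W_w z hz.
  apply: le_trans h1 _; rewrite -!mulrA ler_wpM2l ?(ltW C0)//.
  apply: le_trans h2 _; by rewrite ler_wpM2l ?(ltW C0).
Qed.

(** The point [mobius a b] is reached from [a] by a chain of pseudohyperbolic
    steps of fixed length, whose number is of the order of [- ln (1 - normc b)];
    each step costs a factor [C], whence a power of [1 - normc b]. *)
Lemma invariant_weight_growth W r C : borel_invariant W r C ->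
  exists K : nat, forall a b, disc a -> disc b ->
    W a * (1 - normc b) ^+ K <= C * W (mobius a b).
Proof.
move=> bW; have r0 := binv_r0 bW; have r12 := binv_r12 bW; have C1 := binv_C1 bW.
pose dl := r / 2; have dl0 : 0 < dl by rewrite divr_gt0.
have dlr : dl < r by rewrite /dl; move: r0; lra.
have dl1 : dl < 1 by apply: lt_le_trans dlr _; apply: le_trans r12 _; lra.
have C0 : 0 < C := lt_le_trans ltr01 C1.
have [K hK] : exists K, C * (1 - dl) ^+ K <= 1.
  have [K hK] : exists K, (1 - dl) ^+ K < C^-1.
    have : (1 - dl) ^+ n @[n --> \oo] --> 0.
      by apply: cvg_expr; rewrite ger0_norm; move: dl0 dl1; lra.
    move=> /cvgr_lt/(_ C^-1); rewrite invr_gt0 => /(_ C0) [n _ hn].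
    by exists n; apply: hn => /=.
  by exists K; rewrite mulrC -ler_pdivlMr// div1r ltW.
exists K => a b ha hb.
have [n] : exists n, (1 - dl) ^+ n <= 1 - normc b.
  have : (1 - dl) ^+ n @[n --> \oo] --> 0.
    by apply: cvg_expr; rewrite ger0_norm; move: dl0 dl1; lra.
  have b0 : 0 < 1 - normc b by rewrite subr_gt0.
  by move=> /cvgr_le/(_ _ b0) [n _ hn]; exists n; apply: hn => /=.
elim: n b hb => [|n IH] b hb hn.
  have -> : b = 0.
    apply/eqP; rewrite -normc_eq0 eq_le normc_ge0 andbT.
    by move: hn; rewrite expr0; lra.
  rewrite normc0 subr0 expr1n mulr1 mobius0 ler_peMl//; exact: binv_ge0 bW _.
have x1 : normc b < 1 := hb.
have [small|big] := leP (normc b) dl.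
  apply: (@le_trans _ _ (W a)).
    rewrite ler_piMr ?(binv_ge0 bW)// exprn_ile1 ?subr_ge0 ?(ltW x1)//.
    by rewrite lerBlDr lerDl normc_ge0.
  apply: (binv_le bW ha); split; first exact: disc_mobius.
  rewrite -{1}(mobius0 a) (normc_mobius_mobius ha (disc0 _) hb) mobius_0l normcN.
  exact: le_lt_trans dlr.
pose x := normc b; have x0 : 0 < x := lt_trans dl0 big.
have d1 : 0 < 1 - dl by rewrite subr_gt0.
(* The chain moves along the radius; [x'] is the modulus of the point before [b],
   chosen so that [1 - x] is [1 - dl] times [1 - x']. *)
pose x' := 1 - (1 - x) / (1 - dl).
have ex' : 1 - x' = (1 - x) / (1 - dl) by rewrite /x' opprB addrC subrK.
have x'0 : 0 <= x' by rewrite /x' subr_ge0 ler_pdivrMr// mul1r lerD2l lerN2 ltW.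
have x'x : x - x' = dl * (1 - x').
  have : 1 - x = (1 - x') * (1 - dl) by rewrite ex' divfK// gt_eqF.
  by move=> h; apply/eqP; rewrite -subr_eq0; apply/eqP; move: h; lra.
have x'1 : x' < 1 by rewrite -subr_gt0 ex' divr_gt0// subr_gt0.
pose t := x' / x; have t0 : 0 <= t by rewrite divr_ge0// ltW.
pose b' := t%:C * b.
have nb' : normc b' = x' by rewrite /b' normcM normc_real ger0_norm// divfK// gt_eqF.
have hb' : disc b' by rewrite /disc/= nb'.
have := IH b' hb'; rewrite nb' ex' => {}IH.
have step : W (mobius a b') <= C * W (mobius a b).
  apply: (binv_le bW); first exact: disc_mobius.
  split; first exact: disc_mobius.
  rewrite (normc_mobius_mobius ha hb' hb) /mobius normcM normcV.
  have -> : b' - b = - ((1 - t)%:C * b) by rewrite /b' rmorphB rmorph1; ring.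
  have bb : 0 < normc (1 - b'^* * b) by rewrite normc_gt0 disc_sub1_neq0.
  rewrite ltr_pdivrMr// normcN normcM normc_real.
  have -> : `|1 - t| * normc b = x - x'.
    have xx' : x' <= x by rewrite -subr_ge0 x'x mulr_ge0 ?ltW// subr_gt0.
    rewrite ger0_norm; last by rewrite subr_ge0 ler_pdivrMr// mul1r.
    by rewrite mulrBl mul1r divfK// gt_eqF.
  rewrite x'x; apply: (@le_lt_trans _ _ (dl * normc (1 - b'^* * b))); last by rewrite ltr_pM2r.
  rewrite ler_pM2l//; apply: le_trans (lerB_normc _ _).
  rewrite normc1 lerD2l lerN2 normcM normcC nb' ler_piMr//; exact: ltW.
have hn' : (1 - dl) ^+ n <= (1 - x) / (1 - dl) by rewrite ler_pdivlMr// -exprSr.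
have {}IH := IH hn'.
have : W a * ((1 - x) / (1 - dl)) ^+ K <= C * (C * W (mobius a b)).
  by apply: le_trans IH _; rewrite ler_pM2l.
rewrite expr_div_n => h.
rewrite -(ler_pM2l C0); apply: le_trans h.
rewrite mulrCA ler_wpM2l ?(binv_ge0 bW)//.
rewrite mulrC ler_wpM2l ?exprn_ge0 ?subr_ge0 ?(ltW x1)//.
by rewrite -[leRHS]mul1r ler_pdivlMr ?exprn_gt0.
Qed.

End InvariantWeight.

(** * Composition with the automorphisms at a fixed point *)

Section MobiusComposition.
Variable R : realType.
Local Notation mu2 := (@lebesgue_measure R \x @lebesgue_measure R)%E.
Implicit Types (W : R[i] -> R) (q : {poly R[i]}) (p r C : R).

(** With [z = mobius a b] the definition reads [a + z * b * a^* = z + b], which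
    is affine in [a] with coefficients depending on [z]. *)
Lemma mobius_expansive (a a' b : R[i]) : disc a -> disc a' -> disc b ->
  normc (a - a') * (1 - normc b) <= 2 * normc (mobius a b - mobius a' b).
Proof.
move=> ha ha' hb; set z := mobius a b; set z' := mobius a' b.
have e : (a - a') + b * z * (a - a')^* = (z - z') * (1 - b * a'^*).
  have h c : disc c -> c + mobius c b * b * c^* = mobius c b + b.
    move=> hc; have : mobius c b * (1 - c^* * b) = c - b.
      by rewrite /mobius divfK// disc_sub1_neq0.
    move=> ec; apply/eqP; rewrite -subr_eq0 (_ : _ - _ = c - b - mobius c b * (1 - c^* * b)).
      by rewrite ec subrr.
    by ring.
  have h1 := h a ha; have h2 := h a' ha'; rewrite -/z in h1; rewrite -/z' in h2.
  rewrite rmorphB /=.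
  have -> : a - a' + b * z * (a^* - a'^*) =
      (a + z * b * a^*) - (a' + z' * b * a'^*) - (z - z') * (b * a'^*) by ring.
  by rewrite h1 h2; ring.
have hz : normc z < 1 by exact: disc_mobius.
apply: (@le_trans _ _ (normc ((a - a') + b * z * (a - a')^*))).
  apply: le_trans (lerB_normcD _ _); rewrite (normcM (b * z)) (normcM b) normcC mulrBr mulr1 lerD2l lerN2.
  by rewrite mulrC ler_wpM2l ?normc_ge0// ler_piMr ?normc_ge0// ltW.
rewrite e normcM mulrC ler_wpM2r ?normc_ge0//.
rewrite (le_trans (le_normcB _ _))// normc1 normcM normcC -[leRHS]/(1 + 1) lerD2l.
by rewrite mulr_ile1 ?normc_ge0// ltW.
Qed.

Lemma measurable_bergman_integrand W p q :
  measurable_fun setT (fun u : R * R => W (of_plane u)) ->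
  measurable_fun setT (fun u : R * R => normc q.[of_plane u] `^ p * W (of_plane u)).
Proof.
move=> mW; apply: measurable_funM => //; apply: (measurableT_comp (measurable_powR _)).
exact/measurable_normc/cmeasurable_horner/cmeasurable_of_plane.
Qed.

(** A Euclidean ball of radius [r * (1 - normc z)] lies in a pseudohyperbolic
    disc, on which [1 - normc z] changes by a factor 2 at most. *)
Lemma invariant_weight_near W r C (z z' : R[i]) : borel_invariant W r C -> disc z ->
  normc (z' - z) < r * (1 - normc z) ->
  [/\ disc z', normc (z' - z) < 2 * r * (1 - normc z') &
    W z / (r * (1 - normc z)) ^+ 2 <= 4 * C / r ^+ 2 * ((1 - normc z') ^+ 2)^-1 * W z'].
Proof.
move=> bW hz hu.
have r0 := binv_r0 bW; have r12 := binv_r12 bW.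
have C0 : 0 < C := lt_le_trans ltr01 (binv_C1 bW).
have s0 : 0 < 1 - normc z by rewrite subr_gt0.
have tri : normc z' <= normc z + normc (z' - z).
  by have := le_normcD (z' - z) z; rewrite subrK addrC.
have tri' : normc z <= normc z' + normc (z' - z).
  by have := le_normcD (z - z') z'; rewrite subrK addrC normc_distC.
have hs : r * (1 - normc z) <= 2^-1 * (1 - normc z) by rewrite ler_wpM2r// ltW.
have [z1 z2 z3] : [/\ 0 < 1 - normc z', 1 - normc z' <= 2 * (1 - normc z) &
    1 - normc z <= 2 * (1 - normc z')].
  by move: tri tri' hu hs s0; clear; split; lra.
have hz' : disc z' by rewrite /disc/= -subr_gt0.
have cmp : W z <= C * W z'.
  apply: (binv_le bW) => //; split => //.
  rewrite /mobius normcM normcV.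
  have den : 1 - normc z <= normc (1 - z^* * z').
    apply: le_trans (lerB_normc _ _); rewrite normc1 lerD2l lerN2 normcM normcC.
    by rewrite ler_piMr ?normc_ge0// ltW.
  rewrite ltr_pdivrMr; last exact: lt_le_trans den.
  by rewrite normc_distC (lt_le_trans hu)// ler_wpM2l// ltW.
split => //.
  by apply: lt_le_trans hu _; rewrite (mulrC 2) -mulrA ler_wpM2l// ltW.
rewrite [leRHS](_ : _ = (C * W z') * (4 / (1 - normc z') ^+ 2 / r ^+ 2)); last by ring.
apply: ler_pM => //.
- exact: binv_ge0 bW _.
- by rewrite invr_ge0 exprn_ge0// mulr_ge0// ltW.
rewrite exprMn invfM mulrC ler_wpM2r ?invr_ge0 ?exprn_ge0 ?(ltW r0)//.
rewrite -[leLHS]mul1r ler_pdivrMr ?exprn_gt0// mulrAC ler_pdivlMr ?exprn_gt0//.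
rewrite mul1r (_ : 4 = 2 ^+ 2); last by rewrite expr2 -natrM.
by rewrite -exprMn lerXn2r// nnegrE ?mulr_ge0// ltW.
Qed.

Definition near_set (r : R) (z : R[i]) : set (R * R) :=
  [set u | disc (of_plane u) /\
     normc (of_plane u - z) < 2 * r * (1 - normc (of_plane u))].

(** The integrand [normc q `^ p * W] divided by the order of the area of the
    pseudohyperbolic disc of radius [r] around the point. *)
Definition smear W q (p r C : R) (u : R * R) : R :=
  4 * C / r ^+ 2 * ((1 - normc (of_plane u)) ^+ 2) `^ (-1) *
  (normc q.[of_plane u] `^ p * W (of_plane u)).

Lemma smear_ge0 W q p r C u : borel_invariant W r C -> 0 <= smear W q p r C u.
Proof.
move=> bW; have r0 := binv_r0 bW; have C1 := binv_C1 bW.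
have C0 : 0 <= C := le_trans ler01 C1.
rewrite /smear !mulr_ge0 ?powR_ge0 ?invr_ge0 ?exprn_ge0 ?(ltW r0)//.
exact: binv_ge0 bW _.
Qed.

Lemma measurable_smear W q p r C : borel_invariant W r C ->
  measurable_fun setT (smear W q p r C).
Proof.
move=> bW; apply: measurable_funM; last exact: measurable_bergman_integrand (binv_meas bW).
apply: measurable_funM; first exact: measurable_cst.
apply: (measurableT_comp (measurable_powR _)); apply: measurable_funX.
apply: measurable_funB; first exact: measurable_cst.
exact/measurable_normc/cmeasurable_of_plane.
Qed.

Lemma measurable_near_set r (z : R[i]) : measurable (near_set r z).
Proof.
rewrite (_ : near_set r z = @plane_disc R `&`
   [set u | normc (of_plane u - z) < 2 * r * (1 - normc (of_plane u))]).
  apply: measurableI; first exact: measurable_plane_disc.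
  apply: measurable_normc_lt.
    by apply: cmeasurableB; [exact: cmeasurable_of_plane|exact: cmeasurable_cst].
  apply: measurable_funM; first exact: measurable_cst.
  apply: measurable_funB; first exact: measurable_cst.
  exact/measurable_normc/cmeasurable_of_plane.
by apply/seteqP; split => u [].
Qed.

Lemma bergman_integrand_le_smear W q (p r C : R) (z : R[i]) :
  borel_invariant W r C -> 0 < p -> disc z ->
  ((normc q.[z] `^ p * W z)%:E <=
   \int[mu2]_(u in near_set r z) (smear W q p r C u)%:E)%E.
Proof.
move=> bW p0 hz; have r0 := binv_r0 bW.
pose rho := r * (1 - normc z).
have rho0 : 0 < rho by rewrite mulr_gt0// subr_gt0.
have mB := measurable_plane_ball z rho.
have mq : measurable_fun (plane_ball z rho) (fun u : R * R => normc q.[of_plane u] `^ p).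
  apply: (measurableT_comp (measurable_powR _)).
  exact/measurable_normc/cmeasurable_horner/cmeasurable_of_plane.
have Wrho : 0 <= W z / rho ^+ 2.
  by rewrite divr_ge0 ?exprn_ge0 ?(ltW rho0)//; exact: binv_ge0 bW _.
have c0 : (0 <= (W z / rho ^+ 2)%:E)%E by rewrite lee_fin.
have mqE : measurable_fun (plane_ball z rho) (fun u => (normc q.[of_plane u] `^ p)%:E).
  exact/measurable_EFinP.
have q0 (u : R * R) : plane_ball z rho u -> (0 <= (normc q.[of_plane u] `^ p)%:E)%E.
  by move=> _; rewrite lee_fin powR_ge0.
have mS : measurable_fun setT (fun u => (smear W q p r C u)%:E).
  by apply/measurable_EFinP; exact: measurable_smear.
have S0 u : (0 <= (smear W q p r C u)%:E)%E by rewrite lee_fin; exact: smear_ge0.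
have nearP u : plane_ball z rho u -> near_set r z u /\
    W z / rho ^+ 2 * normc q.[of_plane u] `^ p <= smear W q p r C u.
  move=> /(invariant_weight_near bW hz)[h1 h2 h3]; split; first by split.
  rewrite /smear powR_inv1 ?sqr_ge0// mulrCA [leRHS]mulrC ler_wpM2r ?powR_ge0//.
apply: (@le_trans _ _ (\int[mu2]_(u in plane_ball z rho)
    ((W z / rho ^+ 2)%:E * (normc q.[of_plane u] `^ p)%:E))%E).
  rewrite (@ge0_integralZl _ _ _ mu2 _ mB _ mqE _ q0 c0).
  apply: (@le_trans _ _ ((W z / rho ^+ 2)%:E * (rho ^+ 2 * normc q.[z] `^ p)%:E)%E).
    by rewrite -EFinM lee_fin mulrA divfK ?expf_neq0 ?(gt_eqF rho0)// mulrC.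
  rewrite lee_wpmul2l//; exact: submean_poly.
apply: (@le_trans _ _ (\int[mu2]_(u in plane_ball z rho) (smear W q p r C u)%:E)%E).
  apply: (@ge0_le_integral _ _ _ mu2 _ mB).
  - by move=> u /q0; exact: mule_ge0.
  - by apply: emeasurable_funM => //; exact: measurable_cst.
  - exact: measurable_funS mS.
  - by move=> u /nearP[_]; rewrite -EFinM lee_fin.
apply: (@ge0_subset_integral _ _ _ mu2 _ _ mB (measurable_near_set r z)).
- exact: measurable_funS mS.
- by move=> u _.
- by move=> u /nearP[].
Qed.

(** Two points [a] of this set have images [mobius a b] close to [z], hence
    are close to each other by [mobius_expansive]: the set lies in a square. *)
Lemma area_mobius_near_le (r : R) (z b : R[i]) : 0 < r -> disc z -> disc b ->
  (mu2 [set a | disc (of_plane a) /\ near_set r (mobius (of_plane a) b) (to_plane z)] <=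
   ((16 * r * (1 - normc z) / (1 - normc b)) ^+ 2)%:E)%E.
Proof.
move=> r0 hz hb; set E := [set a | _].
have b1 : 0 < 1 - normc b by rewrite subr_gt0.
have z1 : 0 < 1 - normc z by rewrite subr_gt0.
pose h := 8 * r * (1 - normc z) / (1 - normc b).
have h0 : 0 < h by rewrite divr_gt0// !mulr_gt0.
have -> : 16 * r * (1 - normc z) / (1 - normc b) = 2 * h by rewrite /h; ring.
have mE : measurable E.
  rewrite (_ : E = @plane_disc R `&`
     [set a | normc (mobius (of_plane a) b - z) < 2 * r * (1 - normc z)]).
    apply: measurableI; first exact: measurable_plane_disc.
    apply: measurable_normc_lt; last exact: measurable_cst.
    apply: cmeasurableB; last exact: cmeasurable_cst.
    by apply: cmeasurable_mobius; [exact: cmeasurable_of_plane|exact: cmeasurable_cst].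
  apply/seteqP; split => a.
    by move=> [ha [_]]; rewrite to_planeK normc_distC.
  by move=> [ha] h1; split => //; split; rewrite to_planeK// normc_distC.
have [[a' Ea']|no] := pselect (exists a', E a'); last first.
  rewrite (_ : E = set0) ?measure0 ?lee_fin ?sqr_ge0//.
  by apply/seteqP; split => // a Ea; apply: no; exists a.
rewrite -(area_square a' (ltW h0)); apply: le_measure; rewrite ?inE//.
  exact: measurable_square.
move=> a [ha [_ ha2]]; have [ha' [_ ha2']] := Ea'.
rewrite to_planeK in ha2; rewrite to_planeK in ha2'.
have := mobius_expansive ha ha' hb => lip.
have close : normc (mobius (of_plane a) b - mobius (of_plane a') b) < 4 * r * (1 - normc z).
  have := le_normcD (mobius (of_plane a) b - z) (z - mobius (of_plane a') b).
  rewrite addrA subrK (normc_distC _ z).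
  by move: ha2 ha2'; clear; lra.
have close' : normc (of_plane a - of_plane a') < h.
  by rewrite /h ltr_pdivlMr//; apply: le_lt_trans lip _; move: close; clear; lra.
have := le_lt_trans (ler_Re _) close'; have := le_lt_trans (ler_Im _) close'.
by rewrite /square /= !in_itv /= !ltr_distl => /andP[-> ->] /andP[-> ->].
Qed.

(** The sub-mean value property smears [normc q `^ p * W] over a small
    pseudohyperbolic disc; after exchanging the order of integration only the
    area of the set of [a] with [mobius a b] in such a disc is needed, which
    [mobius_expansive] bounds. *)
Lemma integral_mobius_point_le W r C q (p : R) (b : R[i]) :
  borel_invariant W r C -> 0 < p -> disc b ->
  (\int[mu2]_(u in @plane_disc R)
     (normc q.[mobius (of_plane u) b] `^ p * W (mobius (of_plane u) b))%:E <=
   (4 * 16 ^+ 2 * C / (1 - normc b) ^+ 2)%:E *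
   \int[mu2]_(u in @plane_disc R)
     (normc q.[of_plane u] `^ p * W (of_plane u))%:E)%E.
Proof.
move=> bW p0 hb; have r0 := binv_r0 bW; have C1 := binv_C1 bW.
have C0 : 0 < C := lt_le_trans ltr01 C1.
have b1 : 0 < 1 - normc b by rewrite subr_gt0.
pose g (z : R[i]) := normc q.[z] `^ p * W z.
have g0 z : (0 <= (g z)%:E)%E.
  by rewrite lee_fin mulr_ge0 ?powR_ge0//; exact: binv_ge0 bW _.
have mg : measurable_fun setT (fun u : R * R => (g (of_plane u))%:E).
  by apply/measurable_EFinP; exact: measurable_bergman_integrand (binv_meas bW).
have mD := @measurable_plane_disc R.
pose H := smear W q p r C.
have H0 u : 0 <= H u by exact: smear_ge0.
pose E := [set t : (R * R) * (R * R) |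
  disc (of_plane t.1) /\ near_set r (mobius (of_plane t.1) b) t.2].
have mE : measurable E.
  have c1 : cmeasurable setT (fun t : (R * R) * (R * R) => of_plane t.1).
    have [h1 h2] := @cmeasurable_of_plane R setT.
    by split; [exact: (measurableT_comp h1 measurable_fst)
              |exact: (measurableT_comp h2 measurable_fst)].
  have c2 : cmeasurable setT (fun t : (R * R) * (R * R) => of_plane t.2).
    have [h1 h2] := @cmeasurable_of_plane R setT.
    by split; [exact: (measurableT_comp h1 measurable_snd)
              |exact: (measurableT_comp h2 measurable_snd)].
  rewrite (_ : E = [set t | normc (of_plane t.1) < 1] `&` [set t | normc (of_plane t.2) < 1]
     `&` [set t | normc (of_plane t.2 - mobius (of_plane t.1) b) <
           2 * r * (1 - normc (of_plane t.2))]); last first.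
    by apply/seteqP; split => t; [case=> h1 [h2 h3]|case=> -[]].
  apply: measurableI.
    by apply: measurableI; (apply: measurable_normc_lt; [|exact: measurable_cst]).
  apply: measurable_normc_lt.
    by apply: cmeasurableB => //; apply: cmeasurable_mobius => //; exact: cmeasurable_cst.
  apply: measurable_funM; first exact: measurable_cst.
  by apply: measurable_funB; [exact: measurable_cst|exact: measurable_normc].
pose K (t : (R * R) * (R * R)) : \bar R := ((\1_E t : R) * H t.2)%:E.
have K0 t : (0 <= K t)%E by rewrite lee_fin mulr_ge0.
have mK : measurable_fun setT K.
  apply/measurable_EFinP; apply: measurable_funM; first exact: measurable_indic.
  exact: measurableT_comp (measurable_smear _ _ bW) measurable_snd.
have [mKF mKG swap] := area_tonelli mK K0.
have pt a : plane_disc a ->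
    ((g (mobius (of_plane a) b))%:E <= \int[mu2]_z K (a, z))%E.
  move=> ha; apply: le_trans (bergman_integrand_le_smear _ bW p0 (disc_mobius ha hb)) _.
  rewrite integral_mkcond le_eqVlt; apply/orP; left; apply/eqP.
  apply: eq_integral => u _; rewrite patchE /K indicE.
  have -> : ((a, u) \in E) = (u \in near_set r (mobius (of_plane a) b)).
    by apply/idP/idP; rewrite !inE; [case|move=> ?; split].
  by case: (u \in _); rewrite ?mul1r ?mul0r.
have Kge0 a : (0 <= \int[mu2]_z K (a, z))%E by exact: integral_ge0.
have Kge0' z : (0 <= \int[mu2]_a K (a, z))%E by exact: integral_ge0.
have mphi : cmeasurable setT (fun u : R * R => mobius (of_plane u) b).
  by apply: cmeasurable_mobius; [exact: cmeasurable_of_plane|exact: cmeasurable_cst].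
have mgphi : measurable_fun (@plane_disc R) (fun u => (g (mobius (of_plane u) b))%:E).
  apply: measurable_funS measurableT _ _ => //.
  have := measurableT_comp mg (measurable_to_plane mphi).
  by congr measurable_fun; apply/funext => u /=; rewrite to_planeK.
apply: (@le_trans _ _ (\int[mu2]_a \int[mu2]_z K (a, z))%E).
  apply: (@le_trans _ _ (\int[mu2]_(a in @plane_disc R) \int[mu2]_z K (a, z))%E).
    apply: (@ge0_le_integral _ _ _ mu2 _ mD _ _ _ mgphi _ pt).
    - by move=> u _; exact: g0.
    - exact: measurable_funS mKF.
  exact: (@ge0_subset_integral _ _ _ mu2 _ _ mD measurableT _ mKF (fun a _ => Kge0 a)).
rewrite swap.
have mgD : measurable_fun (@plane_disc R) (fun u : R * R => (g (of_plane u))%:E).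
  exact: measurable_funS mg.
pose k : R := 4 * 16 ^+ 2 * C / (1 - normc b) ^+ 2.
have k0 : (0 <= k%:E)%E.
  by rewrite lee_fin divr_ge0 ?exprn_ge0 ?(ltW b1)// mulr_ge0 ?(ltW C0)// mulr_ge0 ?exprn_ge0 ?ler0n.
rewrite -(@ge0_integralZl _ _ _ mu2 _ mD _ mgD _ (fun u _ => g0 _) k0).
rewrite [leRHS]integral_mkcond.
apply: (@ge0_le_integral _ _ _ mu2 _ measurableT _ _ (fun z _ => Kge0' z) mKG).
  apply/(measurable_restrictT _ mD).
  by apply: emeasurable_funM => //; exact: measurable_cst.
move=> u _; rewrite patchE.
have mEu : measurable [set a | E (a, u)].
  have := measurable_ysection u mE.
  by congr measurable; apply/seteqP; split => a; rewrite /ysection/= inE.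
have -> : (\int[mu2]_a K (a, u) = (H u)%:E * mu2 [set a | E (a, u)])%E.
  transitivity (\int[mu2]_a ((H u)%:E * (\1_[set a | E (a, u)] a)%:E))%E.
    apply: eq_integral => a _; rewrite /K !indicE mulrC EFinM.
    suff -> : ((a, u) \in E) = (a \in [set a | E (a, u)]) by [].
    by apply/idP/idP; rewrite !inE.
  rewrite ge0_integralZl//.
  - by rewrite integral_indic// setIT.
  - by apply/measurable_EFinP; exact: measurable_indic.
  - by rewrite lee_fin.
case: ifPn => uD; last first.
  rewrite (_ : [set a | E (a, u)] = set0) ?measure0 ?mule0//.
  by apply/seteqP; split => // a [_ [hu _]]; move: uD; rewrite notin_setE.
rewrite inE in uD; have z1 : 0 < 1 - normc (of_plane u) by rewrite subr_gt0.
have HE : (0 <= (H u)%:E)%E by rewrite lee_fin.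
have -> : E = [set t | disc (of_plane t.1) /\
    near_set r (mobius (of_plane t.1) b) t.2] by [].
apply: (@le_trans _ _ ((H u)%:E * ((16 * r * (1 - normc (of_plane u)) / (1 - normc b)) ^+ 2)%:E)%E).
  rewrite lee_wpmul2l//.
  have := @area_mobius_near_le r (of_plane u) b r0 uD hb.
  by rewrite of_planeK.
rewrite -!EFinM lee_fin le_eqVlt; apply/orP; left; apply/eqP.
rewrite /H /smear /k /g powR_inv1 ?sqr_ge0//.
by field; rewrite !gt_eqF.
Qed.

End MobiusComposition.

(** * Blaschke and outer factors of a polynomial *)

Section Factors.
Variable R : realType.
Local Notation mu2 := (@lebesgue_measure R \x @lebesgue_measure R)%E.
Implicit Types (a c z : R[i]) (W : R[i] -> R) (p r C k : R).

Lemma normc_sub1_conj c z : normc (1 - c * z^*) = normc (1 - c^* * z).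
Proof. by rewrite -normcC rmorphB rmorph1 rmorphM /= conjcK. Qed.

(** For a zero [c] in the disc, [z - c] is a Blaschke factor times a function
    without zeros in the disc; for [c] outside, [z - c] itself has no zero.
    These are the moduli of the two parts. *)
Definition outer_mod c z := if normc c < 1 then normc (1 - c^* * z) else normc (z - c).

Definition blaschke_mod c z := if normc c < 1 then normc (mobius c z) else 1.

Lemma outer_mod_gt0 c z : disc z -> 0 < outer_mod c z.
Proof.
rewrite /outer_mod => hz; case: ifPn => hc; rewrite normc_gt0.
  exact: disc_sub1_neq0.
by rewrite subr_eq0; apply/eqP => e; move: hz; rewrite /disc/= e (negbTE hc).
Qed.

Lemma blaschke_mod_ge0 c z : 0 <= blaschke_mod c z.
Proof. by rewrite /blaschke_mod; case: ifP; rewrite ?normc_ge0. Qed.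

Lemma blaschke_mod_le1 c z : disc z -> blaschke_mod c z <= 1.
Proof.
rewrite /blaschke_mod => hz; case: ifP => // hc.
by apply: ltW; exact: disc_mobius.
Qed.

Lemma outer_blaschke c z : disc z -> outer_mod c z * blaschke_mod c z = normc (z - c).
Proof.
rewrite /outer_mod /blaschke_mod => hz; case: ifPn => hc; last by rewrite mulr1.
rewrite /mobius normcM normcV mulrCA divff; first by rewrite mulr1 normc_distC.
by rewrite gt_eqF// normc_gt0 disc_sub1_neq0.
Qed.

Lemma conj_factor_le_outer c z : disc z -> normc (1 - c^* * z) <= outer_mod c z.
Proof.
rewrite /outer_mod => hz; case: ifPn => // hc.
rewrite -leNgt in hc.
rewrite normc_le_sqr -(normc_distC c) -subr_le0 mobius_sqrB mulr_le0_ge0//.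
  by rewrite subr_le0 expr_ge1// normc_ge0.
by rewrite subr_ge0 expr_le1 ?normc_ge0// ltW.
Qed.

(** For [c] outside the disc both sides equal [normc (z - c)], since [rho <
    1]. *)
Lemma max_factor c z (rho : R) : disc z -> 0 <= rho -> rho < 1 ->
  Num.max (normc (z - c)) (normc (rho%:C * (1 - c * z^*))) =
  outer_mod c z * Num.max (blaschke_mod c z) rho.
Proof.
move=> hz rho0 rho1; rewrite normcM normc_real ger0_norm//.
rewrite normc_sub1_conj.
rewrite maxr_pMr ?(ltW (outer_mod_gt0 _ hz))// outer_blaschke//.
rewrite /outer_mod; case: ifPn => hc; first by rewrite mulrC.
have le1 := conj_factor_le_outer c hz; rewrite /outer_mod (negbTE hc) in le1.
have n0 : 0 <= normc (z - c) := normc_ge0 _.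
rewrite !max_l//; first by rewrite ler_piMr// ltW.
by rewrite (le_trans _ le1)// ler_piMl ?normc_ge0// ltW.
Qed.

Lemma ae_mobius_circle c (rho : R) : 0 <= rho -> rho < 1 ->
  {ae mu2, forall u : R * R, disc (of_plane u) ->
     normc (of_plane u - c) != normc (rho%:C * (1 - c * (of_plane u)^*))}.
Proof.
move=> rho0 rho1; have [hc|hc] := boolP (normc c < 1); last first.
  apply: aeW => u hu; rewrite normcM normc_real ger0_norm//.
  have := conj_factor_le_outer c hu; rewrite /outer_mod (negbTE hc).
  rewrite normc_sub1_conj.
  move=> le1; have := outer_mod_gt0 c hu; rewrite /outer_mod (negbTE hc) => n0.
  rewrite gt_eqF//; apply: le_lt_trans (_ : rho * normc (of_plane u - c) < _).
    by rewrite ler_wpM2l.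
  by rewrite gtr_pMl.
case: c hc => c1 c2 hc.
pose A := 1 - rho ^+ 2 * (c1 ^+ 2 + c2 ^+ 2).
have A0 : A != 0.
  rewrite subr_eq0 eq_sym lt_eqF//.
  have : c1 ^+ 2 + c2 ^+ 2 = normc (c1 +i* c2) ^+ 2 by rewrite normc_sqr.
  move=> ->; apply: mulr_ilt1; rewrite ?exprn_ge0 ?normc_ge0// expr_lt1 ?normc_ge0//.
pose B (x : R) : R := - (2 * c2) + 2 * rho ^+ 2 * c2.
pose D (x : R) : R := (x - c1) ^+ 2 + c2 ^+ 2 - rho ^+ 2 * ((1 - c1 * x) ^+ 2 + (c2 * x) ^+ 2).
have mB : measurable_fun setT B by exact: measurable_cst.
have mD : measurable_fun setT D.
  repeat first [apply: measurable_funB | apply: measurable_funD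
      | apply: measurable_funX | apply: measurable_funM
      | exact: measurable_cst | exact: measurable_id].
have := @quadratic_curve_null R A B D A0 mB mD.
set E := [set u | _] => E0.
have mE : measurable E.
  rewrite (_ : E = (fun u : R * R => A * u.2 ^+ 2 + B u.1 * u.2 + D u.1) @^-1` [set 0]).
    rewrite -[X in measurable X]setTI; apply: (_ : measurable_fun setT _) => //.
    apply: measurable_funD.
      apply: measurable_funD; apply: measurable_funM.
      - exact: measurable_cst.
      - by apply: measurable_funX; exact: measurable_snd.
      - exact: measurable_cst.
      - exact: measurable_snd.
    exact: measurableT_comp mD measurable_fst.
  by apply/seteqP; split => u /eqP.
apply: filterS (ae_notin mE E0) => u nE _; apply/negP => /eqP nr; apply: nE.
have {}nr := congr1 (fun x => x ^+ 2) nr.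
rewrite normcM normc_real exprMn real_normK ?num_real// !normc_sqr in nr.
rewrite /E /mkset /A /B /D; apply/eqP; move: nr.
case: u => x y /= nr.
transitivity ((x - c1) ^+ 2 + (y - c2) ^+ 2 -
  rho ^+ 2 * ((1 - (c1 * x - c2 * - y)) ^+ 2 + (0 - (c1 * - y + c2 * x)) ^+ 2)); first by ring.
by apply/eqP; rewrite subr_eq0; apply/eqP.
Qed.

(** The geometric mean of [normc q] over the image under [mobius z] of the
    [N]-th roots of unity of radius [rho], again through a difference of two
    [N]-th powers for each root of [q]. *)
Lemma poly_mobius_mean_ge (A : R[i]) (rs : seq R[i]) z (rho : R) :
  disc z -> 0 <= rho -> rho < 1 ->
  (forall c, c \in rs -> normc (z - c) != normc (rho%:C * (1 - c * z^*))) ->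
  exists2 k : R, 0 < k & forall (N : nat) (om : 'I_N -> R[i]), (0 < N)%N ->
    (forall i, om i ^+ N = 1) ->
    (forall x y, \prod_i (x - om i * y) = x ^+ N - y ^+ N) ->
    (normc A * \prod_(c <- rs) (outer_mod c z * Num.max (blaschke_mod c z) rho)) ^+ N * k <=
      \prod_i normc (A * \prod_(c <- rs) (mobius z (om i * rho%:C) - c)).
Proof.
move=> hz rho0 rho1; elim: rs => [|c rs IH] hrs.
  exists 1 => // N om N0 _ _; rewrite big_nil !mulr1.
  under eq_bigr do rewrite big_nil mulr1.
  by rewrite prodr_const card_ord.
have [|k k0 hk] := IH; first by move=> d ds; apply: hrs; rewrite inE ds orbT.
have [k' k'0 hk'] := normc_expB_ge (hrs c (mem_head _ _)).
exists (k' / 2 * k) => [|N om N0 om1 omE]; first by rewrite mulr_gt0// divr_gt0.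
rewrite big_cons [leRHS](eq_bigr (fun i => normc (mobius z (om i * rho%:C) - c) *
  normc (A * \prod_(d <- rs) (mobius z (om i * rho%:C) - d)))); last first.
  by move=> i _; rewrite big_cons mulrCA normcM.
rewrite [leRHS]big_split /= (mulrCA (normc A)) exprMn mulrACA; apply: ler_pM.
- rewrite mulr_ge0// ?exprn_ge0 ?divr_ge0 ?(ltW k'0)// mulr_ge0 ?(ltW (outer_mod_gt0 _ _))//.
  by rewrite le_max blaschke_mod_ge0.
- rewrite mulr_ge0 ?(ltW k0)// exprn_ge0// mulr_ge0 ?normc_ge0// prodr_ge0// => d _.
  by rewrite mulr_ge0 ?(ltW (outer_mod_gt0 _ _))// le_max blaschke_mod_ge0.
- have hb i : disc (om i * rho%:C).
    by rewrite /disc/= normcM normc_real ger0_norm// (normc_unity_root N0 (om1 i)) mul1r.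
  rewrite -max_factor//.
  have -> : \prod_i normc (mobius z (om i * rho%:C) - c) =
      normc ((z - c) ^+ N - (rho%:C * (1 - c * z^*)) ^+ N) / normc (1 - (z^* * rho%:C) ^+ N).
    have -> : 1 - (z^* * rho%:C) ^+ N = \prod_i (1 - om i * (z^* * rho%:C)).
      by rewrite omE expr1n.
    rewrite -omE !normc_prod -prodf_div; apply: eq_bigr => i _.
    rewrite mobiusB// normcM normcV mulrA (mulrCA z^*).
    by congr (_ / normc _); rewrite !mulrA.
  have den : 0 < normc (1 - (z^* * rho%:C) ^+ N).
    rewrite normc_gt0 subr_eq0; apply/eqP => e.
    have : normc ((z^* * rho%:C) ^+ N) < 1.
      rewrite normcX normcM normcC normc_real ger0_norm// exprn_ilt1 ?mulr_ge0 ?normc_ge0 -?lt0n//.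
      by rewrite mulr_ilt1 ?normc_ge0.
    by rewrite -e normc1 ltxx.
  rewrite mulrA; apply: ler_pM.
  + by rewrite mulr_ge0 ?(ltW k'0)// exprn_ge0// le_max normc_ge0.
  + by [].
  + exact: hk'.
  + rewrite lef_pV2 ?posrE//; apply: normc_expB1_le.
    by rewrite normcM normcC normc_real ger0_norm// mulr_ile1 ?normc_ge0// ltW.
- exact: hk.
Qed.

End Factors.

(** * The averaged inequality *)

Section Averaged.
Variable R : realType.
Local Notation mu2 := (@lebesgue_measure R \x @lebesgue_measure R)%E.
Implicit Types (W : R[i] -> R) (rs : seq R[i]).

Lemma measurable_outer_mod (c : R[i]) :
  measurable_fun setT (fun u : R * R => outer_mod c (of_plane u)).
Proof.
rewrite /outer_mod; case: (normc c < 1); apply: measurable_normc; apply: cmeasurableB;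
  do ?[exact: cmeasurable_cst | exact: cmeasurable_of_plane].
by apply: cmeasurableM; [exact: cmeasurable_cst|exact: cmeasurable_of_plane].
Qed.

Lemma measurable_blaschke_mod (c : R[i]) :
  measurable_fun setT (fun u : R * R => blaschke_mod c (of_plane u)).
Proof.
rewrite /blaschke_mod; case: (normc c < 1); last exact: measurable_cst.
apply: measurable_normc; apply: cmeasurable_mobius; first exact: cmeasurable_cst.
exact: cmeasurable_of_plane.
Qed.

(** The geometric mean of [normc (roots_poly A rs).[_]] over the
    pseudohyperbolic circle with centre [z] and radius [rho]. *)
Definition mean_factor (A : R[i]) rs (rho : R) (z : R[i]) : R :=
  normc A * \prod_(c <- rs) (outer_mod c z * Num.max (blaschke_mod c z) rho).

Lemma mean_factor_ge0 A rs rho z : disc z -> 0 <= mean_factor A rs rho z.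
Proof.
move=> hz; rewrite mulr_ge0 ?normc_ge0// prodr_ge0// => c _.
by rewrite mulr_ge0 ?(ltW (outer_mod_gt0 _ _))// le_max blaschke_mod_ge0.
Qed.

Lemma measurable_mean_factor A rs rho :
  measurable_fun setT (fun u : R * R => mean_factor A rs rho (of_plane u)).
Proof.
apply: measurable_funM; first exact: measurable_cst.
apply: measurable_prod => c _; apply: measurable_funM; first exact: measurable_outer_mod.
apply: measurable_maxr; last exact: measurable_cst.
exact: measurable_blaschke_mod.
Qed.

Definition roots_poly (A : R[i]) rs : {poly R[i]} := A *: \prod_(c <- rs) ('X - c%:P).

Lemma horner_roots_poly A rs z : (roots_poly A rs).[z] = A * \prod_(c <- rs) (z - c).
Proof.
by rewrite /roots_poly hornerZ horner_prod; under eq_bigr do rewrite hornerXsubC.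
Qed.

(** Jensen's inequality in the form of the inequality between the arithmetic
    and the geometric mean, over [M * N] points of the form
    [mobius z (om * rho)]; the weights [(1 - rho) ^+ 2] pay for
    [integral_mobius_point_le]. *)
Lemma averaged_inequality W r C (K : nat) A rs (p : R) (M : nat) (rho : 'I_M -> R) :
  borel_invariant W r C ->
  (forall a b, disc a -> disc b -> W a * (1 - normc b) ^+ K <= C * W (mobius a b)) ->
  0 < p -> (0 < M)%N -> (forall i, 0 <= rho i) -> (forall i, rho i < 1) ->
  (\int[mu2]_(u in @plane_disc R)
     ((\prod_i (mean_factor A rs (rho i) (of_plane u) `^ p *
        (C^-1 * W (of_plane u) * (1 - rho i) ^+ (K + 2)))) `^ (M%:R^-1))%:E <=
   (4 * 16 ^+ 2 * C)%:E * \int[mu2]_(u in @plane_disc R)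
      (normc (roots_poly A rs).[of_plane u] `^ p * W (of_plane u))%:E)%E.
Proof.
move=> bW hK p0 M0 rho0 rho1; set q := roots_poly A rs.
have C0 : 0 < C := lt_le_trans ltr01 (binv_C1 bW).
have W0 := binv_ge0 bW; have mW := binv_meas bW.
have mD := @measurable_plane_disc R.
pose om n := sval (cid (@unity_roots_exist R n.+1 (ltn0Sn n))).
have omP n := svalP (cid (@unity_roots_exist R n.+1 (ltn0Sn n))).
have om1 n i : om n i ^+ n.+1 = 1 by case: (omP n) => + _; apply.
have nom n i : normc (om n i) = 1 by apply: (@normc_unity_root _ n.+1).
have nb n i j : normc (om n j * (rho i)%:C) = rho i.
  by rewrite normcM nom mul1r normc_real ger0_norm.
have db n i j : disc (om n j * (rho i)%:C) by rewrite /disc /mkset nb.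
pose x n (t : 'I_M * 'I_n.+1) (u : R * R) : R :=
  let z := mobius (of_plane u) (om n t.2 * (rho t.1)%:C) in
  normc q.[z] `^ p * W z * (1 - rho t.1) ^+ 2.
have x0 n t u : 0 <= x n t u.
  by rewrite /x mulr_ge0 ?sqr_ge0// mulr_ge0 ?powR_ge0.
have mx n t : measurable_fun setT (x n t).
  apply: measurable_funM; last exact: measurable_cst.
  have mphi : cmeasurable setT (fun u : R * R => mobius (of_plane u) (om n t.2 * (rho t.1)%:C)).
    by apply: cmeasurable_mobius; [exact: cmeasurable_of_plane|exact: cmeasurable_cst].
  have := measurableT_comp (measurable_bergman_integrand p q mW) (measurable_to_plane mphi).
  by congr measurable_fun; apply/funext => u /=; rewrite to_planeK.
pose B (i : 'I_M) (u : R * R) := C^-1 * W (of_plane u) * (1 - rho i) ^+ (K + 2).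
have B0 i u : 0 <= B i u.
  by rewrite mulr_ge0 ?exprn_ge0 ?subr_ge0 ?(ltW (rho1 i))// mulr_ge0// invr_ge0 ltW.
pose G u := (\prod_i (mean_factor A rs (rho i) (of_plane u) `^ p * B i u)) `^ (M%:R^-1).
(* The arithmetic mean of [x n] is bounded by [integral_mobius_point_le], and
   its geometric mean is at least [G] up to a factor that tends to 1 as the
   number of roots of unity grows. *)
have cardMN n : #|{: 'I_M * 'I_n.+1}| = (M * n.+1)%N by rewrite card_prod !card_ord.
apply: (@fatou_bound _ _ _ mu2 _ mD
   (fun n u => (\sum_t x n t u) / #|{: 'I_M * 'I_n.+1}|%:R) G).
- move=> n; apply: measurable_funS measurableT _ _ => //.
  apply: measurable_funM; last exact: measurable_cst.
  by apply: measurable_sum => t; exact: mx.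
- by move=> n u _; rewrite divr_ge0 ?sumr_ge0// => t _; exact: x0.
- apply: measurable_funS measurableT _ _ => //.
  apply: (measurableT_comp (measurable_powR _)); apply: measurable_prod => i _.
  apply: measurable_funM.
    by apply: (measurableT_comp (measurable_powR _)); exact: measurable_mean_factor.
  apply: measurable_funM; last exact: measurable_cst.
  by apply: measurable_funM => //; exact: measurable_cst.
- by move=> u _; exact: powR_ge0.
- have : {ae mu2, forall u, forall i, i \in enum 'I_M -> forall c, c \in rs ->
      disc (of_plane u) ->
      normc (of_plane u - c) != normc ((rho i)%:C * (1 - c * (of_plane u)^*))}.
    apply: ae_all_seq => i _; apply: ae_all_seq => c _.
    exact: ae_mobius_circle.
  apply: filterS => u hu Du.
  have /choice[k hk] : forall i, exists k : R, 0 < k /\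
    forall (N : nat) (om : 'I_N -> R[i]), (0 < N)%N -> (forall i, om i ^+ N = 1) ->
    (forall x y, \prod_i (x - om i * y) = x ^+ N - y ^+ N) ->
    mean_factor A rs (rho i) (of_plane u) ^+ N * k <=
      \prod_j normc (A * \prod_(c <- rs) (mobius (of_plane u) (om j * (rho i)%:C) - c)).
    move=> i; have [|k k0 hk] := @poly_mobius_mean_ge R A rs (of_plane u) (rho i) Du (rho0 i) (rho1 i).
      by move=> c crs; apply: hu; rewrite ?mem_enum.
    by exists k.
  have k0 i : 0 < k i by case: (hk i).
  pose kk := \prod_i k i `^ p.
  have kk0 : 0 < kk by apply: prodr_gt0 => i _; exact: powR_gt0.
  exists (fun n => G u * kk `^ ((M * n.+1)%:R^-1)) => [|n].
    rewrite -[X in _ --> X]mulr1; apply: cvgM; first exact: cvg_cst.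
    rewrite (_ : (fun _ => _) = (fun n => (kk `^ M%:R^-1) `^ n.+1%:R^-1)).
      by apply: cvg_powR_invn; exact: powR_gt0.
    by apply/funext => n; rewrite -powRrM natrM invfM.
  rewrite -cardMN; apply: AGM_ge.
  + by rewrite cardMN muln_gt0 M0.
  + by move=> t; exact: x0.
  + exact: powR_ge0.
  + exact: ltW.
  rewrite cardMN exprM.
  have -> : G u ^+ M = \prod_i (mean_factor A rs (rho i) (of_plane u) `^ p * B i u).
    rewrite /G -powR_mulrn ?powR_ge0// -powRrM mulVf ?pnatr_eq0 -?lt0n// powRr1//.
    by rewrite prodr_ge0// => i _; rewrite mulr_ge0// powR_ge0.
  rewrite -prodrXl -big_split /= -(pair_bigA _ (fun i j => x n (i, j) u)) /=.
  apply: ler_prod => i _; apply/andP; split.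
    by rewrite mulr_ge0 ?powR_ge0// exprn_ge0// mulr_ge0 ?powR_ge0.
  have [_ hki] := hk i.
  have {}hki := hki n.+1 (om n) (ltn0Sn n) (om1 n) (proj2 (omP n)).
  rewrite exprMn mulrAC powRXn ?mean_factor_ge0// -powRM ?exprn_ge0 ?mean_factor_ge0 ?(ltW (k0 i))//.
  rewrite /x /= (eq_bigr (fun j => normc q.[mobius (of_plane u) (om n j * (rho i)%:C)] `^ p *
     (W (mobius (of_plane u) (om n j * (rho i)%:C)) * (1 - rho i) ^+ 2))); last first.
    by move=> j _; rewrite mulrA.
  rewrite big_split /=; apply: ler_pM => //.
  + exact: powR_ge0.
  + exact: exprn_ge0.
  + rewrite powR_prod; last by move=> j; exact: normc_ge0.
    under eq_bigr do rewrite horner_roots_poly.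
    apply: ge0_ler_powR; rewrite ?nnegrE ?(ltW p0)//.
    * by rewrite mulr_ge0 ?exprn_ge0 ?mean_factor_ge0 ?(ltW (k0 i)).
    * by rewrite prodr_ge0// => j _; exact: normc_ge0.
  + rewrite -[X in B i u ^+ X](card_ord n.+1) -prodr_const.
    apply: ler_prod => j _; rewrite B0 /=.
    rewrite /B exprD mulrA ler_wpM2r ?sqr_ge0// -mulrA ler_pdivrMl//.
    by have := hK _ _ Du (db n i j); rewrite nb.
- move=> n; apply: (@integral_average_le _ _ _ mu2 _ mD).
  + by rewrite cardMN muln_gt0 M0.
  + by move=> t; apply: measurable_funS (mx n t).
  + exact: x0.
  move=> t; rewrite /x.
  have rt : 0 < 1 - rho t.1 by rewrite subr_gt0.
  set b := om n t.2 * (rho t.1)%:C.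
  have hb : disc b := db n _ _.
  have st := integral_mobius_point_le q bW p0 hb.
  apply: (@le_trans _ _ (\int[mu2]_(u in @plane_disc R) (((1 - rho t.1) ^+ 2)%:E *
     (normc q.[mobius (of_plane u) b] `^ p * W (mobius (of_plane u) b))%:E))%E).
    rewrite le_eqVlt; apply/orP; left; apply/eqP; apply: eq_integral => u _.
    by rewrite mulrC EFinM.
  rewrite ge0_integralZl//; last 3 first.
  + apply/measurable_EFinP; apply: measurable_funS measurableT _ _ => //.
    have mphi : cmeasurable setT (fun u : R * R => mobius (of_plane u) b).
      by apply: cmeasurable_mobius; [exact: cmeasurable_of_plane|exact: cmeasurable_cst].
    have := measurableT_comp (measurable_bergman_integrand p q mW) (measurable_to_plane mphi).
    by congr measurable_fun; apply/funext => u /=; rewrite to_planeK.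
  + by move=> u _; rewrite lee_fin mulr_ge0 ?powR_ge0.
  + by rewrite lee_fin sqr_ge0.
  apply: (@le_trans _ _ (((1 - rho t.1) ^+ 2)%:E *
    ((4 * 16 ^+ 2 * C / (1 - normc b) ^+ 2)%:E * \int[mu2]_(u in @plane_disc R)
     (normc q.[of_plane u] `^ p * W (of_plane u))%:E))%E).
    by rewrite lee_wpmul2l// lee_fin sqr_ge0.
  rewrite muleA -EFinM nb mulrC divfK//.
  by rewrite expf_neq0// gt_eqF.
Qed.

End Averaged.

(** * The main inequality *)

Section MainInequality.
Variable R : realType.
Local Notation mu2 := (@lebesgue_measure R \x @lebesgue_measure R)%E.
Implicit Types (W : R[i] -> R) (rs : seq R[i]) (u s kap : R).

(** A Riemann sum comparison of [ln (max u x)] over [0, 1], whose integral is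
    [u - 1], in multiplicative form; the induction removes one grid point at a
    time, using [ln x <= x - 1]. *)
Lemma grid_prod_ge (M j : nat) u : (0 < M)%N -> (j <= M)%N ->
  j%:R / M%:R <= u -> u <= j.+1%:R / M%:R -> u <= 1 ->
  expR (- (M%:R * (1 - u))) <= u ^+ j * \prod_(j.+1 <= i < M.+1) (i%:R / M%:R).
Proof.
move=> M0 jM; have M0' : (0 : R) < M%:R by rewrite ltr0n.
have [d] : exists d, (d + j = M)%N by exists (M - j)%N; rewrite subnK.
elim: d j u {jM} => [|d IH] j u dj ju uj u1.
  move: dj ju; rewrite add0n => -> ju; rewrite big_geq// mulr1.
  have -> : u = 1.
    by apply/eqP; rewrite eq_le u1 /=; move: ju; rewrite divff// gt_eqF.
  by rewrite subrr mulr0 oppr0 expR0 expr1n.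
have jM : (j < M)%N by rewrite -dj addSn ltnS leq_addl.
pose v : R := j.+1%:R / M%:R.
have v1 : v <= 1 by rewrite ler_pdivrMr// mul1r ler_nat.
have v0 : 0 < v by rewrite divr_gt0// ltr0n.
have := IH j.+1 v; rewrite addnS -addSn dj => /(_ erefl (lexx _)).
have vv : v <= j.+2%:R / M%:R by rewrite ler_pM2r ?invr_gt0// ler_nat.
move=> /(_ vv v1) {}IH.
rewrite big_ltn// -/v mulrA.
have u0 : 0 <= u by apply: le_trans ju; rewrite divr_ge0.
suff step : expR (- (M%:R * (v - u))) * v ^+ j <= u ^+ j.
  apply: (@le_trans _ _ (expR (- (M%:R * (v - u))) * expR (- (M%:R * (1 - v))))).
    by rewrite -expRD le_eqVlt; apply/orP; left; apply/eqP; congr expR; ring.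
  apply: (@le_trans _ _ (expR (- (M%:R * (v - u))) *
     (v ^+ j.+1 * \prod_(j.+2 <= i < M.+1) (i%:R / M%:R)))).
    by rewrite ler_wpM2l// expR_ge0.
  rewrite mulrA exprSr mulrA ler_wpM2r//.
    by rewrite big_nat prodr_ge0// => i _; rewrite divr_ge0.
  by rewrite ler_wpM2r// ltW.
case: j dj ju uj jM @v v1 v0 vv IH => [|j] dj ju uj jM v v1 v0 vv IH.
  rewrite !expr0 mulr1 -[leRHS]expR0 ler_expR oppr_le0 mulr_ge0 ?(ltW M0')//.
  by rewrite subr_ge0.
have {}u0 : 0 < u by apply: lt_le_trans ju; rewrite divr_gt0// ltr0n.
have uv : u / v >= expR (- ((v - u) / u)).
  rewrite expRN -[leRHS]invrK invf_div lef_pV2 ?posrE ?expR_gt0 ?divr_gt0//.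
  apply: le_trans (expR_ge1Dx _).
  by rewrite mulrBl divff ?gt_eqF// addrC subrK.
apply: (@le_trans _ _ ((u / v) ^+ j.+1 * v ^+ j.+1)); last first.
  by rewrite -exprMn divfK// gt_eqF.
rewrite ler_wpM2r ?exprn_ge0 ?(ltW v0)//.
apply: (@le_trans _ _ (expR (- ((v - u) / u)) ^+ j.+1)); last first.
  by rewrite lerXn2r ?nnegrE ?expR_ge0// divr_ge0// ltW.
rewrite -expRM_natl ler_expR mulrN lerN2 mulrA ler_pdivrMr// mulrAC ler_wpM2r ?subr_ge0//.
by move: ju; rewrite ler_pdivrMr// mulrC.
Qed.

(** The grid of this product starts at 0, whence one more factor [u] than in
    [grid_prod_ge]. *)
Lemma prod_max_grid_ge (M : nat) u : (0 < M)%N -> 0 < u -> u <= 1 ->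
  expR (- (M%:R * (1 - u))) * u <= \prod_(i < M) Num.max u (i%:R / M%:R).
Proof.
move=> M0 u0 u1; have M0' : (0 : R) < M%:R by rewrite ltr0n.
have [lt1|] := ltP u 1; last first.
  move=> u1'; have -> : u = 1 by apply/eqP; rewrite eq_le u1.
  rewrite subrr mulr0 oppr0 expR0 mulr1.
  rewrite -[leLHS](expr1n _ #|'I_M|) -prodr_const.
  by apply: ler_prod => i _; rewrite ler01 le_max lexx.
have := truncn_itv (mulr_ge0 (ltW u0) (ltW M0')).
set j := Num.truncn _ => /andP[ju uj].
have jM : (j < M)%N by rewrite -(ltr_nat R) (le_lt_trans ju)// gtr_pMl.
have := @grid_prod_ge M j u M0 (ltnW jM).
rewrite ler_pdivrMr// ler_pdivlMr// => /(_ ju (ltW uj) u1) h.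
apply: (@le_trans _ _ (u ^+ j * \prod_(j.+1 <= i < M.+1) (i%:R / M%:R) * u)).
  by rewrite ler_wpM2r// ltW.
rewrite mulrAC -exprSr big_nat_recr//= divff ?gt_eqF// mulr1.
rewrite -(big_mkord xpredT (fun i => Num.max u (i%:R / M%:R))).
rewrite (@big_cat_nat _ _ _ j.+1 0 M)//=; apply: ler_pM.
- by rewrite exprn_ge0// ltW.
- by rewrite prodr_ge0// => i _; rewrite divr_ge0.
- rewrite -[X in u ^+ X](card_ord j.+1) -prodr_const big_mkord.
  by apply: ler_prod => i _; rewrite (ltW u0) le_max lexx.
- by apply: ler_prod => i _; rewrite divr_ge0//= le_max lexx orbT.
Qed.

Lemma prod_one_sub_grid_ge (M : nat) : (0 < M)%N ->
  expR (- M%:R) <= \prod_(i < M) (1 - i%:R / M%:R) :> R.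
Proof.
move=> M0; have M0' : (M%:R : R) != 0 by rewrite pnatr_eq0 -lt0n.
have := @grid_prod_ge M 0 0 M0 (leq0n _); rewrite mul0r => /(_ (lexx _)).
rewrite subr0 mulr1 expr0 mul1r => /(_ _ ler01); rewrite divr_ge0// => /(_ isT).
move=> /le_trans; apply; rewrite big_add1 big_mkord (reindex_inj rev_ord_inj) /=.
apply: ler_prod => i _; rewrite divr_ge0//=.
rewrite subnSK// natrB; last exact: ltnW.
by rewrite mulrBl divff.
Qed.

(** The powers [rho `^ kap] of these radii are equidistributed, so that the
    mean of [ln (Num.max s rho)] over them tends to [- (1 - s `^ kap) / kap]. *)
Definition grid_radius kap (M : nat) (i : 'I_M) : R := (i%:R / M%:R) `^ kap^-1.

Lemma grid_radius_ge0 kap M (i : 'I_M) : 0 <= grid_radius kap i.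
Proof. exact: powR_ge0. Qed.

Lemma one_sub_grid_radius kap M (i : 'I_M) : 0 < kap ->
  (1 - i%:R / M%:R) / (kap + 1) <= 1 - grid_radius kap i.
Proof.
move=> k0; have M0 : (0 : R) < M%:R by rewrite ltr0n (leq_ltn_trans _ (ltn_ord i)).
set t : R := i%:R / M%:R; set y := grid_radius kap i.
have t0 : 0 <= t by rewrite divr_ge0.
have t1 : t <= 1 by rewrite ler_pdivrMr// mul1r ler_nat ltnW.
have y0 : 0 <= y := grid_radius_ge0 _ _.
have y1 : y <= 1.
  apply: (@le_trans _ _ (1 `^ kap^-1)); last by rewrite powR1.
  by apply: ge0_ler_powR; rewrite ?nnegrE ?invr_ge0 ?(ltW k0).
have ty : t = y `^ kap by rewrite -powRrM mulVf ?gt_eqF// powRr1.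
have := truncn_itv (ltW k0); set n := Num.truncn _ => /andP[nk kn].
have yn : y ^+ n.+1 <= t.
  rewrite ty -powR_mulrn//; have [->|yn0] := eqVneq y 0.
    by rewrite !powR0 ?gt_eqF.
  apply: ger_powR; last exact: ltW.
  by rewrite lt_def yn0 y0.
have bern : 1 - y ^+ n.+1 <= n.+1%:R * (1 - y).
  rewrite -[X in X - _](expr1n _ n.+1) subrXX mulrC ler_wpM2r ?subr_ge0//.
  rewrite -[n.+1 in leRHS]card_ord -sumr_const.
  by apply: ler_sum => j _; rewrite expr1n mul1r exprn_ile1.
rewrite ler_pdivrMr ?addr_gt0//.
apply: (@le_trans _ _ (1 - y ^+ n.+1)); first by rewrite lerD2l lerN2.
apply: le_trans bern _; rewrite mulrC ler_wpM2l ?subr_ge0//.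
by rewrite -natr1 lerD2r.
Qed.

Lemma grid_radius_lt1 kap M (i : 'I_M) : 0 < kap -> grid_radius kap i < 1.
Proof.
move=> k0; rewrite -subr_gt0; apply: lt_le_trans (one_sub_grid_radius i k0).
have M0 : (0 : R) < M%:R by rewrite ltr0n (leq_ltn_trans _ (ltn_ord i)).
apply: divr_gt0; last by rewrite addr_gt0.
by rewrite subr_gt0 ltr_pdivrMr// mul1r ltr_nat.
Qed.

Lemma prod_max_radius_ge kap (M : nat) s : 0 < kap -> (0 < M)%N -> 0 < s -> s <= 1 ->
  expR (- ((1 - s `^ kap) / kap)) ^+ M * s <= \prod_(i < M) Num.max s (grid_radius kap i).
Proof.
move=> k0 M0 s0 s1; pose u := s `^ kap.
have u0 : 0 < u by exact: powR_gt0.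
have u1 : u <= 1.
  apply: (@le_trans _ _ (1 `^ kap)); last by rewrite powR1.
  by apply: ge0_ler_powR; rewrite ?nnegrE ?(ltW k0) ?(ltW s0).
have su : s = u `^ kap^-1 by rewrite -powRrM mulfV ?gt_eqF// powRr1// ltW.
rewrite (eq_bigr (fun i : 'I_M => (Num.max u (i%:R / M%:R)) `^ kap^-1)); last first.
  move=> i _; rewrite {1}su /grid_radius.
  have [ui|iu] := leP u (i%:R / M%:R).
    rewrite !max_r//; apply: ge0_ler_powR; rewrite ?nnegrE ?invr_ge0 ?divr_ge0// ltW//.
  rewrite !max_l// ?(ltW iu)//.
  apply: ge0_ler_powR; rewrite ?nnegrE ?invr_ge0 ?divr_ge0// ltW//.
rewrite powR_prod; last by move=> i; rewrite le_max (ltW u0).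
apply: (@le_trans _ _ ((expR (- (M%:R * (1 - u))) * u) `^ kap^-1)); last first.
  apply: ge0_ler_powR; rewrite ?nnegrE ?invr_ge0 ?(ltW k0)//.
  - by rewrite mulr_ge0 ?expR_ge0// ltW.
  - by rewrite prodr_ge0// => i _; rewrite le_max (ltW u0).
  - exact: prod_max_grid_ge.
rewrite powRM ?expR_ge0 ?(ltW u0)// -su ler_wpM2r ?(ltW s0)//.
by rewrite -expRM -expRM_natl ler_expR -/u mulNr mulrN mulrA.
Qed.

End MainInequality.

Section MainInequality.
Variable R : realType.
Local Notation mu2 := (@lebesgue_measure R \x @lebesgue_measure R)%E.
Implicit Types (W : R[i] -> R) (rs : seq R[i]) (A z : R[i]) (p kap : R).

(** The expectation of the [p]-th powers of the moduli of the outer factors,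
    times the [kap]-th powers of the Blaschke factors of a random set of
    zeros, where each zero is retained with probability [p / kap]. *)
Definition mixed_integrand A rs p kap z : R :=
  normc A `^ p * \prod_(c <- rs)
    (outer_mod c z `^ p * (1 - p / kap + p / kap * blaschke_mod c z `^ kap)).

Lemma mixed_factor_ge0 p kap c z : disc z -> 0 < p -> p <= kap ->
  0 <= outer_mod c z `^ p * (1 - p / kap + p / kap * blaschke_mod c z `^ kap).
Proof.
move=> hz p0 pk; have k0 : 0 < kap := lt_le_trans p0 pk.
apply: mulr_ge0; first exact: powR_ge0.
apply: addr_ge0; first by rewrite subr_ge0 ler_pdivrMr// mul1r.
by rewrite mulr_ge0 ?powR_ge0// divr_ge0// ltW.
Qed.

Lemma mixed_integrand_ge0 A rs p kap z : disc z -> 0 < p -> p <= kap ->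
  0 <= mixed_integrand A rs p kap z.
Proof.
move=> hz p0 pk; rewrite mulr_ge0 ?powR_ge0// prodr_ge0// => c _.
exact: mixed_factor_ge0.
Qed.

Lemma measurable_mixed_integrand A rs p kap :
  measurable_fun setT (fun u : R * R => mixed_integrand A rs p kap (of_plane u)).
Proof.
apply: measurable_funM; first exact: measurable_cst.
apply: measurable_prod => c _; apply: measurable_funM.
  by apply: (measurableT_comp (measurable_powR _)); exact: measurable_outer_mod.
apply: measurable_funD; first exact: measurable_cst.
apply: measurable_funM; first exact: measurable_cst.
by apply: (measurableT_comp (measurable_powR _)); exact: measurable_blaschke_mod.
Qed.

(** For [al = p / kap], convexity of the exponential gives [1 - al + al * s `^
    kap <= expR (- al * (1 - s `^ kap))], and the right-hand side is the limit
    of the geometric mean of [Num.max s rho `^ p] over the grid radii. *)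
Lemma prod_mean_factor_ge A rs p kap (M : nat) z : disc z -> 0 < p -> p <= kap ->
  (0 < M)%N -> (forall c, c \in rs -> 0 < blaschke_mod c z) ->
  mixed_integrand A rs p kap z ^+ M * \prod_(c <- rs) blaschke_mod c z `^ p <=
  \prod_(i < M) mean_factor A rs (grid_radius kap i) z `^ p.
Proof.
move=> hz p0 pk M0 hb; have k0 : 0 < kap := lt_le_trans p0 pk.
rewrite [leRHS]powR_prod; last by move=> i; exact: mean_factor_ge0.
have -> : \prod_(i < M) mean_factor A rs (grid_radius kap i) z =
    normc A ^+ M * \prod_(c <- rs)
      (outer_mod c z ^+ M * \prod_(i < M) Num.max (blaschke_mod c z) (grid_radius kap i)).
  rewrite /mean_factor big_split /= prodr_const card_ord; congr (_ * _).
  rewrite exchange_big /=; apply: eq_bigr => c _.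
  by rewrite big_split /= prodr_const card_ord.
rewrite powRM ?exprn_ge0 ?normc_ge0//; last first.
  rewrite prodr_ge0// => c _; rewrite mulr_ge0 ?exprn_ge0 ?(ltW (outer_mod_gt0 _ _))//.
  by rewrite prodr_ge0// => i _; rewrite le_max blaschke_mod_ge0.
rewrite /mixed_integrand exprMn powRXn ?normc_ge0// -mulrA ler_wpM2l ?powR_ge0//.
rewrite -powR_prod; last first.
  move=> c; rewrite mulr_ge0 ?exprn_ge0 ?(ltW (outer_mod_gt0 _ _))//.
  by rewrite prodr_ge0// => i _; rewrite le_max blaschke_mod_ge0.
elim: rs hb => [|c rs IH] hb; first by rewrite !big_nil expr1n mulr1.
rewrite !big_cons exprMn mulrACA; apply: ler_pM.
- by rewrite mulr_ge0 ?powR_ge0// exprn_ge0//; exact: mixed_factor_ge0.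
- rewrite mulr_ge0//; last by rewrite prodr_ge0// => d _; exact: powR_ge0.
  by rewrite exprn_ge0// prodr_ge0// => d _; exact: mixed_factor_ge0.
- rewrite exprMn powRXn ?(ltW (outer_mod_gt0 _ _))// -mulrA.
  rewrite powRM ?exprn_ge0 ?(ltW (outer_mod_gt0 _ _))//; last first.
    by rewrite prodr_ge0// => i _; rewrite le_max blaschke_mod_ge0.
  rewrite ler_wpM2l ?powR_ge0//.
  set s := blaschke_mod c z.
  have s0 : 0 < s by apply: hb; exact: mem_head.
  have s1 : s <= 1 by exact: blaschke_mod_le1.
  have h := prod_max_radius_ge k0 M0 s0 s1.
  apply: (@le_trans _ _ ((expR (- ((1 - s `^ kap) / kap)) ^+ M * s) `^ p)); last first.
    apply: ge0_ler_powR; rewrite ?nnegrE ?(ltW p0)//.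
      by rewrite mulr_ge0 ?exprn_ge0 ?expR_ge0// ltW.
    by rewrite prodr_ge0// => i _; rewrite le_max (ltW s0).
  rewrite powRM ?exprn_ge0 ?expR_ge0 ?(ltW s0)// ler_wpM2r ?powR_ge0//.
  rewrite -powRXn ?expR_ge0// -expRM lerXn2r ?nnegrE ?expR_ge0//.
    apply: addr_ge0; first by rewrite subr_ge0 ler_pdivrMr// mul1r.
    by rewrite mulr_ge0 ?powR_ge0// divr_ge0// ltW.
  apply: le_trans (expR_ge1Dx _); rewrite le_eqVlt; apply/orP; left; apply/eqP.
  by ring.
- by apply: IH => d ds; apply: hb; rewrite inE ds orbT.
Qed.

(** Its polynomial growth in [kap] makes the final constant uniform in the
    larger exponent. *)
Definition growth_const (C : R) (K : nat) kap : R :=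
  4 * 16 ^+ 2 * C ^+ 2 * (expR 1 * (kap + 1)) ^+ (K + 2).

(** The averaged inequality for the grid radii, as the grid is refined; the
    geometric mean of the factors [1 - rho] stays above [1 / (expR 1 * (kap +
    1))]. *)
Lemma main_inequality W r C (K : nat) A rs p kap :
  borel_invariant W r C ->
  (forall a b, disc a -> disc b -> W a * (1 - normc b) ^+ K <= C * W (mobius a b)) ->
  0 < p -> p <= kap ->
  (\int[mu2]_(u in @plane_disc R)
     (mixed_integrand A rs p kap (of_plane u) * W (of_plane u))%:E <=
   (growth_const C K kap)%:E * \int[mu2]_(u in @plane_disc R)
      (normc (roots_poly A rs).[of_plane u] `^ p * W (of_plane u))%:E)%E.
Proof.
move=> bW hK p0 pk; have k0 : 0 < kap := lt_le_trans p0 pk.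
have C0 : 0 < C := lt_le_trans ltr01 (binv_C1 bW).
have W0 := binv_ge0 bW; have mW := binv_meas bW.
have mD := @measurable_plane_disc R.
pose B : R := C * (expR 1 * (kap + 1)) ^+ (K + 2).
have B0 : 0 < B by rewrite mulr_gt0// exprn_gt0// mulr_gt0 ?expR_gt0// addr_gt0.
pose T n u := \prod_(i < n.+1) (mean_factor A rs (grid_radius kap i) (of_plane u) `^ p *
        (C^-1 * W (of_plane u) * (1 - grid_radius kap i) ^+ (K + 2))).
have mT n : measurable_fun setT (fun u => T n u `^ n.+1%:R^-1).
  apply: (measurableT_comp (measurable_powR _)); apply: measurable_prod => i _.
  apply: measurable_funM.
    by apply: (measurableT_comp (measurable_powR _)); exact: measurable_mean_factor.
  apply: measurable_funM; last exact: measurable_cst.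
  by apply: measurable_funM => //; exact: measurable_cst.
have T0 n u : 0 <= T n u.
  rewrite prodr_ge0// => i _; rewrite mulr_ge0 ?powR_ge0// mulr_ge0//.
    by rewrite mulr_ge0// invr_ge0 ltW.
  by rewrite exprn_ge0// subr_ge0 ltW// grid_radius_lt1.
apply: (@fatou_bound _ _ _ mu2 _ mD (fun n u => B * T n u `^ n.+1%:R^-1)
   (fun u => mixed_integrand A rs p kap (of_plane u) * W (of_plane u))).
- move=> n; apply: measurable_funS measurableT _ _ => //.
  by apply: measurable_funM; [exact: measurable_cst|exact: mT].
- by move=> n u _; rewrite mulr_ge0 ?powR_ge0// ltW.
- apply: measurable_funS measurableT _ _ => //.
  by apply: measurable_funM => //; exact: measurable_mixed_integrand.
- by move=> u Du; rewrite mulr_ge0// mixed_integrand_ge0.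
- have : {ae mu2, forall u, forall c, c \in rs -> disc (of_plane u) ->
      normc (of_plane u - c) != normc ((0 : R)%:C * (1 - c * (of_plane u)^*))}.
    by apply: ae_all_seq => c _; apply: ae_mobius_circle.
  apply: filterS => u hu Du.
  have hb c : c \in rs -> 0 < blaschke_mod c (of_plane u).
    move=> crs; have := hu c crs Du; rewrite normcM normc_real normr0 mul0r.
    rewrite -outer_blaschke// mulf_eq0 negb_or => /andP[_ n0].
    by rewrite lt_def n0 blaschke_mod_ge0.
  pose k := \prod_(c <- rs) blaschke_mod c (of_plane u) `^ p.
  have kk0 : 0 < k.
    by rewrite /k big_seq prodr_gt0// => c crs; rewrite powR_gt0// hb.
  set g := mixed_integrand _ _ _ _ _ * _.
  have g0 : 0 <= g by rewrite mulr_ge0// mixed_integrand_ge0.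
  exists (fun n => g * k `^ n.+1%:R^-1) => [|n].
    rewrite -[X in _ --> X]mulr1; apply: cvgM; first exact: cvg_cst.
    exact: cvg_powR_invn.
  rewrite -ler_pdivrMl// mulrA.
  have -> : B^-1 * g * k `^ n.+1%:R^-1 = ((B^-1 * g) ^+ n.+1 * k) `^ n.+1%:R^-1.
    have g1 : 0 <= B^-1 * g by rewrite mulr_ge0// invr_ge0 ltW.
    rewrite powRM ?exprn_ge0 ?(ltW kk0)//; congr (_ * _).
    by rewrite -powR_mulrn// -powRrM mulfV ?pnatr_eq0// powRr1.
  apply: ge0_ler_powR; rewrite ?nnegrE ?invr_ge0 ?ler0n ?mulr_ge0 ?exprn_ge0 ?(ltW kk0)//.
    by rewrite mulr_ge0// invr_ge0 ltW.
  rewrite /T big_split /=.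
  apply: (@le_trans _ _ ((mixed_integrand A rs p kap (of_plane u) ^+ n.+1 * k) *
     (B^-1 * W (of_plane u)) ^+ n.+1)).
    rewrite le_eqVlt; apply/orP; left; apply/eqP.
    by rewrite mulrAC -exprMn /g; congr (_ ^+ _ * _); ring.
  apply: ler_pM.
  + by rewrite mulr_ge0 ?exprn_ge0 ?mixed_integrand_ge0// ltW.
  + by rewrite exprn_ge0// mulr_ge0// invr_ge0 ltW.
  + exact: prod_mean_factor_ge.
  rewrite big_split /= prodr_const card_ord.
  rewrite /B invfM [C^-1 * _ * _]mulrAC exprMn ler_wpM2l ?exprn_ge0 ?mulr_ge0 ?invr_ge0 ?(ltW C0)//.
  rewrite prodrXl -exprVn exprAC.
  have e0 : 0 <= (expR 1 * (kap + 1))^-1 :> R.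
    by rewrite invr_ge0 mulr_ge0 ?expR_ge0// addr_ge0// ltW.
  rewrite lerXn2r ?nnegrE ?exprn_ge0//.
    by rewrite prodr_ge0// => i _; rewrite subr_ge0 ltW// grid_radius_lt1.
  apply: (@le_trans _ _ (\prod_(i < n.+1) ((1 - i%:R / n.+1%:R) / (kap + 1)))); last first.
    apply: ler_prod => i _; rewrite one_sub_grid_radius// andbT divr_ge0//.
      by rewrite subr_ge0 ler_pdivrMr// mul1r ler_nat ltnW.
    by rewrite addr_ge0// ltW.
  rewrite big_split /= prodr_const card_ord invfM exprMn ler_wpM2r//.
    by rewrite exprn_ge0// invr_ge0 addr_ge0// ltW.
  rewrite -expRN -expRM_natl mulrN mulr1.
  exact: prod_one_sub_grid_ge.
- move=> n.
  have h := @averaged_inequality R W r C K A rs p n.+1 (@grid_radius R kap n.+1) bW hK p0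
    (ltn0Sn n) (@grid_radius_ge0 R kap n.+1) (fun i => @grid_radius_lt1 R kap n.+1 i k0).
  apply: (@le_trans _ _ (\int[mu2]_(u in @plane_disc R) (B%:E * (T n u `^ n.+1%:R^-1)%:E))%E).
    by rewrite le_eqVlt; apply/orP; left; apply/eqP; apply: eq_integral => u _; rewrite EFinM.
  rewrite ge0_integralZl//; last 3 first.
  + apply/measurable_EFinP; exact: measurable_funS (mT n).
  + by move=> u _; rewrite lee_fin powR_ge0.
  + by rewrite lee_fin ltW.
  have -> : growth_const C K kap = B * (4 * 16 ^+ 2 * C) by rewrite /growth_const /B; ring.
  rewrite (EFinM B (_ * C)) -[leRHS]muleA lee_wpmul2l//.
  by rewrite lee_fin ltW.
Qed.

End MainInequality.

(** * Functions approximable by polynomials on the disc *)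

Section PolyApprox.
Variable R : realType.
Implicit Types (f g : R[i] -> R[i]) (P Q : {poly R[i]}) (r e M : R) (z : R[i]).

(** Locally uniform limits of polynomials. The factors of a polynomial are
    obtained in this class, which is closed under products, contains the
    powers of [1 - z], and inherits the estimates of Cauchy from polynomials. *)
Definition poly_approx f := forall r, r < 1 -> forall e, 0 < e ->
  exists P, forall z, normc z <= r -> normc (f z - P.[z]) <= e.

Lemma poly_approx_poly P : poly_approx (fun z => P.[z]).
Proof.
by move=> r r1 e e0; exists P => z _; rewrite subrr normc0 ltW.
Qed.

Lemma poly_approx_cst (c : R[i]) : poly_approx (fun=> c).
Proof.
by move=> r r1 e e0; exists c%:P => z _; rewrite hornerC subrr normc0 ltW.
Qed.

Lemma horner_bounded P r : exists M, 0 < M /\ forall z, normc z <= r -> normc P.[z] <= M.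
Proof.
elim/poly_ind: P => [|P c [M [M0 hM]]].
  by exists 1; split => // z _; rewrite horner0 normc0.
exists (M * `|r| + normc c + 1); split.
  by rewrite ltr_wpDl// addr_ge0 ?normc_ge0// mulr_ge0// ltW.
move=> z hz; rewrite hornerMXaddC ler_wpDr// (le_trans (le_normcD _ _))// lerD2r normcM.
by apply: ler_pM; rewrite ?normc_ge0 ?hM// (le_trans hz)// ler_norm.
Qed.

Lemma poly_approx_bounded f r : poly_approx f -> r < 1 ->
  exists M, 0 < M /\ forall z, normc z <= r -> normc (f z) <= M.
Proof.
move=> af r1; have [P hP] := af r r1 1 ltr01; have [M [M0 hM]] := horner_bounded P r.
exists (1 + M); split => [|z hz]; first exact: addr_gt0.
rewrite -(subrK P.[z] (f z)) (le_trans (le_normcD _ _))// lerD//; [exact: hP|exact: hM].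
Qed.

Lemma poly_approxM f g : poly_approx f -> poly_approx g -> poly_approx (fun z => f z * g z).
Proof.
move=> af ag r r1 e e0.
have [M [M0 hM]] := poly_approx_bounded af r1.
have [Q hQ] := ag r r1 (e / 2 / M) (divr_gt0 (divr_gt0 e0 (ltr0n _ 2)) M0).
have [N [N0 hN]] := horner_bounded Q r.
have [P hP] := af r r1 (e / 2 / N) (divr_gt0 (divr_gt0 e0 (ltr0n _ 2)) N0).
exists (P * Q) => z hz; rewrite hornerM.
have -> : f z * g z - P.[z] * Q.[z] = f z * (g z - Q.[z]) + (f z - P.[z]) * Q.[z] by ring.
apply: le_trans (le_normcD _ _) _; rewrite [leRHS](splitr e) !normcM lerD//.
  apply: (@le_trans _ _ (M * (e / 2 / M))); last by rewrite mulrC divfK ?gt_eqF.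
  by apply: ler_pM; rewrite ?normc_ge0 ?hM ?hQ.
apply: (@le_trans _ _ (e / 2 / N * N)); last by rewrite divfK ?gt_eqF.
by apply: ler_pM; rewrite ?normc_ge0 ?hN ?hP.
Qed.

Lemma poly_approx_prod (I : Type) (s : seq I) (F : I -> R[i] -> R[i]) :
  (forall i, poly_approx (F i)) -> poly_approx (fun z => \prod_(i <- s) F i z).
Proof.
move=> aF; elim: s => [|i s IH].
  by under eq_fun do rewrite big_nil; exact: poly_approx_cst.
by under eq_fun do rewrite big_cons; exact: poly_approxM.
Qed.

Lemma poly_approx_scale f (b : R[i]) : normc b <= 1 -> poly_approx f ->
  poly_approx (fun z => f (b * z)).
Proof.
move=> b1 af r r1 e e0; have [P hP] := af r r1 e e0.
exists (P \Po (b *: 'X)) => z hz; rewrite horner_comp hornerZ hornerX; apply: hP.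
by rewrite normcM (le_trans _ hz)// ler_piMl// normc_ge0.
Qed.

(** The intervals of centre [u n] and radius [e n] meet pairwise, so the
    infimum of their right ends belongs to all of them. *)
Lemma cauchy_rate_real (u e : nat -> R) :
  (forall n m, (n <= m)%N -> `|u m - u n| <= e n) ->
  exists l, forall n, `|l - u n| <= e n.
Proof.
move=> he.
have e0 n : 0 <= e n by apply: le_trans (he n n (leqnn n)).
have cross n m : u n - e n <= u m + e m.
  have [nm|/ltnW mn] := leqP n m.
    have := he n m nm; rewrite ler_distl => /andP[h _].
    by rewrite (le_trans h)// lerDl.
  have := he m n mn; rewrite ler_distl => /andP[_ h].
  by rewrite (le_trans _ h)// gerBl.
pose S := [set u n + e n | n in setT].
have Sinf : has_inf S.
  split; first by exists (u 0%N + e 0%N); exists 0%N.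
  by exists (u 0%N - e 0%N) => _ [n _ <-]; exact: cross.
exists (inf S) => n; rewrite ler_distl; apply/andP; split.
  by apply: lb_le_inf; [exact: Sinf.1|move=> _ [m _ <-]; exact: cross].
by apply: ge_inf; [exact: Sinf.2|exists n].
Qed.

Lemma cauchy_rate (u : nat -> R[i]) (e : nat -> R) :
  (forall n m, (n <= m)%N -> normc (u m - u n) <= e n) ->
  exists l, forall n, normc (l - u n) <= 2 * e n.
Proof.
move=> he.
have [|x hx] := @cauchy_rate_real (fun n => complex.Re (u n)) e.
  move=> n m nm; apply: le_trans (he n m nm); apply: le_trans (ler_Re _).
  by case: (u n) (u m) => ? ? [].
have [|y hy] := @cauchy_rate_real (fun n => complex.Im (u n)) e.
  move=> n m nm; apply: le_trans (he n m nm); apply: le_trans (ler_Im _).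
  by case: (u n) (u m) => ? ? [].
exists (x +i* y) => n; apply: le_trans (normc_le_ReIm _) _.
rewrite mulrDl mul1r; move: (hx n) (hy n).
by case: (u n) => a b /= h1 h2; exact: lerD.
Qed.

Lemma natmul_expr_le r n : 0 <= r -> r < 1 -> n%:R * r ^+ n <= (1 - r)^-1.
Proof.
move=> r0 r1; have d0 : 0 < 1 - r by rewrite subr_gt0.
rewrite -[leRHS]div1r ler_pdivlMr//.
have : (1 - r) * \sum_(i < n) r ^+ i <= 1.
  have -> : (1 - r) * \sum_(i < n) r ^+ i = 1 - r ^+ n.
    by rewrite -(opprB r 1) mulNr -subrX1 opprB.
  by rewrite gerBl exprn_ge0.
apply: le_trans; rewrite mulrC ler_wpM2l ?(ltW d0)//.
have -> : n%:R * r ^+ n = \sum_(i < n) r ^+ n.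
  by rewrite sumr_const card_ord mulr_natl.
apply: ler_sum => i _; apply: ler_wiXn2l => //; [exact: ltW|exact: ltnW].
Qed.

Lemma small_geometric r e : 0 <= r -> r < 1 -> 0 < e ->
  exists N, forall n, (N <= n)%N -> n%:R ^+ 2 * r ^+ n <= e.
Proof.
move=> r0 r1 e0; pose t := r `^ 3^-1.
have t0 : 0 <= t by exact: powR_ge0.
have t3 : t ^+ 3 = r by rewrite -powR_mulrn// -powRrM mulVf// powRr1.
have t1 : t < 1.
  by rewrite -(@ltr_pXn2r _ 3)// ?nnegrE// t3 expr1n.
have : t ^+ n @[n --> \oo] --> 0 by apply: cvg_expr; rewrite ger0_norm.
have d0 : 0 < 1 - t by rewrite subr_gt0.
move=> /cvgr_le/(_ (e * (1 - t) ^+ 2)); rewrite mulr_gt0 ?exprn_gt0// => /(_ isT) [N _ hN].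
exists N => n Nn; have := hN n Nn; rewrite /= => {}hN.
have -> : n%:R ^+ 2 * r ^+ n = (n%:R * t ^+ n) ^+ 2 * t ^+ n.
  by rewrite -t3 -exprM mulnC exprM; set a := t ^+ n; ring.
apply: (@le_trans _ _ ((1 - t)^-1 ^+ 2 * t ^+ n)).
  rewrite ler_wpM2r ?exprn_ge0// lerXn2r ?nnegrE ?invr_ge0 ?(ltW d0) ?mulr_ge0 ?exprn_ge0//.
  exact: natmul_expr_le.
by rewrite exprVn mulrC ler_pdivrMr ?exprn_gt0.
Qed.

(** The difference with the linear function vanishes at 1 and 1/2, so its
    value doubles along the doubling map of the interval; being bounded, it
    vanishes. *)
Lemma additive_bounded_linear (D : R -> R) (K : R) :
  (forall x y, 0 <= x -> 0 <= y -> x + y <= 1 -> D (x + y) = D x + D y) ->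
  (forall x, 0 <= x -> x <= 1 -> `|D x| <= K) ->
  forall x, 0 <= x -> x <= 1 -> D x = x * D 1.
Proof.
move=> Dadd DK; pose E x := D x - x * D 1.
have Eadd x y : 0 <= x -> 0 <= y -> x + y <= 1 -> E (x + y) = E x + E y.
  by move=> x0 y0 xy; rewrite /E Dadd//; ring.
have EK x : 0 <= x -> x <= 1 -> `|E x| <= K + K.
  move=> x0 x1; rewrite (le_trans (ler_normB _ _))// lerD ?DK// normrM ger0_norm//.
  by rewrite (le_trans (ler_wpM2r (normr_ge0 _) x1))// mul1r DK.
have E1 : E 1 = 0 by rewrite /E mul1r subrr.
have Ehalf : E 2^-1 = 0.
  have h2 : 2^-1 + 2^-1 = 1 :> R by rewrite [RHS](splitr 1) mul1r.
  have h0 : (0 : R) <= 2^-1 by rewrite invr_ge0.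
  have := Eadd 2^-1 2^-1 h0 h0; rewrite h2 lexx E1 => /(_ isT) h.
  by move: h; lra.
have dbl x : 0 <= x -> x <= 1 -> exists y, [/\ 0 <= y, y <= 1 & E y = 2 * E x].
  move=> x0 x1; have [xh|/ltW xh] := leP x 2^-1.
    exists (x + x); split; first exact: addr_ge0.
      by move: xh; lra.
    by rewrite Eadd//; [ring|move: xh; lra].
  have xh0 : 0 <= x - 2^-1 by rewrite subr_ge0.
  exists ((x - 2^-1) + (x - 2^-1)); split; first exact: addr_ge0.
    by move: x1; lra.
  rewrite Eadd//; last by move: x1; lra.
  have h0 : (0 : R) <= 2^-1 by rewrite invr_ge0.
  have := Eadd (x - 2^-1) 2^-1 xh0 h0; rewrite subrK Ehalf addr0 => /(_ x1) ->.
  by ring.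
have small n : forall x, 0 <= x -> x <= 1 -> 2 ^+ n * `|E x| <= K + K.
  elim: n => [|n IH] x x0 x1; first by rewrite expr0 mul1r EK.
  have [y [y0 y1 ey]] := dbl x x0 x1.
  by have := IH y y0 y1; rewrite ey normrM ger0_norm// exprSr mulrA.
move=> x x0 x1; apply/eqP; rewrite -subr_eq0 -/(E x) -normr_le0.
rewrite leNgt; apply/negP => Ex0.
have [n hn] : exists n : nat, (K + K) / `|E x| < n%:R.
  exists (Num.truncn ((K + K) / `|E x|)).+1.
  have K0 : 0 <= (K + K) / `|E x|.
    by rewrite divr_ge0// (le_trans (normr_ge0 (E 0)))// EK.
  by case/andP: (truncn_itv K0).
have := small n x x0 x1; apply/negP; rewrite -ltNge.
rewrite ltr_pdivrMr// in hn; apply: (lt_le_trans hn).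
rewrite ler_wpM2r// -natrX ler_nat; exact: ltnW (ltn_expl _ _).
Qed.

End PolyApprox.

(** * Powers of [1 - z] *)

Section Binomial.
Variable R : realType.
Implicit Types (g d : R) (z : R[i]) (n : nat).

(** The coefficients of the power series of [(1 - z) `^ g]. *)
Fixpoint binom_coef g n : R :=
  if n is m.+1 then binom_coef g m * ((m%:R - g) / m.+1%:R) else 1.

Definition binom_poly g n : {poly R[i]} := \poly_(k < n) (binom_coef g k)%:C.

Lemma binom_coefS g n : n.+1%:R * binom_coef g n.+1 = (n%:R - g) * binom_coef g n.
Proof. by rewrite /= mulrC -mulrA divfK ?pnatr_eq0// mulrC. Qed.

Lemma binom_coef_le1 g n : `|g| <= 1 -> `|binom_coef g n| <= 1.
Proof.
move=> g1; elim: n => [|n IH] /=; first by rewrite normr1.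
rewrite normrM mulr_ile1// normrM normfV [`|n.+1%:R|]ger0_norm// ler_pdivrMr// mul1r.
by rewrite (le_trans (ler_normB _ _))// ger0_norm// -natr1 lerD2l.
Qed.

Lemma vandermonde_binom_coef g d n :
  \sum_(j < n.+1) binom_coef g j * binom_coef d (n - j) = binom_coef (g + d) n.
Proof.
elim: n => [|n IH]; first by rewrite big_ord_recr big_ord0 /= add0r mulr1.
have n0 : n.+1%:R != 0 :> R by rewrite pnatr_eq0.
apply: (mulfI n0); rewrite binom_coefS -IH mulr_sumr.
rewrite (eq_bigr (fun j : 'I_n.+2 => j%:R * binom_coef g j * binom_coef d (n.+1 - j)
   + binom_coef g j * ((n.+1 - j)%:R * binom_coef d (n.+1 - j)))); last first.
  move=> j _; have jn : (j <= n.+1)%N by rewrite -ltnS.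
  by rewrite -{1}(subnK jn) natrD; ring.
rewrite big_split /= big_ord_recl mul0r mul0r add0r.
rewrite [X in _ + X]big_ord_recr /= subnn mul0r mulr0 addr0 -big_split mulr_sumr /=.
apply: eq_bigr => j _; rewrite /bump /= add1n subSS.
have jn : (j <= n)%N by rewrite -ltnS.
have e1 := binom_coefS g j; have e2 := binom_coefS d (n - j).
rewrite subSn//; rewrite /= in e1 e2 *; rewrite e1 e2 natrB//; ring.
Qed.

Lemma binom_poly_cauchy g z n m : `|g| <= 1 -> normc z < 1 -> (n <= m)%N ->
  normc ((binom_poly g m).[z] - (binom_poly g n).[z]) <= normc z ^+ n / (1 - normc z).
Proof.
move=> g1 z1 nm; have d0 : 0 < 1 - normc z by rewrite subr_gt0.
rewrite !horner_poly -!(big_mkord xpredT (fun i => (binom_coef g i)%:C * z ^+ i)).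
rewrite (@big_cat_nat _ _ _ n 0 m)//= addrAC subrr add0r.
apply: le_trans (normc_sum _ _ _) _.
apply: (@le_trans _ _ (\sum_(n <= i < m) normc z ^+ i)).
  apply: ler_sum => i _; rewrite normcM normcX normc_real ler_piMl ?exprn_ge0 ?normc_ge0//.
  exact: binom_coef_le1.
rewrite ler_pdivlMr// -{1}(add0n n) big_addn big_mkord.
rewrite (eq_bigr (fun i : 'I_(m - n) => normc z ^+ n * normc z ^+ i)); last first.
  by move=> i _; rewrite addnC exprD.
rewrite -mulr_sumr -mulrA ler_piMr ?exprn_ge0 ?normc_ge0//.
rewrite mulrC -(opprB _ 1) mulNr -subrX1 opprB gerBl exprn_ge0// normc_ge0.
by [].
Qed.

Lemma binom_limit_exists g z : exists l : R[i], `|g| <= 1 -> normc z < 1 ->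
  forall n, normc (l - (binom_poly g n).[z]) <= 2 * (normc z ^+ n / (1 - normc z)).
Proof.
have [g1|ng] := pselect (`|g| <= 1); last by exists 0 => /ng.
have [z1|nz] := pselect (normc z < 1); last by exists 0 => _ /nz.
have [l hl] := @cauchy_rate R (fun n => (binom_poly g n).[z])
  (fun n => normc z ^+ n / (1 - normc z)) (fun n m => binom_poly_cauchy g1 z1).
by exists l.
Qed.

(** The principal branch of [(1 - z) `^ g]. *)
Definition binom_fun g z : R[i] := sval (cid (binom_limit_exists g z)).

Lemma binom_funP g z n : `|g| <= 1 -> normc z < 1 ->
  normc (binom_fun g z - (binom_poly g n).[z]) <= 2 * (normc z ^+ n / (1 - normc z)).
Proof. by move=> g1 z1; rewrite /binom_fun; case: cid => l /= /(_ g1 z1). Qed.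

Lemma poly_approx_binom_fun g : `|g| <= 1 -> poly_approx (binom_fun g).
Proof.
move=> g1 r r1 e e0; pose s := Num.max r 0.
have s0 : 0 <= s by rewrite le_max lexx orbT.
have s1 : s < 1 by rewrite gt_max r1 ltr01.
have d0 : 0 < 1 - s by rewrite subr_gt0.
have [N hN] := small_geometric s0 s1 (mulr_gt0 (divr_gt0 e0 (ltr0n _ 2)) d0).
exists (binom_poly g N.+1) => z zr; have zs : normc z <= s by rewrite le_max zr.
apply: le_trans (binom_funP _ g1 (le_lt_trans zs s1)) _.
rewrite mulrC -ler_pdivlMr//.
apply: (@le_trans _ _ (s ^+ N.+1 / (1 - s))).
  apply: ler_pM; rewrite ?exprn_ge0 ?normc_ge0 ?invr_ge0 ?subr_ge0 ?(le_trans zs (ltW s1))//.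
    by rewrite lerXn2r// nnegrE normc_ge0.
  by rewrite lef_pV2 ?posrE ?subr_gt0 ?(le_lt_trans zs s1)// lerD2l lerN2.
rewrite ler_pdivrMr//; apply: le_trans (hN N.+1 (leqnSn N)).
by rewrite ler_peMl ?exprn_ge0// exprn_ege1// ler1n.
Qed.

Lemma normc_le_eps (x y : R[i]) (r k : R) : 0 <= r -> r < 1 -> 0 < k ->
  (exists N, forall n, (N <= n)%N -> normc (x - y) <= k * (n%:R ^+ 2 * r ^+ n)) -> x = y.
Proof.
move=> r0 r1 k0 [N hN]; apply/eqP; rewrite -subr_eq0 -normc_eq0 eq_le normc_ge0 andbT.
apply/ler_addgt0Pl => e e0; rewrite addr0.
have [N' hN'] := small_geometric r0 r1 (divr_gt0 e0 k0).
apply: le_trans (hN (maxn N N') (leq_maxl _ _)) _.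
by rewrite mulrC -ler_pdivlMr// hN'// leq_maxr.
Qed.

Lemma le_sqr_geometric (r : R) n : 0 <= r -> (0 < n)%N -> r ^+ n <= n%:R ^+ 2 * r ^+ n.
Proof. by move=> r0 n0; rewrite ler_peMl ?exprn_ge0// exprn_ege1// ler1n. Qed.

Lemma binom_fun_eq_horner g z (w : R[i]) : `|g| <= 1 -> normc z < 1 ->
  (exists N, forall n, (N <= n)%N -> (binom_poly g n).[z] = w) -> binom_fun g z = w.
Proof.
move=> g1 z1 [N hN]; have d0 : 0 < 1 - normc z by rewrite subr_gt0.
apply: (@normc_le_eps _ _ (normc z) (2 / (1 - normc z))) => //.
- exact: normc_ge0.
- exact: divr_gt0.
exists N.+1 => n Nn; rewrite -(hN n (ltnW Nn)).
apply: le_trans (binom_funP _ g1 z1) _.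
rewrite mulrCA mulrC ler_wpM2l ?divr_ge0 ?(ltW d0)//.
by apply: le_sqr_geometric; [exact: normc_ge0|exact: leq_ltn_trans Nn].
Qed.

Lemma binom_fun0 z : normc z < 1 -> binom_fun 0 z = 1.
Proof.
move=> z1; apply: binom_fun_eq_horner; rewrite ?normr0//.
have c0 k : binom_coef 0 k.+1 = 0.
  elim: k => [|k IH]; first by rewrite /= subr0 mul0r mulr0.
  by move: IH => /= ->; rewrite mul0r.
exists 1%N => -[//|n] _; rewrite horner_poly big_ord_recl big1 ?addr0; last first.
  by move=> i _; rewrite (_ : nat_of_ord (lift ord0 i) = i.+1)// c0 mul0r.
by rewrite /= expr0 mulr1.
Qed.

Lemma binom_fun1 z : normc z < 1 -> binom_fun 1 z = 1 - z.
Proof.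
move=> z1; apply: binom_fun_eq_horner; rewrite ?normr1//.
have c1 : binom_coef 1 1 = -1 by rewrite /= sub0r divr1 mul1r.
have c0 k : binom_coef 1 k.+2 = 0.
  elim: k => [|k IH]; first by rewrite /= subrr mul0r mulr0.
  by move: IH => /= ->; rewrite mul0r.
exists 2%N => -[//|[//|n]] _; rewrite horner_poly big_ord_recl big_ord_recl.
rewrite big1 ?addr0; last first.
  move=> i _; rewrite (_ : nat_of_ord (lift ord0 (lift ord0 i)) = i.+2)// c0 mul0r.
  by [].
by rewrite [X in X%:C * _ + _]/= [X in _ + X%:C * _]c1 mul1r expr0 expr1 rmorphN1 mulN1r.
Qed.

(** The product of the partial sums of length [n] for [g] and [d] agrees with
    the one for [g + d] in degrees below [n]; in each of the [n] further
    degrees the coefficient is at most [2 * n]. This is the source of the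
    bound [n ^+ 2 * r ^+ n]. *)
Lemma binom_funD g d z : `|g| <= 1 -> `|d| <= 1 -> `|g + d| <= 1 -> normc z < 1 ->
  binom_fun g z * binom_fun d z = binom_fun (g + d) z.
Proof.
move=> g1 d1 gd1 z1; set r := normc z; have r0 : 0 <= r := normc_ge0 _.
have q0 : 0 < 1 - r by rewrite subr_gt0.
pose L := 2 / (1 - r); have L0 : 0 < L by rewrite divr_gt0.
have fL h n : `|h| <= 1 -> normc (binom_fun h z - (binom_poly h n).[z]) <= L * r ^+ n.
  by move=> h1; rewrite mulrAC -mulrA; exact: binom_funP.
have fb h : `|h| <= 1 -> normc (binom_fun h z) <= L.
  move=> h1; have := fL h 0%N h1; rewrite expr0 mulr1.
  by rewrite /binom_poly horner_poly big_ord0 subr0.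
apply: (@normc_le_eps _ _ r (3 * L ^+ 2 + 2 + L)) => //.
  by rewrite addr_gt0// addr_gt0// mulr_gt0// exprn_gt0.
exists 1%N => n n0.
set u := (binom_poly g n).[z]; set v := (binom_poly d n).[z].
set w := (binom_poly (g + d) n).[z].
have -> : binom_fun g z * binom_fun d z - binom_fun (g + d) z =
  (binom_fun g z * (binom_fun d z - v) + (binom_fun g z - u) * v) + (u * v - w)
    + (w - binom_fun (g + d) z) by ring.
set x := n%:R ^+ 2 * r ^+ n.
have rx : r ^+ n <= x by exact: le_sqr_geometric.
have x0 : 0 <= x by rewrite mulr_ge0 ?exprn_ge0.
have Lx : L * r ^+ n <= L * x by rewrite ler_pM2l.
have vb : normc v <= 2 * L.
  rewrite -(subKr (binom_fun d z) v) (le_trans (le_normcB _ _))// mulrDl mul1r lerD ?fb//.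
  by apply: le_trans (fL d n d1) _; rewrite ler_piMr ?(ltW L0)// exprn_ile1// ltW.
have t1 : normc (binom_fun g z * (binom_fun d z - v)) <= L * (L * x).
  by rewrite normcM; apply: ler_pM; rewrite ?normc_ge0 ?fb// (le_trans (fL d n d1)).
have t2 : normc ((binom_fun g z - u) * v) <= L * x * (2 * L).
  by rewrite normcM; apply: ler_pM; rewrite ?normc_ge0// (le_trans (fL g n g1)).
have t4 : normc (w - binom_fun (g + d) z) <= L * x.
  by rewrite normc_distC (le_trans (fL _ n gd1)).
have t3 : normc (u * v - w) <= 2 * x.
  rewrite -hornerM -hornerN -hornerD.
  set P := _ - _.
  have sP : (size P <= n + n)%N.
    apply: leq_trans (size_polyD _ _) _; rewrite geq_max size_polyN.
    apply/andP; split; last by rewrite (leq_trans (size_poly _ _))// leq_addr.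
    apply: leq_trans (size_polyMleq _ _) _; apply: leq_trans (leq_pred _) _.
    by apply: leq_add; exact: size_poly.
  rewrite (horner_coef_wide _ sP) big_split_ord /= big1 ?add0r; last first.
    move=> i _; rewrite coefB coefM coef_poly ltn_ord.
    rewrite (eq_bigr (fun j : 'I_i.+1 => (binom_coef g j * binom_coef d (i - j))%:C)).
      by rewrite -rmorph_sum vandermonde_binom_coef subrr mul0r.
    move=> j _; rewrite !coef_poly rmorphM.
    have ji : (j <= i)%N by rewrite -ltnS.
    by rewrite (leq_ltn_trans ji)// (leq_ltn_trans (leq_subr _ _)).
  apply: le_trans (normc_sum _ _ _) _.
  have -> : 2 * x = \sum_(i < n) (n + n)%:R * r ^+ n.
    by rewrite sumr_const card_ord -mulr_natl natrD /x; ring.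
  apply: ler_sum => i _; rewrite normcM normcX; apply: ler_pM.
  - exact: normc_ge0.
  - by rewrite exprn_ge0// normc_ge0.
  - rewrite coefB coefM [X in _ - X]coef_poly ltnNge leq_addr subr0.
    apply: le_trans (normc_sum _ _ _) _.
    apply: (@le_trans _ _ (\sum_(j < (n + i).+1) 1)).
      apply: ler_sum => j _; rewrite normcM mulr_ile1 ?normc_ge0// coef_poly;
        by case: ifP; rewrite ?normc0// normc_real binom_coef_le1.
    by rewrite sumr_const card_ord ler_nat -addnS leq_add2l.
  - by rewrite ler_wiXn2l ?(ltW z1)// leq_addr.
apply: (@le_trans _ _ (L * (L * x) + L * x * (2 * L) + 2 * x + L * x)); last first.
  by rewrite le_eqVlt; apply/orP; left; apply/eqP; ring.
apply: le_trans (le_normcD _ _) _; apply: lerD t4.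
apply: le_trans (le_normcD _ _) _; apply: lerD t3.
by apply: le_trans (le_normcD _ _) _; apply: lerD t2.
Qed.

Lemma binom_fun_inv g z : `|g| <= 1 -> normc z < 1 -> binom_fun g z * binom_fun (- g) z = 1.
Proof. by move=> g1 z1; rewrite binom_funD ?normrN ?subrr ?normr0 ?binom_fun0. Qed.

(** The modulus is multiplicative in the exponent and bounded above and below,
    so its logarithm is additive and bounded, hence linear. *)
Lemma normc_binom_fun g z : 0 <= g -> g <= 1 -> normc z < 1 ->
  normc (binom_fun g z) = normc (1 - z) `^ g.
Proof.
move=> g0 g1 z1; have q0 : 0 < 1 - normc z by rewrite subr_gt0.
pose L := 2 / (1 - normc z).
have L0 : 0 < L by rewrite divr_gt0.
have a1 h : 0 <= h -> h <= 1 -> `|h| <= 1 by move=> h0 h1; rewrite ger0_norm.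
have fb h : `|h| <= 1 -> normc (binom_fun h z) <= L.
  move=> h1; have := @binom_funP h z 0%N h1 z1.
  by rewrite /binom_poly horner_poly big_ord0 subr0 expr0 div1r.
have f0 h : `|h| <= 1 -> 0 < normc (binom_fun h z).
  move=> h1; rewrite normc_gt0; apply/eqP => e; have := binom_fun_inv h1 z1.
  by rewrite e mul0r => /eqP; rewrite eq_sym oner_eq0.
have low h : `|h| <= 1 -> L^-1 <= normc (binom_fun h z).
  move=> h1; have := congr1 (@normc R) (binom_fun_inv h1 z1); rewrite normcM normc1 => e.
  rewrite -[leLHS]mul1r -e ler_pdivrMr// ler_wpM2l ?normc_ge0// fb// normrN//.
pose D h := ln (normc (binom_fun h z)).
have Dlin : D g = g * D 1.
  apply: (@additive_bounded_linear _ D (ln L)) => // [x y x0 y0 xy|x x0 x1].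
    have x1 : x <= 1 by apply: le_trans xy; rewrite lerDl.
    have y1 : y <= 1 by apply: le_trans xy; rewrite lerDr.
    rewrite /D -binom_funD ?a1 ?addr_ge0// normcM lnM ?posrE ?f0 ?a1//.
  rewrite ler_norml -lnV ?posrE// /D; apply/andP; split.
    by rewrite ler_ln ?posrE ?invr_gt0 ?f0 ?low ?a1.
  by rewrite ler_ln ?posrE ?f0 ?fb ?a1.
have n1 : 0 < normc (1 - z) by rewrite -binom_fun1// f0// normr1.
rewrite -[LHS]lnK ?posrE ?f0 ?a1// -/(D g) Dlin /D binom_fun1// /powR gt_eqF//.
Qed.

End Binomial.

(** * Factorization of polynomials *)

Section FactorFunctions.
Variable R : realType.
Local Notation mu2 := (@lebesgue_measure R \x @lebesgue_measure R)%E.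
Implicit Types (c z : R[i]) (g d p : R).

(** Analytic functions whose moduli are [outer_mod c z `^ g] and [blaschke_mod
    c z]. For [c] outside the disc the unimodular constant in [blaschke_fun]
    makes [outer_blaschke_fun] hold. *)
Definition outer_fun g c z : R[i] :=
  if normc c < 1 then binom_fun g (c^* * z) else (normc c `^ g)%:C * binom_fun g (c^-1 * z).

Definition blaschke_fun c z : R[i] :=
  if normc c < 1 then (z - c) * binom_fun (-1) (c^* * z) else - (c / (normc c)%:C).

Lemma outer_arg_lt1 c z : disc z -> ~~ (normc c < 1) -> normc (c^-1 * z) < 1.
Proof.
move=> hz; rewrite -leNgt => c1; rewrite normcM normcV.
by rewrite mulrC ltr_pdivrMr ?(lt_le_trans ltr01 c1)// mul1r (lt_le_trans hz).
Qed.

Lemma inner_arg_lt1 c z : disc z -> normc c < 1 -> normc (c^* * z) < 1.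
Proof. by move=> hz c1; rewrite normcM normcC mulr_ilt1 ?normc_ge0. Qed.

Lemma normc_outer_fun g c z : 0 <= g -> g <= 1 -> disc z ->
  normc (outer_fun g c z) = outer_mod c z `^ g.
Proof.
move=> g0 g1 hz; rewrite /outer_fun /outer_mod; case: ifPn => hc.
  by rewrite normc_binom_fun// inner_arg_lt1.
have c0 : c != 0 by apply: contraNneq hc => ->; rewrite normc0.
rewrite normcM normc_real ger0_norm ?powR_ge0// normc_binom_fun ?outer_arg_lt1//.
rewrite -powRM ?normc_ge0// -normcM mulrBr mulr1 mulVKf//.
by rewrite normc_distC.
Qed.

Lemma normN1_le1 : `|-1 : R| <= 1.
Proof. by rewrite normrN1. Qed.

Lemma normc_blaschke_fun c z : disc z -> normc (blaschke_fun c z) = blaschke_mod c z.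
Proof.
move=> hz; rewrite /blaschke_fun /blaschke_mod; case: ifPn => hc.
  have := congr1 (@normc R) (@binom_fun_inv R 1 (c^* * z) _ (inner_arg_lt1 hz hc)).
  rewrite normr1 => /(_ (lexx _)); rewrite binom_fun1 ?inner_arg_lt1// normcM normc1 => e.
  rewrite /mobius !normcM normcV normc_distC; congr (_ * _).
  have n0 : normc (1 - c^* * z) != 0.
    by rewrite normc_eq0; exact: disc_sub1_neq0.
  by apply: (mulfI n0); rewrite e divff.
have c0 : normc c != 0 by rewrite gt_eqF// (lt_le_trans ltr01)// leNgt.
by rewrite normcN normcM normcV normc_real ger0_norm ?normc_ge0// divff.
Qed.

Lemma outer_blaschke_fun g d c z : 0 <= g -> 0 <= d -> g + d = 1 -> disc z ->
  outer_fun g c z * outer_fun d c z * blaschke_fun c z = z - c.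
Proof.
move=> g0 d0 gd hz.
have g1 : `|g| <= 1 by rewrite ger0_norm// -gd lerDl.
have d1 : `|d| <= 1 by rewrite ger0_norm// -gd lerDr.
have gd1 : `|g + d| <= 1 by rewrite gd normr1.
rewrite /outer_fun /blaschke_fun; case: ifPn => hc.
  have h := inner_arg_lt1 hz hc.
  rewrite binom_funD// gd mulrCA (@binom_fun_inv R 1) ?normr1// mulr1//.
have h := outer_arg_lt1 hz hc.
have c0 : c != 0 by apply: contraNneq hc => ->; rewrite normc0.
have n0 : (normc c)%:C != 0.
  by rewrite (_ : 0 = (0 : R)%:C)// (inj_eq (@complexI R)) normc_eq0.
rewrite mulrACA -rmorphM -powRD; last by rewrite gd oner_eq0.
rewrite gd powRr1 ?normc_ge0// binom_funD// gd binom_fun1//.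
by field; rewrite c0 n0.
Qed.

Lemma poly_approx_outer_fun g c : `|g| <= 1 -> poly_approx (outer_fun g c).
Proof.
move=> g1; have [hc|hc] := boolP (normc c < 1); rewrite /outer_fun ?hc ?(negbTE hc).
  by apply: poly_approx_scale; [rewrite normcC ltW|exact: poly_approx_binom_fun].
apply: poly_approxM; first exact: poly_approx_cst.
apply: poly_approx_scale; last exact: poly_approx_binom_fun.
by rewrite -leNgt in hc; rewrite normcV invf_le1// (lt_le_trans ltr01).
Qed.

Lemma poly_approx_blaschke_fun c : poly_approx (blaschke_fun c).
Proof.
have [hc|hc] := boolP (normc c < 1); rewrite /blaschke_fun ?hc ?(negbTE hc); last first.
  exact: poly_approx_cst.
apply: poly_approxM.
  have := @poly_approx_poly R ('X - c%:P).
  by congr poly_approx; apply/funext => z; rewrite !hornerE.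
apply: poly_approx_scale; first by rewrite normcC ltW.
exact/poly_approx_binom_fun/normN1_le1.
Qed.

Lemma poly_approx_seq f : poly_approx f -> exists P : nat -> {poly R[i]},
  forall n z, normc z <= 1 - n.+1%:R^-1 -> normc (f z - (P n).[z]) <= n.+1%:R^-1.
Proof.
move=> af; have /choice[P hP] : forall n : nat, exists P : {poly R[i]},
    forall z, normc z <= 1 - n.+1%:R^-1 -> normc (f z - P.[z]) <= n.+1%:R^-1.
  move=> n; apply: af; last by rewrite invr_gt0.
  by rewrite gtrBl invr_gt0.
by exists P.
Qed.

Lemma near_disc_radius z : disc z -> \forall n \near \oo, normc z <= 1 - n.+1%:R^-1.
Proof.
move=> hz; have d0 : 0 < 1 - normc z by rewrite subr_gt0.
have := @cvg_harmonic R; move=> /cvgr_le/(_ _ d0); apply: filterS => n /=.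
by rewrite /harmonic lerBrDl -lerBrDr.
Qed.

Lemma poly_approx_seq_cvg (f : R[i] -> R[i]) (P : nat -> {poly R[i]}) z :
  (forall n z, normc z <= 1 - n.+1%:R^-1 -> normc (f z - (P n).[z]) <= n.+1%:R^-1) ->
  disc z -> normc (f z - (P n).[z]) @[n --> \oo] --> (0 : R).
Proof.
move=> hP hz; apply: (@squeeze_cvgr _ _ _ _ (fun=> 0) (@harmonic R)).
- by apply: filterS (near_disc_radius hz) => n hn; rewrite normc_ge0 hP.
- exact: cvg_cst.
- exact: cvg_harmonic.
Qed.

Lemma cvg_normc (u : nat -> R[i]) (l : R[i]) :
  normc (l - u n) @[n --> \oo] --> (0 : R) -> normc (u n) @[n --> \oo] --> normc l.
Proof.
move=> h; apply/subr_cvg0; apply: (@squeeze_cvgr _ _ _ _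
  (fun n => - normc (l - u n)) (fun n => normc (l - u n))).
- apply: nearW => n; rewrite -ler_norml ler_norml; apply/andP; split.
    by rewrite lerNl opprB lerB_normc.
  by rewrite normc_distC lerB_normc.
- by rewrite -oppr0; apply: cvgN.
- exact: h.
Qed.

Lemma measurable_poly_approx f : poly_approx f ->
  measurable_fun (@plane_disc R) (fun u : R * R => normc (f (of_plane u))).
Proof.
move=> /poly_approx_seq[P hP].
apply: (@measurable_fun_cvg _ _ _ _ (fun n u => normc (P n).[of_plane u])).
- by move=> n; apply/measurable_normc/cmeasurable_horner/cmeasurable_of_plane.
- by move=> u Du; apply: cvg_normc; exact: poly_approx_seq_cvg.
Qed.

End FactorFunctions.

Section PolyFactorization.
Variable R : realType.
Local Notation mu2 := (@lebesgue_measure R \x @lebesgue_measure R)%E.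
Implicit Types (W : R[i] -> R) (c z A B a b : R[i]) (p g d k : R) (rs : seq R[i]).

(** If all [i] violated one of the bounds, then [b * x i + a * y i] would
    exceed [2 * a * b], which bounds its mean. *)

Lemma two_means_le (I : finType) (pi x y : I -> R) (a b : R) :
  (forall i, 0 <= pi i) -> \sum_i pi i = 1 -> (forall i, 0 <= x i) -> (forall i, 0 <= y i) ->
  0 < a -> 0 < b -> \sum_i pi i * x i <= a -> \sum_i pi i * y i <= b ->
  exists i, x i <= 2 * a /\ y i <= 2 * b.
Proof.
move=> pi0 pi1 x0 y0 a0 b0 xa yb; apply: contrapT => no.
have big i : 2 * a * b < b * x i + a * y i.
  have [xi|xi] := leP (x i) (2 * a); last first.
    apply: (@lt_le_trans _ _ (b * x i)); first by rewrite [ltLHS]mulrC ltr_pM2l.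
    by rewrite lerDl mulr_ge0// ltW.
  have [yi|yi] := leP (y i) (2 * b); first by exfalso; apply: no; exists i.
  apply: (@lt_le_trans _ _ (a * y i)); first by rewrite (mulrC 2) -mulrA ltr_pM2l.
  by rewrite lerDr mulr_ge0// ltW.
have : 2 * a * b < b * (\sum_i pi i * x i) + a * (\sum_i pi i * y i).
  have -> : 2 * a * b = \sum_i 2 * a * b * pi i by rewrite -mulr_sumr pi1 mulr1.
  rewrite !mulr_sumr -big_split /=.
  have [i pii] : exists i, 0 < pi i.
    apply: contrapT => np; have : \sum_i pi i = 0.
      apply: big1 => i _; apply/eqP; rewrite eq_le pi0 andbT leNgt; apply/negP => h.
      by apply: np; exists i.
    by rewrite pi1 => /eqP; rewrite oner_eq0.
  have e j : 2 * a * b * pi j <= b * (pi j * x j) + a * (pi j * y j).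
    rewrite (_ : _ + _ = (b * x j + a * y j) * pi j); last by ring.
    by rewrite ler_wpM2r// ltW.
  rewrite (bigD1 i)//= [ltRHS](bigD1 i)//= ltr_leD//; last by apply: ler_sum => j _; exact: e.
  rewrite (_ : b * _ + _ = (b * x i + a * y i) * pi i); last by ring.
  by rewrite ltr_pM2r.
apply/negP; rewrite -leNgt.
apply: (@le_trans _ _ (b * a + a * b)); last by rewrite le_eqVlt; apply/orP; left; apply/eqP; ring.
by rewrite lerD// ler_pM2l.
Qed.

Definition split_factor g (c z : R[i]) (keep : bool) : R[i] :=
  outer_fun g c z * (if keep then blaschke_fun c z else 1).

(** One of the two factors of a polynomial: it receives the power [g] of the
    outer factor of each zero, and the Blaschke factors of the zeros in [J]. *)
Definition split_fun (a : R[i]) g n (cs : 'I_n -> R[i]) (J : {set 'I_n}) z : R[i] :=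
  a * \prod_i split_factor g (cs i) z (i \in J).

Lemma poly_approx_split_fun a g n (cs : 'I_n -> R[i]) J : `|g| <= 1 ->
  poly_approx (split_fun a g cs J).
Proof.
move=> g1; apply: poly_approxM; first exact: poly_approx_cst.
apply: poly_approx_prod => i; apply: poly_approxM; first exact: poly_approx_outer_fun.
by case: (i \in J); [exact: poly_approx_blaschke_fun|exact: poly_approx_cst].
Qed.

Lemma split_funM a b g d n (cs : 'I_n -> R[i]) J z : 0 <= g -> 0 <= d -> g + d = 1 ->
  disc z -> split_fun a g cs J z * split_fun b d cs (~: J) z = a * b * \prod_i (z - cs i).
Proof.
move=> g0 d0 gd hz; rewrite /split_fun mulrACA -big_split /=; congr (_ * _).
apply: eq_bigr => i _; rewrite -(outer_blaschke_fun _ g0 d0 gd hz) /split_factor finset.in_setC.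
by case: (i \in J); rewrite /= ?mulr1; ring.
Qed.

Lemma normc_split_fun A g k p n (cs : 'I_n -> R[i]) J z : 0 <= g -> g <= 1 -> 0 < k ->
  g * k = p -> disc z ->
  normc (split_fun A g cs J z) `^ k =
  normc A `^ k * \prod_i (outer_mod (cs i) z `^ p *
    (if i \in J then blaschke_mod (cs i) z `^ k else 1)).
Proof.
move=> g0 g1 k0 gk hz; rewrite /split_fun normcM normc_prod powRM ?normc_ge0//; last first.
  by rewrite prodr_ge0// => i _; exact: normc_ge0.
congr (_ * _); rewrite -powR_prod; last by move=> i; exact: normc_ge0.
apply: eq_bigr => i _; rewrite /split_factor normcM normc_outer_fun//.
rewrite powRM ?powR_ge0 ?normc_ge0// -powRrM gk; congr (_ * _).
by case: ifP => _; rewrite ?normc_blaschke_fun// normc1 powR1.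
Qed.

(** Each zero goes to the first factor independently with probability [g]; the
    expectation of the product over the zeros factorizes. *)
Lemma expected_split_fun A B g k p n (cs : 'I_n -> R[i]) z : 0 <= g -> g <= 1 -> 0 < k ->
  g * k = p -> disc z -> normc B `^ k = normc A `^ p ->
  mixed_integrand A [seq cs i | i <- enum 'I_n] p k z =
  \sum_(J in {set 'I_n}) (\prod_i (if i \in J then g else 1 - g)) *
     normc (split_fun B g cs J z) `^ k.
Proof.
move=> g0 g1 k0 gk hz BA.
have pk : p / k = g by rewrite -gk mulfK// gt_eqF.
rewrite /mixed_integrand pk big_map big_enum /=.
rewrite (eq_bigr (fun i => g * (outer_mod (cs i) z `^ p * blaschke_mod (cs i) z `^ k) +
   (1 - g) * (outer_mod (cs i) z `^ p))); last by move=> i _; ring.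
rewrite bigA_distr mulr_sumr; apply: eq_bigr => J _.
rewrite (@normc_split_fun _ _ _ p)// BA mulrCA; congr (_ * _).
rewrite -big_split /=; apply: eq_bigr => i _.
by case: ifP => _; rewrite ?mulr1.
Qed.

Lemma sum_prod_split (g : R) n :
  \sum_(J in {set 'I_n}) (\prod_i (if i \in J then g else 1 - g)) = 1.
Proof.
transitivity (\prod_(i < n) (g + (1 - g))); first by rewrite bigA_distr.
by apply: big1 => i _; rewrite addrC subrK.
Qed.

Lemma measurable_split_fun W r C a g k n (cs : 'I_n -> R[i]) J : borel_invariant W r C ->
  `|g| <= 1 -> measurable_fun (@plane_disc R)
    (fun u => (normc (split_fun a g cs J (of_plane u)) `^ k * W (of_plane u))%:E).
Proof.
move=> bW g1; apply/measurable_EFinP; apply: measurable_funM.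
  apply: (measurableT_comp (measurable_powR _)).
  exact: measurable_poly_approx (poly_approx_split_fun _ _ _ _).
exact: measurable_funS (binv_meas bW).
Qed.

Lemma expected_split_integral_le W r C K rs A B g k p :
  borel_invariant W r C ->
  (forall a b, disc a -> disc b -> W a * (1 - normc b) ^+ K <= C * W (mobius a b)) ->
  0 < g -> g <= 1 -> 0 < k -> g * k = p -> normc B `^ k = normc A `^ p ->
  (\sum_(J in {set 'I_(size rs)}) (\prod_i (if i \in J then g else 1 - g))%:E *
     \int[mu2]_(u in @plane_disc R)
       (normc (split_fun B g (fun i : 'I_(size rs) => rs`_i) J (of_plane u)) `^ k
          * W (of_plane u))%:E <=
   (growth_const C K k)%:E * \int[mu2]_(u in @plane_disc R)
      (normc (roots_poly A rs).[of_plane u] `^ p * W (of_plane u))%:E)%E.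
Proof.
move=> bW hK g0 g1 k0 gk BA; have p0 : 0 < p by rewrite -gk mulr_gt0.
have pk : p <= k by rewrite -gk ler_piMl// ltW.
have g1' : `|g| <= 1 by rewrite ger0_norm// ltW.
apply: le_trans (main_inequality A rs bW hK p0 pk).
have mD := @measurable_plane_disc R.
set cs := fun i : 'I_(size rs) => rs`_i.
have ers : rs = [seq cs i | i <- enum 'I_(size rs)].
  by rewrite -[LHS](mkseq_nth 0) /mkseq -val_enum_ord -map_comp.
have W0 := binv_ge0 bW.
have pi0 (J : {set 'I_(size rs)}) : 0 <= \prod_i (if i \in J then g else 1 - g).
  by rewrite prodr_ge0// => i _; case: ifP => _; [exact: ltW|rewrite subr_ge0].
have mS J := @measurable_split_fun W r C B g k _ cs J bW g1'.
have S0 (J : {set 'I_(size rs)}) (u : R * R) :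
  (0 <= (normc (split_fun B g cs J (of_plane u)) `^ k * W (of_plane u))%:E)%E.
  by rewrite lee_fin mulr_ge0 ?powR_ge0.
pose F (J : {set 'I_(size rs)}) (u : R * R) : \bar R :=
  ((\prod_i (if i \in J then g else 1 - g))%:E *
   (normc (split_fun B g cs J (of_plane u)) `^ k * W (of_plane u))%:E)%E.
have F0 J u : @plane_disc R u -> (0 <= F J u)%E by move=> _; rewrite mule_ge0// lee_fin.
have mF J : measurable_fun (@plane_disc R) (F J).
  by apply: emeasurable_funM; [exact: measurable_cst|exact: mS].
have -> : (\int[mu2]_(u in @plane_disc R)
    (mixed_integrand A rs p k (of_plane u) * W (of_plane u))%:E =
    \int[mu2]_(u in @plane_disc R) (\sum_(J <- enum {set 'I_(size rs)}) F J u))%E.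
  apply: eq_integral => u; rewrite inE => Du.
  rewrite {1}ers (@expected_split_fun A B g k p _ cs)//; last exact: ltW.
  rewrite mulr_suml big_enum -sumEFin; apply: eq_bigr => J _.
  by rewrite /F -EFinM mulrA.
rewrite (ge0_integral_sum mu2 mD mF F0) big_enum /=.
apply: lee_sum => J _.
by rewrite (ge0_integralZl mu2 mD (mS J) (fun u _ => S0 J u))// lee_fin.
Qed.

End PolyFactorization.

Section PolyFactorizationTheorem.
Variable R : realType.
Local Notation mu2 := (@lebesgue_measure R \x @lebesgue_measure R)%E.
Implicit Types (W : R[i] -> R) (p : R).

Lemma weighted_sum_fin (I : finType) (pi : I -> R) (X : I -> \bar R) (a : R) :
  (forall i, 0 < pi i) -> (forall i, (0 <= X i)%E) ->
  (\sum_i (pi i)%:E * X i <= a%:E)%E ->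
  (forall i, X i = (fine (X i))%:E) /\ \sum_i pi i * fine (X i) <= a.
Proof.
move=> pi0 X0 Xa.
have Xfin i : X i = (fine (X i))%:E.
  rewrite fineK// ge0_fin_numE//.
  have : ((pi i)%:E * X i <= a%:E)%E.
    apply: le_trans Xa; rewrite (bigD1 i)//= leeDl// sume_ge0// => j _.
    by rewrite mule_ge0// lee_fin ltW.
  move: (X0 i); case: (X i) => [x||]//= _; first by rewrite ltry.
  by rewrite gt0_muley ?lte_fin// leye_eq.
split => //; rewrite -lee_fin -sumEFin; apply: le_trans Xa.
by apply: lee_sum => i _; rewrite [in leRHS]Xfin EFinM.
Qed.

Lemma growth_const_gt0 (C : R) K kap : 0 < C -> 0 < kap -> 0 < growth_const C K kap.
Proof.
move=> C0 k0; rewrite /growth_const mulr_gt0 ?exprn_gt0// ?mulr_gt0 ?exprn_gt0 ?expR_gt0//.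
by rewrite addr_gt0.
Qed.

(** A random distribution of the zeros of [q] over the two factors: the outer
    factor is split deterministically, and each zero goes to the first factor
    with probability [p / p1]. *)
Lemma poly_factorization W r C K (q : {poly R[i]}) p p1 p2 :
  borel_invariant W r C ->
  (forall a b, disc a -> disc b -> W a * (1 - normc b) ^+ K <= C * W (mobius a b)) ->
  0 < p -> 0 < p1 -> 0 < p2 -> p^-1 = p1^-1 + p2^-1 ->
  (\int[mu2]_(u in @plane_disc R) (normc q.[of_plane u] `^ p * W (of_plane u))%:E < +oo)%E ->
  exists f1 f2 : R[i] -> R[i],
    [/\ poly_approx f1, poly_approx f2, forall z, disc z -> q.[z] = f1 z * f2 z,
      (\int[mu2]_(u in @plane_disc R) (normc (f1 (of_plane u)) `^ p1 * W (of_plane u))%:E <=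
       (2 * growth_const C K p1)%:E *
       \int[mu2]_(u in @plane_disc R) (normc q.[of_plane u] `^ p * W (of_plane u))%:E)%E &
      (\int[mu2]_(u in @plane_disc R) (normc (f2 (of_plane u)) `^ p2 * W (of_plane u))%:E <=
       (2 * growth_const C K p2)%:E *
       \int[mu2]_(u in @plane_disc R) (normc q.[of_plane u] `^ p * W (of_plane u))%:E)%E].
Proof.
move=> bW hK p0 p10 p20 pp Ifin.
have C0 : 0 < C := lt_le_trans ltr01 (binv_C1 bW).
have W0 := binv_ge0 bW.
have int0 (f : R[i] -> R[i]) k :
  (0 <= \int[mu2]_(u in @plane_disc R) (normc (f (of_plane u)) `^ k * W (of_plane u))%:E)%E.
  by apply: integral_ge0 => u _; rewrite lee_fin mulr_ge0 ?powR_ge0.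
have [q0|q0] := eqVneq q 0.
  exists (fun=> 0), (fun=> 0); split.
  - exact: poly_approx_cst.
  - exact: poly_approx_cst.
  - by move=> z _; rewrite q0 horner0 mul0r.
  - rewrite integral0_eq; last by move=> u _; rewrite normc0 powR0 ?gt_eqF// mul0r.
    rewrite mule_ge0// lee_fin mulr_ge0// ltW// growth_const_gt0//.
  - rewrite integral0_eq; last by move=> u _; rewrite normc0 powR0 ?gt_eqF// mul0r.
    rewrite mule_ge0// lee_fin mulr_ge0// ltW// growth_const_gt0//.
have [rs Eq] := closed_field_poly_normal q.
set A := lead_coef q in Eq.
have A0 : A != 0 by rewrite lead_coef_eq0.
have qE : q = roots_poly A rs by [].
pose g := p / p1; pose d := p / p2.
have g0 : 0 < g by exact: divr_gt0.
have d0 : 0 < d by exact: divr_gt0.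
have gd : g + d = 1 by rewrite /g /d -mulrDr -pp divff// gt_eqF.
have g1 : g <= 1 by rewrite -gd lerDl ltW.
have d1 : d <= 1 by rewrite -gd lerDr ltW.
have gp : g * p1 = p by rewrite divfK// gt_eqF.
have dp : d * p2 = p by rewrite divfK// gt_eqF.
have nA : 0 < normc A by rewrite normc_gt0.
(* The leading coefficient is split in the same proportions, with its phase in
   the first factor. *)
pose B1 : R[i] := A / (normc A)%:C * (normc A `^ g)%:C.
pose B2 : R[i] := (normc A `^ d)%:C.
have nAC : (normc A)%:C != 0.
  by rewrite (_ : 0 = (0 : R)%:C)// (inj_eq (@complexI R)) gt_eqF.
have nB1 : normc B1 `^ p1 = normc A `^ p.
  rewrite /B1 2!normcM normcV !normc_real !ger0_norm ?powR_ge0 ?normc_ge0//.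
  by rewrite divff ?gt_eqF// mul1r -powRrM gp.
have nB2 : normc B2 `^ p2 = normc A `^ p.
  by rewrite /B2 normc_real ger0_norm ?powR_ge0// -powRrM dp.
have B12 : B1 * B2 = A.
  have e : (normc A `^ g)%:C * (normc A `^ d)%:C = (normc A)%:C.
    rewrite -rmorphM -powRD; last by rewrite gd oner_eq0.
    by rewrite gd powRr1 ?normc_ge0.
  rewrite /B1 /B2 -[LHS]mulrA e divfK//.
pose n := size rs; pose cs (i : 'I_n) := rs`_i.
pose X (J : {set 'I_n}) := (\int[mu2]_(u in @plane_disc R)
  (normc (split_fun B1 g cs J (of_plane u)) `^ p1 * W (of_plane u))%:E)%E.
pose Y (J : {set 'I_n}) := (\int[mu2]_(u in @plane_disc R)
  (normc (split_fun B2 d cs (~: J) (of_plane u)) `^ p2 * W (of_plane u))%:E)%E.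
pose I0 := (\int[mu2]_(u in @plane_disc R)
  (normc q.[of_plane u] `^ p * W (of_plane u))%:E)%E.
have I0E : I0 = (fine I0)%:E by rewrite fineK// ge0_fin_numE//; exact: int0.
have iv0 : 0 <= fine I0 by apply: fine_ge0; exact: int0.
pose pi (J : {set 'I_n}) : R := \prod_i (if i \in J then g else 1 - g).
have pi0 J : 0 < pi J.
  rewrite prodr_gt0// => i _; case: ifP => _ //.
  by rewrite -gd addrC addKr.
have pi1 : \sum_J pi J = 1.
  by rewrite -[RHS](sum_prod_split g n); apply: eq_bigl => J; rewrite inE.
have hX : (\sum_J (pi J)%:E * X J <= (growth_const C K p1 * fine I0)%:E)%E.
  have := expected_split_integral_le rs bW hK g0 g1 p10 gp nB1.
  rewrite -qE -/I0 I0E EFinM; apply: le_trans.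
  by rewrite le_eqVlt; apply/orP; left; apply/eqP; apply: eq_bigl => J; rewrite inE.
have hY : (\sum_J (pi J)%:E * Y J <= (growth_const C K p2 * fine I0)%:E)%E.
  have := expected_split_integral_le rs bW hK d0 d1 p20 dp nB2.
  rewrite -qE -/I0 I0E EFinM; apply: le_trans.
  rewrite le_eqVlt; apply/orP; left; apply/eqP.
  rewrite [RHS](reindex_inj (inv_inj (@finset.setCK _))) /=.
  apply: eq_big => [J|J _]; first by rewrite inE.
  congr (_%:E * _)%E; apply: eq_bigr => i _; rewrite finset.in_setC.
  by case: (i \in J); rewrite -gd ?addrK// addrC addKr.
have X0 J : (0 <= X J)%E by exact: int0.
have Y0 J : (0 <= Y J)%E by exact: int0.
have [XE sX] := weighted_sum_fin pi0 X0 hX.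
have [YE sY] := weighted_sum_fin pi0 Y0 hY.
have [J [xJ yJ]] : exists J, fine (X J) <= 2 * (growth_const C K p1 * fine I0) /\
    fine (Y J) <= 2 * (growth_const C K p2 * fine I0).
  have := iv0; rewrite le_eqVlt => /orP[/eqP I00|I0pos].
    have small (Z : {set 'I_n} -> \bar R) a : (forall J, (0 <= Z J)%E) ->
        \sum_J pi J * fine (Z J) <= a * fine I0 -> forall J, fine (Z J) <= 2 * (a * fine I0).
      move=> Z0; rewrite -I00 !mulr0 => sZ J.
      have : pi J * fine (Z J) <= 0.
        apply: le_trans sZ; rewrite (bigD1 J)//= lerDl sumr_ge0// => J' _.
        by rewrite mulr_ge0 ?fine_ge0// ltW.
      by rewrite pmulr_rle0.
    exists [set: 'I_n]%SET; split; [exact: small X0 sX _|exact: small Y0 sY _].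
  have a0 k : 0 < k -> 0 < growth_const C K k * fine I0.
    by move=> k0; rewrite mulr_gt0// growth_const_gt0.
  have fX J : 0 <= fine (X J) := fine_ge0 (X0 J).
  have fY J : 0 <= fine (Y J) := fine_ge0 (Y0 J).
  exact: (two_means_le (fun J => ltW (pi0 J)) pi1 fX fY (a0 _ p10) (a0 _ p20) sX sY).
exists (split_fun B1 g cs J), (split_fun B2 d cs (~: J)); split.
- by apply: poly_approx_split_fun; rewrite ger0_norm// ltW.
- by apply: poly_approx_split_fun; rewrite ger0_norm// ltW.
- move=> z hz; rewrite (split_funM _ _ _ _ (ltW g0) (ltW d0) gd hz) B12 qE horner_roots_poly.
  by rewrite (big_nth 0) big_mkord.
- by rewrite -/(X J) -/I0 XE I0E -EFinM lee_fin -mulrA.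
- by rewrite -/(Y J) -/I0 YE I0E -EFinM lee_fin -mulrA.
Qed.

End PolyFactorizationTheorem.

(** * Normal families of functions approximable by polynomials *)

Section NormalFamilies.
Variable R : realType.
Implicit Types (z h : R[i]) (P : {poly R[i]}) (M r : R).

(** Tychonoff's theorem provides a cluster point of the sequence of sequences;
    its neighbourhoods constrain finitely many coordinates, more and more of
    which are approximated as [j] grows. *)
Lemma diagonal_extraction (u : nat -> nat -> R) (M : nat -> R) :
  (forall n k, `|u n k| <= M k) ->
  exists b phi, forall j, (j <= phi j)%N /\
    forall k, (k < j)%N -> `|u (phi j) k - b k| < j.+1%:R^-1.
Proof.
move=> uM; pose A k : set R := `[- M k, M k]%classic.
have cA k : compact (A k) by exact: segment_compact.
have cK := @tychonoff nat (fun=> R) A cA.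
set K := [set f | _] in cK.
pose F : set_system (prod_topology (fun _ : nat => R)) := (u n) @[n --> \oo].
have FK : F K by exists 0%N => // n _ k; rewrite /A /= in_itv/= -ler_norml.
have [b [_ bF]] := cK F _ FK.
have step j : exists n, (j <= n)%N /\ forall k, (k < j)%N -> `|u n k - b k| < j.+1%:R^-1.
  have e0 : (0 : R) < j.+1%:R^-1 by rewrite invr_gt0.
  pose V m : set (nat -> R) := [set f | forall k, (k < m)%N -> `|f k - b k| < j.+1%:R^-1].
  have NF : Filter (nbhs (b : prod_topology (fun _ : nat => R))) := nbhs_filter _.
  have nV m : nbhs (b : prod_topology (fun _ : nat => R)) (V m).
    elim: m => [|m IH].
      by rewrite (_ : V 0%N = setT); [exact: filterT|apply/seteqP; split].
    have nm : nbhs (b : prod_topology (fun _ : nat => R))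
        [set f | `|f m - b m| < j.+1%:R^-1].
      have := @proj_continuous nat (fun=> R) m b.
      move=> /(_ [set x | `|x - b m| < j.+1%:R^-1]); apply.
      rewrite nbhs_ballP; exists j.+1%:R^-1 => //= x.
      by rewrite /ball /= distrC.
    apply: (@filterS _ _ NF _ _ _ (@filterI _ _ NF _ _ IH nm)) => f [h1 h2] k.
    by rewrite ltnS leq_eqVlt => /predU1P[->//|]; exact: h1.
  have FA : F [set f | exists2 n, (j <= n)%N & f = u n].
    by exists j => // n /= jn; exists n.
  have [f [[n jn ->] hf]] := bF _ _ FA (nV j).
  by exists n.
have [phi hphi] := choice step.
by exists b, phi.
Qed.

Lemma complex_diagonal_extraction (u : nat -> nat -> R[i]) (M : nat -> R) :
  (forall n k, normc (u n k) <= M k) ->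
  exists b phi, forall j, (j <= phi j)%N /\
    forall k, (k.*2.+1 < j)%N -> normc (u (phi j) k - b k) <= 2 / j.+1%:R.
Proof.
move=> uM.
pose v n k := if odd k then complex.Im (u n k./2) else complex.Re (u n k./2).
have [|b [phi hphi]] := @diagonal_extraction v (fun k => M k./2).
  by move=> n k; rewrite /v; case: ifP => _; apply: le_trans (uM n _);
    [exact: ler_Im|exact: ler_Re].
exists (fun k => b k.*2 +i* b k.*2.+1), phi => j; have [jp hj] := hphi j; split => // k kj.
have h1 := hj k.*2 (ltnW kj); have h2 := hj k.*2.+1 kj.
rewrite /v odd_double doubleK in h1; rewrite /v /= odd_double /= uphalf_double in h2.
apply: le_trans (normc_le_ReIm _) _; rewrite mulrDl mul1r.
by move: h1 h2; case: (u _ _) => x y /= /ltW h1 /ltW h2; exact: lerD.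
Qed.

Lemma prim_root_exists (N : nat) : (0 < N)%N -> exists w : R[i], N.-primitive_root w.
Proof.
move=> N0.
have [rs er] := closed_field_poly_normal ('X^N - 1 : {poly R[i]}).
rewrite (monicP (monicXnsubC _ N0)) scale1r in er.
have szr : size rs = N.
  by apply/eq_add_S; rewrite -(size_prod_XsubC rs id) -er (size_XnsubC _ N0).
have us : uniq rs.
  rewrite -separable_prod_XsubC -er separable_Xn_sub_1// pnatr_eq0 -lt0n//.
have : has N.-primitive_root rs.
  apply: has_prim_root => //; last by rewrite szr.
  apply/allP => z zr; rewrite unity_rootE -subr_eq0.
  have : root ('X^N - 1 : {poly R[i]}) z by rewrite er root_prod_XsubC.
  by rewrite /root !hornerE.
by case/hasP => w _ pw; exists w.
Qed.

(** Cauchy's estimate, with the mean over the [N]-th roots of unity for [N]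
    larger than the degree instead of a contour integral. *)
Lemma cauchy_estimate P M r (k : nat) : 0 <= r ->
  (forall z, normc z <= r -> normc P.[z] <= M) -> normc P`_k * r ^+ k <= M.
Proof.
move=> r0 hM; pose N := (size P + k).+1.
have N0 : (0 < N)%N by [].
have [w pw] := prim_root_exists N0.
have wN := prim_expr_order pw.
have nw : normc w = 1 := normc_unity_root N0 wN.
have kN : (k < N)%N by rewrite ltnS leq_addl.
have key : \sum_(j < N) P.[r%:C * w ^+ j] * w ^+ (j * (N - k)) = N%:R * (P`_k * r%:C ^+ k).
  have sP : (size P <= N)%N by rewrite /N -addnS leq_addr.
  transitivity (\sum_(j < N) \sum_(m < N) P`_m * r%:C ^+ m * w ^+ (j * (m + (N - k)))).
    apply: eq_bigr => j _; rewrite (horner_coef_wide _ sP) mulr_suml.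
    apply: eq_bigr => m _; rewrite exprMn -exprM mulnDr exprD; ring.
  rewrite exchange_big (bigD1 (Ordinal kN))//= [X in _ + X]big1 ?addr0.
    rewrite subnKC ?(ltnW kN)// (eq_bigr (fun=> P`_k * r%:C ^+ k)).
      by rewrite sumr_const card_ord mulr_natl.
    by move=> j _; rewrite mulnC exprM wN expr1n mulr1.
  move=> m /eqP mk; rewrite -mulr_sumr.
  set x := w ^+ (m + (N - k)).
  rewrite (eq_bigr (fun j : 'I_N => x ^+ j)); last by move=> j _; rewrite -exprM mulnC.
  have x1 : x != 1.
    rewrite /x -(prim_order_dvd pw); apply/negP => dv; apply: mk; apply/val_inj => /=.
    have mN := ltn_ord m; have : (m + (N - k) = k + (N - k) %[mod N])%N.
      by rewrite subnKC ?(ltnW kN)// modnn; apply/eqP.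
    by move/eqP; rewrite eqn_modDr !modn_small// => /eqP.
  suff -> : \sum_(j < N) x ^+ j = 0 by rewrite mulr0.
  apply: (mulfI (x := x - 1)); first by rewrite subr_eq0.
  by rewrite mulr0 -subrX1 /x -exprM mulnC exprM wN expr1n subrr.
have := congr1 (@normc R) key; rewrite !normcM normcX normc_real (ger0_norm r0).
have -> : normc (N%:R : R[i]) = N%:R.
  by rewrite -(rmorph_nat (real_complex R)) normc_real ger0_norm.
move=> e; have NR : (0 : R) < N%:R by rewrite ltr0n.
rewrite -(ler_pM2l NR) -e; apply: le_trans (normc_sum _ _ _) _.
apply: (@le_trans _ _ (\sum_(j < N) M)); last by rewrite sumr_const card_ord mulr_natl.
apply: ler_sum => j _; rewrite normcM normcX nw expr1n mulr1; apply: hM.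
by rewrite normcM normcX nw expr1n mulr1 normc_real ger0_norm.
Qed.

Lemma sum_geometric_le (t : R) n m : 0 <= t -> t < 1 -> (n <= m)%N ->
  \sum_(n <= i < m) t ^+ i <= t ^+ n / (1 - t).
Proof.
move=> t0 t1 nm; have d0 : 0 < 1 - t by rewrite subr_gt0.
rewrite ler_pdivlMr// -{1}(add0n n) big_addn big_mkord.
rewrite (eq_bigr (fun i : 'I_(m - n) => t ^+ n * t ^+ i)); last first.
  by move=> i _; rewrite addnC exprD.
rewrite -mulr_sumr -mulrA ler_piMr ?exprn_ge0//.
by rewrite mulrC -(opprB _ 1) mulNr -subrX1 opprB gerBl exprn_ge0.
Qed.

(** By Cauchy's estimates the tail is dominated by a geometric series,
    whatever the degree. *)
Lemma horner_tail_le P M r (K : nat) z : 0 < r -> normc z < r ->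
  (forall z, normc z <= r -> normc P.[z] <= M) ->
  normc (P.[z] - \sum_(k < K) P`_k * z ^+ k) <=
    M * ((normc z / r) ^+ K / (1 - normc z / r)).
Proof.
move=> r0 zr hM; set t := normc z / r.
have t0 : 0 <= t by rewrite divr_ge0 ?normc_ge0// ltW.
have t1 : t < 1 by rewrite ltr_pdivrMr// mul1r.
have M0 : 0 <= M by apply: le_trans (normc_ge0 _) (hM 0 _); rewrite normc0 ltW.
pose S := (size P + K)%N.
rewrite (horner_coef_wide _ (leq_addr K (size P))).
rewrite -!(big_mkord xpredT (fun k => P`_k * z ^+ k)).
rewrite (@big_cat_nat _ _ _ K 0 S)//= ?leq_addl// addrAC subrr add0r.
apply: le_trans (normc_sum _ _ _) _.
apply: (@le_trans _ _ (\sum_(K <= i < S) M * t ^+ i)); last first.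
  by rewrite -mulr_sumr ler_wpM2l// sum_geometric_le// leq_addl.
apply: ler_sum => i _; rewrite normcM normcX.
have -> : normc z = t * r by rewrite divfK// gt_eqF.
rewrite exprMn mulrCA mulrC ler_wpM2r ?exprn_ge0//.
exact: cauchy_estimate (ltW r0) hM.
Qed.

(** The error of the linear approximation is bounded independently of the
    degree, so this estimate passes to pointwise limits and shows that they
    are differentiable. *)
Lemma horner_second_order P M d z : 0 < d ->
  (forall w, normc (w - z) <= d -> normc P.[w] <= M) ->
  exists2 c : R[i], normc c <= M / d &
    forall h, normc h <= d / 2 ->
      normc (P.[z + h] - P.[z] - c * h) <= 2 * M / d ^+ 2 * normc h ^+ 2.
Proof.
move=> d0 hM; pose Q := P \Po ('X + z%:P).
have hQ w : Q.[w] = P.[w + z] by rewrite /Q horner_comp !hornerE.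
have QM w : normc w <= d -> normc Q.[w] <= M.
  by move=> wd; rewrite hQ hM// addrK.
exists Q`_1.
  have := cauchy_estimate 1 (ltW d0) QM.
  by rewrite expr1 ler_pdivlMr.
move=> h hd; have hd' : normc h < d.
  by apply: le_lt_trans hd _; rewrite ltr_pdivrMr// ltr_pMr// ltr1n.
have M0 : 0 <= M by apply: le_trans (normc_ge0 _) (QM 0 _); rewrite normc0 ltW.
have := horner_tail_le 2 d0 hd' QM.
rewrite !big_ord_recr big_ord0 /= add0r expr0 mulr1 expr1.
have -> : Q`_0 = P.[z] by rewrite -horner_coef0 hQ add0r.
rewrite hQ (addrC h) opprD addrA; move=> /le_trans; apply.
have t2 : normc h / d <= 2^-1 by rewrite ler_pdivrMr// mulrC.
have t3 : 2^-1 <= 1 - normc h / d by move: t2; lra.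
have h0 := normc_ge0 h.
rewrite [leRHS](_ : _ = M * ((normc h / d) ^+ 2 * 2)); last first.
  by rewrite expr_div_n; ring.
rewrite ler_wpM2l// ler_wpM2l ?sqr_ge0// -[leRHS]invrK lef_pV2 ?posrE//.
by apply: lt_le_trans t3; rewrite invr_gt0.
Qed.

End NormalFamilies.

Section Montel.
Variable R : realType.
Implicit Types (z h : R[i]) (P : {poly R[i]}) (M r : R).

(** Convergence of complex sequences with errors in [R], where all the moduli
    live. *)
Definition ccvg (u : nat -> R[i]) (l : R[i]) :=
  forall e : R, 0 < e -> exists N, forall n, (N <= n)%N -> normc (l - u n) <= e.

Lemma exists_invn_le (e : R) : 0 < e -> exists N, forall n, (N <= n)%N -> n.+1%:R^-1 <= e.
Proof.
by move=> e0; have := @cvg_harmonic R; move=> /cvgr_le/(_ _ e0)[N _ hN]; exists N => n /hN.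
Qed.

Lemma bounded_cluster (v : nat -> R[i]) (B : R) : (forall n, normc (v n) <= B) ->
  exists l psi, (forall j, (j <= psi j)%N) /\ ccvg (v \o psi) l.
Proof.
move=> vB.
have [b [phi hphi]] := @complex_diagonal_extraction R (fun n _ => v n) (fun=> B) (fun n _ => vB n).
exists (b 0%N), phi; split => [j|e e0]; first by case: (hphi j).
have [N hN] := exists_invn_le (divr_gt0 e0 (ltr0n _ 2)).
exists (maxn N 2) => j; rewrite geq_max => /andP[Nj j2].
have [_ /(_ 0%N j2)] := hphi j; rewrite normc_distC => /le_trans; apply.
by rewrite mulrC -ler_pdivlMr// hN.
Qed.

Lemma complex_cauchy (u : nat -> R[i]) :
  (forall e : R, 0 < e -> exists N, forall n m, (N <= n)%N -> (N <= m)%N -> normc (u n - u m) <= e) ->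
  exists l, ccvg u l.
Proof.
move=> hu; have [N1 hN1] := hu 1 ltr01.
have [|l [psi [hpsi hl]]] := @bounded_cluster (fun n => u (n + N1)%N) (normc (u N1) + 1).
  move=> n; rewrite -(subrK (u N1) (u (n + N1)%N)) (le_trans (le_normcD _ _))// addrC lerD2l.
  by rewrite hN1// leq_addl.
exists l => e e0; have e2 : 0 < e / 2 by rewrite divr_gt0.
have [N hN] := hu _ e2; have [N' hN'] := hl _ e2.
exists N => n Nn; pose j := maxn N N'.
have -> : l - u n = (l - u (psi j + N1)%N) + (u (psi j + N1)%N - u n) by ring.
rewrite (le_trans (le_normcD _ _))// [leRHS](splitr e) lerD//.
  by apply: hN'; rewrite leq_maxr.
apply: hN => //; apply: leq_trans (leq_addr _ _); apply: leq_trans (hpsi j).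
exact: leq_maxl.
Qed.

Lemma derivable_second_order (F : R[i] -> R[i]) z (D : R[i]) (K d : R) : 0 < d -> 0 <= K ->
  (forall h, normc h <= d -> normc (F (z + h) - F z - D * h) <= K * normc h ^+ 2) ->
  derivable (F : R[i]^o -> R[i]^o) z 1.
Proof.
move=> d0 K0 hF; apply/cvg_ex; exists (D : R[i]^o).
apply/cvgrPdist_le => e e0.
have [e' ee'] : exists e' : R, e = e'%:C.
  by exists (complex.Re e); case: e e0 => x y; rewrite ltcE /= => /andP[/eqP -> _].
rewrite ee' in e0 *; have {}e0 : 0 < e' by rewrite -(ltcR 0 e').
pose m := Num.min d (e' / (K + 1)).
have m0 : 0 < m by rewrite lt_min d0 divr_gt0// ltr_wpDl.
have mC : (0 : R[i]) < m%:C by rewrite (_ : 0 = (0 : R)%:C)// ltcR.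
have h1 := @dnbhs0_le _ (R[i]^o) _ mC.
have h2 := @nbhs_dnbhs_neq _ (0 : R[i]^o).
apply: filterS2 h1 h2 => h hm h0 /=.
rewrite normcE_norm lecR in hm; rewrite normcE_norm lecR.
have hd : normc h <= d by rewrite (le_trans hm)// ge_min lexx.
have n0 : 0 < normc h by rewrite normc_gt0.
have -> : D - h^-1 *: (F (h *: 1 + z) - F z) = - (h^-1 * (F (z + h) - F z - D * h)).
  rewrite -[h *: 1]/(h * 1) mulr1 (addrC h) -[_ *: _]/(_ * _).
  by field.
rewrite normcN normcM normcV mulrC ler_pdivrMr//.
apply: le_trans (hF h hd) _; rewrite expr2 mulrA ler_wpM2r ?(ltW n0)//.
apply: (@le_trans _ _ ((K + 1) * (e' / (K + 1)))).
  apply: ler_pM; rewrite ?normc_ge0// ?lerDl//.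
  by rewrite (le_trans hm)// ge_min lexx orbT.
by rewrite mulrC divfK// gt_eqF// ltr_wpDl.
Qed.

Definition locally_bounded (f : nat -> R[i] -> R[i]) :=
  forall r, r < 1 -> exists M, forall n z, normc z <= r -> normc (f n z) <= M.

(** The coefficients converge along a diagonal subsequence, and on a disc of
    radius less than 1 the tails are uniformly small. *)
Lemma normal_family_pointwise (P : nat -> {poly R[i]}) :
  (forall r, r < 1 -> exists M n0, forall n z, (n0 <= n)%N -> normc z <= r ->
     normc (P n).[z] <= M) ->
  exists phi, (forall j, (j <= phi j)%N) /\
    forall z, disc z -> exists l, ccvg (fun j => (P (phi j)).[z]) l.
Proof.
move=> PB; have [|M [n0 hM]] := PB 2^-1; first by rewrite invf_lt1// ltr1n.
have h20 : (0 : R) < 2^-1 by rewrite invr_gt0.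
have [|b [phi hphi]] := @complex_diagonal_extraction R (fun n k => (P (n + n0)%N)`_k)
    (fun k => M / 2^-1 ^+ k).
  move=> n k; rewrite ler_pdivlMr ?exprn_gt0//.
  apply: cauchy_estimate; first exact: ltW.
  by move=> z; apply: hM; rewrite leq_addl.
exists (fun j => (phi j + n0)%N); split.
  by move=> j; apply: leq_trans (leq_addr _ _); case: (hphi j).
move=> z hz; apply: complex_cauchy => e e0.
pose r := (1 + normc z) / 2.
have hz' : normc z < 1 := hz.
have r1 : r < 1 by rewrite /r; move: hz'; lra.
have zr : normc z < r by rewrite /r; move: hz'; lra.
have r0 : 0 < r := le_lt_trans (normc_ge0 _) zr.
have [M' [n1 hM']] := PB r r1.
pose t := normc z / r.
have t0 : 0 <= t by rewrite divr_ge0 ?normc_ge0// ltW.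
have t1 : t < 1 by rewrite ltr_pdivrMr// mul1r.
have d0 : 0 < 1 - t by rewrite subr_gt0.
have M'0 : 0 <= M'.
  by apply: le_trans (normc_ge0 _) (hM' n1 0 (leqnn _) _); rewrite normc0 ltW.
pose B := (M' + 1) / (1 - t).
have B0 : 0 < B by rewrite divr_gt0// ltr_wpDl.
have e4 : 0 < e / 4 by rewrite divr_gt0.
have [K0 hK0] := small_geometric t0 t1 (divr_gt0 e4 B0).
pose K := K0.+1.
have tailK : M' * (t ^+ K / (1 - t)) <= e / 4.
  apply: (@le_trans _ _ (B * t ^+ K)).
    have -> : M' * (t ^+ K / (1 - t)) = M' / (1 - t) * t ^+ K by rewrite mulrA mulrAC.
    apply: ler_wpM2r; first exact: exprn_ge0.
    apply: ler_wpM2r; first by rewrite invr_ge0 ltW.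
    by rewrite lerDl.
  rewrite mulrC -ler_pdivlMr//; apply: le_trans (hK0 K (leqnSn _)).
  exact: le_sqr_geometric.
have K1 : (0 : R) < K%:R by rewrite ltr0n.
have [N hN] := exists_invn_le (divr_gt0 (divr_gt0 e4 K1) (ltr0n _ 2)).
have tail j : (n1 <= j)%N -> normc ((P (phi j + n0)%N).[z]
    - \sum_(k < K) (P (phi j + n0)%N)`_k * z ^+ k) <= e / 4.
  move=> n1j; apply: le_trans tailK; apply: horner_tail_le => // w hw.
  apply: hM' hw; apply: leq_trans n1j _; apply: leq_trans (leq_addr _ _).
  by case: (hphi j).
have head j : (maxn N K.*2.+1 <= j)%N ->
    normc (\sum_(k < K) (P (phi j + n0)%N)`_k * z ^+ k - \sum_(k < K) b k * z ^+ k) <= e / 4.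
  rewrite geq_max => /andP[Nj Kj].
  rewrite -sumrB; apply: le_trans (normc_sum _ _ _) _.
  apply: (@le_trans _ _ (\sum_(k < K) (e / 4 / K%:R))); last first.
    by rewrite sumr_const card_ord -[leLHS]mulr_natr divfK// gt_eqF.
  apply: ler_sum => k _; rewrite -mulrBl normcM normcX.
  apply: (@le_trans _ _ (2 / j.+1%:R * 1)); last first.
    by rewrite mulr1 mulrC -ler_pdivlMr// hN.
  apply: ler_pM; rewrite ?normc_ge0 ?exprn_ge0 ?exprn_ile1 ?normc_ge0 ?(ltW hz')//.
  have [_ hj] := hphi j; apply: hj; apply: leq_trans Kj.
  by rewrite ltnS ltn_double ltn_ord.
exists (maxn n1 (maxn N K.*2.+1)) => i j; rewrite !geq_max => /andP[i1 i2] /andP[j1 j2].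
rewrite -!geq_max in i2 j2.
have -> : (P (phi i + n0)%N).[z] - (P (phi j + n0)%N).[z] =
  (((P (phi i + n0)%N).[z] - \sum_(k < K) (P (phi i + n0)%N)`_k * z ^+ k) +
   (\sum_(k < K) (P (phi i + n0)%N)`_k * z ^+ k - \sum_(k < K) b k * z ^+ k)) -
  (((P (phi j + n0)%N).[z] - \sum_(k < K) (P (phi j + n0)%N)`_k * z ^+ k) +
   (\sum_(k < K) (P (phi j + n0)%N)`_k * z ^+ k - \sum_(k < K) b k * z ^+ k)) by ring.
have -> : e = (e / 4 + e / 4) + (e / 4 + e / 4) by field.
apply: le_trans (le_normcB _ _) _.
by apply: lerD; apply: le_trans (le_normcD _ _) _; apply: lerD;
  do ?[exact: tail | exact: head].
Qed.

(** Polynomials close to the [f n] converge pointwise along a diagonal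
    subsequence. Differentiability passes to the limit through the second
    order estimate, because its linear coefficients are bounded and so have a
    cluster point. *)
Theorem montel (f : nat -> R[i] -> R[i]) :
  (forall n, poly_approx (f n)) -> locally_bounded f ->
  exists phi (F : R[i] -> R[i]), [/\ forall j, (j <= phi j)%N, analytic_on_disc F &
    forall z, disc z -> ccvg (fun j => f (phi j) z) (F z)].
Proof.
move=> af fB.
have /choice[P hP] : forall n : nat, exists P : {poly R[i]},
    forall z, normc z <= 1 - n.+1%:R^-1 -> normc (f n z - P.[z]) <= n.+1%:R^-1.
  by move=> n; apply: af; rewrite ?invr_gt0// gtrBl invr_gt0.
have near1 r : r < 1 -> exists N, forall n, (N <= n)%N -> r <= 1 - n.+1%:R^-1.
  move=> r1; have [|N hN] := @exists_invn_le (1 - r); first by rewrite subr_gt0.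
  by exists N => n /hN; rewrite lerBrDl -lerBrDr.
have PB : forall r, r < 1 -> exists M n0, forall n z, (n0 <= n)%N -> normc z <= r ->
     normc (P n).[z] <= M.
  move=> r r1; have [M hM] := fB r r1; have [N hN] := near1 r r1.
  exists (M + 1), N => n z Nn zr.
  rewrite -(subKr (f n z) (P n).[z]) (le_trans (le_normcB _ _))// lerD ?hM//.
  rewrite (le_trans (hP n z _)) ?(le_trans zr) ?hN//.
  by rewrite invf_le1// ler1n.
have [phi [phij hphi]] := normal_family_pointwise PB.
have /choice[F hF] : forall z, exists l, disc z -> ccvg (fun j => (P (phi j)).[z]) l.
  move=> z; have [hz|nz] := pselect (disc z); last by exists 0.
  by have [l hl] := hphi z hz; exists l.
exists phi, F; split => //.
- move=> z hz; have hz' : normc z < 1 := hz.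
  pose d := (1 - normc z) / 2.
  have d0 : 0 < d by rewrite divr_gt0// subr_gt0.
  have r1 : normc z + d < 1 by rewrite /d; move: hz'; lra.
  have [M [n1 hM]] := PB _ r1.
  have inr w : normc (w - z) <= d -> normc w <= normc z + d.
    move=> wz; rewrite -(subrK z w) (le_trans (le_normcD _ _))//.
    by rewrite [leRHS]addrC lerD2r.
  have /choice[c hc] : forall n, exists c : R[i], (n1 <= n)%N -> normc c <= M / d /\
      forall h, normc h <= d / 2 ->
      normc ((P n).[z + h] - (P n).[z] - c * h) <= 2 * M / d ^+ 2 * normc h ^+ 2.
    move=> n; have [n1n|nn] := pselect (n1 <= n)%N; last by exists 0 => /nn.
    have [c hc1 hc2] := @horner_second_order R (P n) M d z d0
      (fun w hw => hM n w n1n (inr w hw)).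
    by exists c.
  have n1phi j : (n1 <= phi (j + n1))%N.
    by apply: leq_trans (phij _); rewrite leq_addl.
  have [D [psi [psij hD]]] := @bounded_cluster (fun j => c (phi (j + n1)%N)) (M / d)
    (fun j => proj1 (hc _ (n1phi j))).
  have M0 : 0 <= M.
    by apply: le_trans (normc_ge0 _) (hM n1 z (leqnn _) _); rewrite lerDl ltW.
  apply: (@derivable_second_order F z D (2 * M / d ^+ 2) (d / 2)).
  + exact: divr_gt0.
  + by apply: divr_ge0; [exact: mulr_ge0|exact: sqr_ge0].
  move=> h hd; apply/ler_addgt0Pr => e e0.
  have zh : disc (z + h).
    rewrite /disc/=; apply: le_lt_trans r1; apply: le_trans (le_normcD _ _) _.
    by rewrite lerD2l (le_trans hd)// ler_pdivrMr// ler_peMr ?ler1n// ltW.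
  have h1 : normc h <= 1.
    by apply: le_trans hd _; rewrite /d; have := normc_ge0 z; lra.
  have e3 : 0 < e / 3 by rewrite divr_gt0.
  have [N1 hN1] := hF _ zh _ e3; have [N2 hN2] := hF _ hz _ e3.
  have [N3 hN3] := hD _ e3.
  pose j := maxn N1 (maxn N2 N3).
  have jN1 : (N1 <= psi j + n1)%N.
    by apply: leq_trans (leq_addr _ _); apply: leq_trans (psij j); rewrite leq_maxl.
  have jN2 : (N2 <= psi j + n1)%N.
    apply: leq_trans (leq_addr _ _); apply: leq_trans (psij j).
    by rewrite /j leq_max leq_maxl orbT.
  have jN3 : (N3 <= j)%N by rewrite /j !leq_max leqnn !orbT.
  have [_ hcj] := hc _ (n1phi (psi j)).
  set Q := P (phi (psi j + n1)%N) in hcj.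
  set cj := c _ in hcj.
  have -> : F (z + h) - F z - D * h = (Q.[z + h] - Q.[z] - cj * h) +
    ((F (z + h) - Q.[z + h]) - (F z - Q.[z]) - (D - cj) * h) by ring.
  apply: le_trans (le_normcD _ _) _; apply: lerD; first exact: hcj.
  have -> : e = e / 3 + e / 3 + e / 3 by field.
  apply: le_trans (le_normcB _ _) _; apply: lerD.
    by apply: le_trans (le_normcB _ _) _; apply: lerD; [exact: hN1|exact: hN2].
  rewrite normcM -[leRHS]mulr1; apply: ler_pM; rewrite ?normc_ge0//.
  exact: hN3.
- move=> z hz e e0; have e2 : 0 < e / 2 by rewrite divr_gt0.
  have [N1 hN1] := hF _ hz _ e2; have [N2 hN2] := exists_invn_le e2.
  have [N3 hN3] := near1 _ hz.
  exists (maxn N1 (maxn N2 N3)) => j; rewrite !geq_max => /and3P[j1 j2 j3].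
  have -> : F z - f (phi j) z = (F z - (P (phi j)).[z]) - (f (phi j) z - (P (phi j)).[z]) by ring.
  rewrite (le_trans (le_normcB _ _))// [leRHS](splitr e) lerD ?hN1//.
  apply: le_trans (hP _ _ _) _; first by apply: hN3; apply: leq_trans j3 (phij j).
  by apply: hN2; apply: leq_trans j2 (phij j).
Qed.

End Montel.

(** * Continuous functions on the disc *)

Section DiscContinuity.
Variable R : realType.
Implicit Types (f g : R[i] -> R[i]) (z v : R[i]).

Definition continuous_on_disc f := forall z, disc z -> forall e : R, 0 < e ->
  exists2 d : R, 0 < d & forall v, normc (v - z) < d -> normc (f v - f z) <= e.

Lemma analytic_continuous_on_disc f : analytic_on_disc f -> continuous_on_disc f.
Proof.
move=> af z hz e e0.
have /derivable1_diffP/differentiable_continuous/cvgrPdist_le cf := af z hz.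
have e0C : (0 : R[i]) < e%:C by rewrite (_ : 0 = (0 : R)%:C)// ltcR.
have /nbhs_ballP[d /= d0 hd] := cf _ e0C.
have [d' dd'] : exists d' : R, d = d'%:C.
  by exists (complex.Re d); case: d d0 {hd} => x y; rewrite ltcE /= => /andP[/eqP -> _].
rewrite dd' in d0 hd; exists d'; first by rewrite -(ltcR 0 d').
move=> v vz; have := hd v; rewrite /ball /= => /(_ _).
rewrite !normcE_norm lecR ltcR => h.
by rewrite normc_distC h// normc_distC.
Qed.

Lemma continuous_on_disc_cst (c : R[i]) : continuous_on_disc (fun=> c).
Proof. by move=> z _ e e0; exists 1 => // v _; rewrite subrr normc0 ltW. Qed.

Lemma continuous_on_disc_id : continuous_on_disc (fun z => z).
Proof. by move=> z _ e e0; exists e => // v /ltW. Qed.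

Lemma continuous_on_discB f g : continuous_on_disc f -> continuous_on_disc g ->
  continuous_on_disc (fun z => f z - g z).
Proof.
move=> cf cg z hz e e0; have e2 : 0 < e / 2 by rewrite divr_gt0.
have [d1 d10 h1] := cf z hz _ e2; have [d2 d20 h2] := cg z hz _ e2.
exists (Num.min d1 d2); first by rewrite lt_min d10.
move=> v; rewrite lt_min => /andP[v1 v2].
have -> : f v - g v - (f z - g z) = (f v - f z) - (g v - g z) by ring.
by rewrite (le_trans (le_normcB _ _))// [leRHS](splitr e) lerD ?h1 ?h2.
Qed.

Lemma continuous_on_discM f g : continuous_on_disc f -> continuous_on_disc g ->
  continuous_on_disc (fun z => f z * g z).
Proof.
move=> cf cg z hz e e0.
pose M := normc (f z) + normc (g z) + 1.
have M0 : 0 < M by rewrite /M ltr_wpDl// addr_ge0// normc_ge0.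
pose t := Num.min 1 (e / 2 / M).
have t0 : 0 < t by rewrite lt_min ltr01 !divr_gt0.
have [d1 d10 h1] := cf z hz _ t0; have [d2 d20 h2] := cg z hz _ t0.
exists (Num.min d1 d2); first by rewrite lt_min d10.
move=> v; rewrite lt_min => /andP[/h1 v1 /h2 v2].
have -> : f v * g v - f z * g z = (f v - f z) * g v + f z * (g v - g z) by ring.
apply: le_trans (le_normcD _ _) _; rewrite !normcM [leRHS](splitr e).
have tM : t * M <= e / 2 by rewrite -ler_pdivlMr// ge_min lexx orbT.
apply: lerD; apply: le_trans tM; last first.
  rewrite mulrC; apply: ler_pM; rewrite ?normc_ge0// /M -addrA lerDl.
  by rewrite addr_ge0// normc_ge0.
apply: ler_pM; rewrite ?normc_ge0//.
rewrite -(subrK (g z) (g v)) (le_trans (le_normcD _ _))//.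
have : normc (g v - g z) <= 1 by rewrite (le_trans v2)// ge_min lexx.
by rewrite /M; have := normc_ge0 (f z); lra.
Qed.

Lemma continuous_on_disc_horner (q : {poly R[i]}) : continuous_on_disc (fun z => q.[z]).
Proof.
elim/poly_ind: q => [|q c IHq].
  rewrite (_ : (fun _ => _) = (fun=> 0)); first exact: continuous_on_disc_cst.
  by apply/funext => z; rewrite horner0.
rewrite (_ : (fun _ => _) = (fun z => q.[z] * z - - c)).
  apply: continuous_on_discB; last exact: continuous_on_disc_cst.
  by apply: continuous_on_discM => //; exact: continuous_on_disc_id.
by apply/funext => z; rewrite !hornerE opprK.
Qed.

(** A function of the plane that is constant on the cells of a square grid is
    Borel, whatever its values: there are countably many cells. *)
Lemma measurable_grid_fun (m : nat) (G : R[i] -> R) :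
  measurable_fun setT (fun u : R * R =>
    G ((Num.floor (u.1 * m.+1%:R))%:~R / m.+1%:R +i*
       ((Num.floor (u.2 * m.+1%:R))%:~R / m.+1%:R))).
Proof.
pose cell (i : int) : set R := `[i%:~R / m.+1%:R, (i + 1)%:~R / m.+1%:R[%classic.
have m0 : (0 : R) < m.+1%:R by rewrite ltr0n.
have cellE i x : cell i x <-> Num.floor (x * m.+1%:R) = i.
  rewrite /cell/= in_itv/= ler_pdivrMr// ltr_pdivlMr//.
  split => [h|<-]; last exact: floor_itv.
  by apply: floor_def.
pose F n : set (R * R) := if unpickle n is Some ij
  then cell (ij : int * int).1 `*` cell ij.2 else set0.
apply: (@measurable_countable_cover _ _ _ _ F) => [n||n u v].
- rewrite /F; case: unpickle => [[i j]|]; last exact: measurable0.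
  by apply: measurableX; exact: measurable_itv.
- apply/seteqP; split => // u _.
  exists (pickle (Num.floor (u.1 * m.+1%:R), Num.floor (u.2 * m.+1%:R))); first exact: I.
  by rewrite /F pickleK; split; apply/cellE.
- rewrite /F; case: unpickle => [[i j]|]//.
  by move=> [/cellE-> /cellE->] [/cellE-> /cellE->].
Qed.

(** On the disc, a continuous function is the pointwise limit of its values at
    the corners of finer and finer square grids. *)
Lemma measurable_continuous_on_disc f : continuous_on_disc f ->
  measurable_fun (@plane_disc R) (fun u : R * R => normc (f (of_plane u))).
Proof.
move=> cf.
apply: (@measurable_fun_cvg _ _ _ _ (fun m (u : R * R) =>
    normc (f ((Num.floor (u.1 * m.+1%:R))%:~R / m.+1%:R +i*
       ((Num.floor (u.2 * m.+1%:R))%:~R / m.+1%:R))))).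
  move=> m; apply: measurable_funTS.
  exact: (@measurable_grid_fun m (fun z => normc (f z))).
move=> u Du; apply/cvgrPdist_le => e e0.
have [d d0 hd] := cf _ Du _ e0.
have d3 : 0 < d / 3 by rewrite divr_gt0.
have [N hN] := exists_invn_le d3.
exists N => // m /= Nm; set v := (X in _ - normc (f X)).
have rnd (x : R) : `|(Num.floor (x * m.+1%:R))%:~R / m.+1%:R - x| <= m.+1%:R^-1.
  have m0 : (0 : R) < m.+1%:R by rewrite ltr0n.
  have /andP[h1 h2] := floor_itv (x * m.+1%:R).
  rewrite -[X in _ - X](mulfK (lt0r_neq0 m0) x) -mulrBl normrM.
  rewrite [X in _ * X]ger0_norm ?invr_ge0 ?(ltW m0)//.
  rewrite ler_piMl ?invr_ge0 ?(ltW m0)// ler_norml.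
  by rewrite intrD in h2; move: h1 h2; lra.
have vu : normc (v - of_plane u) < d.
  apply: le_lt_trans (normc_le_ReIm _) _; rewrite /v/of_plane /=.
  apply: (@le_lt_trans _ _ (d / 3 + d / 3)); last by lra.
  by apply: lerD; apply: le_trans (hN _ Nm); exact: rnd.
have := hd _ vu; rewrite ler_norml => h; apply/andP; split.
  by rewrite lerNl opprB (le_trans (lerB_normc _ _)).
by rewrite (le_trans (lerB_normc _ _))// normc_distC.
Qed.

Lemma open_disc z : disc z -> exists2 d : R, 0 < d & forall v, normc (v - z) < d -> normc v < normc z + d /\ normc z + d < 1.
Proof.
move=> hz; have hz' : normc z < 1 := hz; exists ((1 - normc z) / 2).
  by rewrite divr_gt0// subr_gt0.
move=> v vz; split; last by move: hz'; lra.
by rewrite -{1}(subrK z v) (le_lt_trans (le_normcD _ _))// addrC ltrD2l.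
Qed.

End DiscContinuity.

(** * Weighted means of analytic functions *)

Section LowerIntegral.
Context {d : measure_display} {T : measurableType d} {R : realType}.

(** The integral of a nonnegative function is a supremum over the simple
    functions below it, hence monotone even on functions that are not Borel,
    such as those that contain the given weight. *)
Lemma le_integral_nonneg (mu : {measure set T -> \bar R}) (D : set T) (F G : T -> \bar R) :
  (forall x, D x -> (0 <= F x)%E) -> (forall x, D x -> (F x <= G x)%E) ->
  (\int[mu]_(x in D) F x <= \int[mu]_(x in D) G x)%E.
Proof.
move=> F0 FG; have G0 x : D x -> (0 <= G x)%E.
  by move=> Dx; exact: le_trans (F0 x Dx) (FG x Dx).
rewrite !ge0_integralE//; apply: le_ereal_sup => _ [h hF <-]; exists h => // x.
apply: le_trans (hF x) _; rewrite /patch; case: ifPn => // /set_mem; exact: FG.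
Qed.

End LowerIntegral.

Section WeightedMeans.
Variable R : realType.
Local Notation mu2 := (@lebesgue_measure R \x @lebesgue_measure R)%E.
Implicit Types (f g : R[i] -> R[i]) (z v : R[i]).

Lemma powR_add_le (p a b : R) : 0 <= p -> 0 <= a -> 0 <= b ->
  (a + b) `^ p <= 2 `^ p * (a `^ p + b `^ p).
Proof.
move=> p0; wlog ab : a b / a <= b => [h a0 b0|a0 b0].
  have [ab|/ltW ba] := leP a b; first exact: h.
  by rewrite addrC [X in _ * X]addrC; exact: h.
apply: (@le_trans _ _ ((2 * b) `^ p)).
  by apply: ge0_ler_powR; rewrite ?nnegrE ?addr_ge0 ?mulr_ge0//; move: ab; lra.
by rewrite powRM// ler_wpM2l ?powR_ge0// lerDr powR_ge0.
Qed.

Lemma area_plane_disc_le : (mu2 (@plane_disc R) <= 4%:E)%E.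
Proof.
apply: (@le_trans _ _ (mu2 (square (0, 0) 1))).
  apply: le_measure; rewrite ?inE.
  - exact: measurable_plane_disc.
  - exact: measurable_square.
  move=> [x y]; rewrite /plane_disc/disc/= => h; split; rewrite /= in_itv/=.
    have := le_lt_trans (ler_Re (x +i* y)) h.
    by rewrite ltr_norml sub0r add0r.
  have := le_lt_trans (ler_Im (x +i* y)) h.
  by rewrite ltr_norml sub0r add0r.
by rewrite area_square// lee_fin mulr1 -natrX.
Qed.

Variables (W : R[i] -> R) (rW C : R) (K : nat).
Hypothesis bW : borel_invariant W rW C.
Hypothesis hK : forall a b, disc a -> disc b ->
    W a * (1 - normc b) ^+ K <= C * W (mobius a b).

Definition weighted_integral (p : R) f : \bar R :=
  (\int[mu2]_(u in @plane_disc R) (normc (f (of_plane u)) `^ p * W (of_plane u))%:E)%E.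

Lemma weighted_integral_ge0 p f : (0 <= weighted_integral p f)%E.
Proof.
apply: integral_ge0 => u _; rewrite lee_fin mulr_ge0 ?powR_ge0//.
exact: (binv_ge0 bW).
Qed.

Lemma measurable_weighted p f :
  measurable_fun (@plane_disc R) (fun u : R * R => normc (f (of_plane u))) ->
  measurable_fun (@plane_disc R)
    (fun u : R * R => normc (f (of_plane u)) `^ p * W (of_plane u)).
Proof.
move=> mf; apply: measurable_funM.
  exact: (measurableT_comp (@measurable_powR R p) mf).
exact: measurable_funTS (binv_meas bW).
Qed.

Lemma weight_lower_bound (s : R) : s < 1 ->
  exists2 m : R, 0 < m & forall z, normc z <= s -> m <= W z.
Proof.
move=> s1; have C0 : 0 < C by exact: lt_le_trans ltr01 (binv_C1 bW).
exists (C^-1 * (W 0 * (1 - s) ^+ K)).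
  rewrite !mulr_gt0 ?invr_gt0 ?exprn_gt0 ?subr_gt0//.
  exact: (binv_gt0 bW (@disc0 R)).
move=> z zs; have hz : disc (- z) by rewrite /disc/mkset normcN (le_lt_trans zs).
rewrite -ler_pdivlMl ?invr_gt0// invrK.
have := hK (@disc0 R) hz; rewrite mobius_0l opprK normcN => /(le_trans _); apply.
rewrite ler_wpM2l ?(binv_ge0 bW)//; apply: lerXn2r; rewrite ?nnegrE ?subr_ge0 ?(ltW s1)//.
  by rewrite (le_trans zs)// ltW.
by rewrite lerB.
Qed.

(** The mean of f controls f on compact subsets, by the sub-mean value property
    of a polynomial within distance 1 of f.  The error 1 makes the bound
    inhomogeneous, which is harmless for normal families. *)
Lemma weighted_integral_locally_bounded (p s B : R) : 0 < p -> s < 1 -> 0 <= B ->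
  exists M, forall f, poly_approx f -> (weighted_integral p f <= B%:E)%E ->
    forall z, normc z <= s -> normc (f z) <= M.
Proof.
move=> p0 s1 B0; pose rho := (1 - s) / 2.
have rho0 : 0 < rho by rewrite divr_gt0// subr_gt0.
have s1' : s + rho < 1 by rewrite /rho; move: s1; lra.
have [m m0 hm] := weight_lower_bound s1'.
pose c : R := 2 `^ p.
have c0 : 0 < c by rewrite powR_gt0.
pose A := c * (m^-1 * B + 4) / rho ^+ 2.
exists (A `^ p^-1 + 1) => f af fB z zs.
have [P hP] := af _ s1' 1 ltr01.
have ballP u : plane_ball z rho u -> normc (of_plane u) <= s + rho.
  rewrite /plane_ball/mkset => h; rewrite -(subrK z (of_plane u)).
  by rewrite (le_trans (le_normcD _ _))// addrC lerD// ltW.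
have ballD : plane_ball z rho `<=` @plane_disc R.
  by move=> u /ballP /le_lt_trans; exact.
have mP : measurable_fun (@plane_disc R)
    (fun u : R * R => (normc P.[of_plane u] `^ p)%:E).
  apply/measurable_EFinP/(measurableT_comp (@measurable_powR R p)).
  exact/measurable_normc/cmeasurable_horner/cmeasurable_of_plane.
have mf := measurable_weighted p (measurable_poly_approx af).
have mD := @measurable_plane_disc R.
have Pz : normc P.[z] `^ p <= A.
  rewrite /A ler_pdivlMr ?exprn_gt0// mulrC -lee_fin.
  apply: le_trans (submean_poly P z p0 rho0) _.
  pose G (u : R * R) : \bar R :=
    (c%:E * (m^-1%:E * (normc (f (of_plane u)) `^ p * W (of_plane u))%:E + 1%:E))%E.
  have G1 u : (0 <= m^-1%:E * (normc (f (of_plane u)) `^ p * W (of_plane u))%:E)%E.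
    by rewrite -EFinM lee_fin mulr_ge0 ?invr_ge0 ?(ltW m0)// mulr_ge0 ?powR_ge0// (binv_ge0 bW).
  have mG1 : measurable_fun (@plane_disc R) (fun u : R * R =>
      (m^-1%:E * (normc (f (of_plane u)) `^ p * W (of_plane u))%:E))%E.
    by apply: measurable_funeM; exact/measurable_EFinP.
  apply: (@le_trans _ _ (\int[mu2]_(u in plane_ball z rho) G u)%E).
    apply: le_integral_nonneg => u hu; first by rewrite lee_fin powR_ge0.
    rewrite /G -EFinM lee_fin.
    have hu' := ballP _ hu; have := hP _ hu'; rewrite normc_distC => h1.
    apply: (@le_trans _ _ ((normc (f (of_plane u)) + 1) `^ p)).
      apply: ge0_ler_powR; rewrite ?nnegrE ?addr_ge0 ?normc_ge0 ?(ltW p0)//.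
      by rewrite -lerBlDl (le_trans (lerB_normc _ _)).
    apply: (le_trans (powR_add_le (ltW p0) (normc_ge0 _) ler01)).
    rewrite powR1 ler_wpM2l ?(ltW c0)// lerD2r mulrCA ler_peMr ?powR_ge0//.
    by rewrite mulrC ler_pdivlMr// mul1r hm.
  apply: (@le_trans _ _ (\int[mu2]_(u in @plane_disc R) G u)%E).
    apply: ge0_subset_integral => //; first exact: measurable_plane_ball.
      apply: measurable_funeM; apply: emeasurable_funD => //.
    move=> u _; apply: mule_ge0; first by rewrite lee_fin ltW.
    by apply: adde_ge0; [exact: G1|rewrite lee_fin].
  rewrite /G ge0_integralZl//; last 3 first.
  - by apply: emeasurable_funD.
  - by move=> u _; apply: adde_ge0; [exact: G1|rewrite lee_fin].
  - by rewrite lee_fin ltW.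
  rewrite ge0_integralD//.
  rewrite ge0_integralZl//; last 3 first.
  - exact/measurable_EFinP.
  - by move=> u _; rewrite lee_fin mulr_ge0 ?powR_ge0// (binv_ge0 bW).
  - by rewrite lee_fin invr_ge0 ltW.
  rewrite integral_cst// mul1e EFinM lee_pmul2l// ?lte_fin//.
  rewrite EFinD EFinM; apply: leeD; last exact: area_plane_disc_le.
  by rewrite lee_pmul2l// lte_fin invr_gt0.
have A0 : 0 <= A := le_trans (powR_ge0 _ _) Pz.
rewrite -(subrK P.[z] (f z)) (le_trans (le_normcD _ _))// addrC lerD//; last first.
  by apply: hP; rewrite (le_trans zs)// lerDl ltW.
rewrite -[leLHS](@powRr1 _ (normc P.[z])) ?normc_ge0// -(mulfV (lt0r_neq0 p0)) powRrM.
by apply: ge0_ler_powR; rewrite ?nnegrE ?powR_ge0 ?invr_ge0 ?(ltW p0).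
Qed.

(** A nonzero value would bound [normc g] below on a ball, where the weight is
    bounded below too. *)
Lemma weighted_integral_eq0 (p : R) g : 0 < p -> continuous_on_disc g ->
  (weighted_integral p g <= 0)%E -> forall z, disc z -> g z = 0.
Proof.
move=> p0 cg g0 z hz; apply/eqP/negPn/negP => gz.
have c0 : 0 < normc (g z) / 2 by rewrite divr_gt0// normc_gt0.
have [d1 d10 h1] := cg z hz _ c0; have [d2 d20 h2] := open_disc hz.
pose d := Num.min d1 d2.
have d0 : 0 < d by rewrite lt_min d10.
have [|_ s1] := h2 z; first by rewrite subrr normc0.
have [m m0 hm] := weight_lower_bound s1.
pose k := (normc (g z) / 2) `^ p * m.
have k0 : 0 < k by rewrite mulr_gt0// powR_gt0.
have mB := @measurable_plane_ball R z d.
have : ((k * d ^+ 2)%:E <= 0)%E.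
  apply: le_trans g0; rewrite EFinM.
  apply: (@le_trans _ _ (\int[mu2]_(u in plane_ball z d) k%:E)%E).
    by rewrite integral_cst// lee_pmul2l ?lte_fin// area_plane_ball_ge.
  apply: (@le_trans _ _ (\int[mu2]_(u in plane_ball z d)
      (normc (g (of_plane u)) `^ p * W (of_plane u))%:E)%E).
    apply: le_integral_nonneg => u; first by rewrite lee_fin ltW.
    rewrite /plane_ball/mkset lt_min => /andP[u1 u2]; rewrite lee_fin.
    apply: ler_pM; rewrite ?powR_ge0 ?(ltW m0)//; last first.
      by apply: hm; have [/ltW] := h2 _ u2.
    apply: ge0_ler_powR; rewrite ?nnegrE ?normc_ge0 ?(ltW c0) ?(ltW p0)//.
    have := h1 _ u1; rewrite normc_distC => h.
    by have := le_trans (lerB_normc (g z) (g (of_plane u))) h; lra.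
  apply: (ge0_subset_integral mu2 mB (@measurable_plane_disc R)).
  - by apply/measurable_EFinP; apply: measurable_weighted; exact: measurable_continuous_on_disc.
  - by move=> u _; rewrite lee_fin mulr_ge0 ?powR_ge0// (binv_ge0 bW).
  move=> u; rewrite /plane_ball/mkset lt_min => /andP[_ u2].
  by have [v1 v2] := h2 _ u2; exact: lt_trans v1 v2.
by rewrite lee_fin leNgt mulr_gt0// exprn_gt0.
Qed.

Lemma weighted_integral_sub_le (p : R) f g : 0 < p -> p <= 2 ->
  continuous_on_disc f -> continuous_on_disc g ->
  (weighted_integral p g <= 4%:E * (weighted_integral p f +
     weighted_integral p (fun z => (f z - g z)%R)))%E.
Proof.
move=> p0 p2 cf cg.
have mE h : continuous_on_disc h -> measurable_fun (@plane_disc R)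
    (fun u : R * R => (normc (h (of_plane u)) `^ p * W (of_plane u))%:E).
  move=> ch; apply/measurable_EFinP; apply: measurable_weighted.
  exact: measurable_continuous_on_disc.
have mf := mE _ cf; have mg := mE _ (continuous_on_discB cf cg).
have E0 h (u : R * R) : @plane_disc R u ->
    (0 <= (normc (h (of_plane u)) `^ p * W (of_plane u))%:E)%E.
  by move=> _; rewrite lee_fin mulr_ge0 ?powR_ge0// (binv_ge0 bW).
have mD := @measurable_plane_disc R.
have EfE := E0 f; have EgE := E0 (fun z => f z - g z).
rewrite /weighted_integral -(ge0_integralD mu2 mD EfE mf EgE mg) -ge0_integralZl//; last 2 first.
- exact: emeasurable_funD.
- by move=> u Du; apply: adde_ge0; [exact: EfE|exact: EgE].
apply: le_integral_nonneg => u Du; first exact: E0.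
rewrite -EFinD -EFinM lee_fin -mulrDl mulrA ler_wpM2r ?(binv_ge0 bW)//.
set a := f _; set b := g _.
apply: (@le_trans _ _ ((normc a + normc (a - b)) `^ p)).
  apply: ge0_ler_powR; rewrite ?nnegrE ?addr_ge0 ?normc_ge0 ?(ltW p0)//.
  by rewrite -{1}(subKr a b) le_normcB.
apply: le_trans (powR_add_le (ltW p0) (normc_ge0 _) (normc_ge0 _)) _.
rewrite ler_wpM2r ?addr_ge0 ?powR_ge0//.
have -> : (4 : R) = 2 `^ 2%:R by rewrite powR_mulrn// -natrX.
by rewrite ler_powR// ler1n.
Qed.

End WeightedMeans.

(** * The factorization for a Borel weight *)

Section WeightedFactorization.
Variable R : realType.
Local Notation mu2 := (@lebesgue_measure R \x @lebesgue_measure R)%E.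
Implicit Types (f g F : R[i] -> R[i]) (z : R[i]).

Lemma ccvg_subseq (u : nat -> R[i]) l (phi : nat -> nat) :
  (forall j, (j <= phi j)%N) -> ccvg u l -> ccvg (u \o phi) l.
Proof.
move=> hphi ul e /ul[N hN]; exists N => n Nn.
by apply: hN; exact: leq_trans (hphi n).
Qed.

Lemma ccvgM (u v : nat -> R[i]) a b :
  ccvg u a -> ccvg v b -> ccvg (fun n => u n * v n) (a * b).
Proof.
move=> ua vb e e0.
pose M := normc a + normc b + 1.
have M0 : 0 < M by rewrite /M ltr_wpDl// addr_ge0// normc_ge0.
pose t := Num.min 1 (e / 2 / M).
have t0 : 0 < t by rewrite lt_min ltr01 !divr_gt0.
have tM : t * M <= e / 2 by rewrite -ler_pdivlMr// ge_min lexx orbT.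
have [N1 h1] := ua _ t0; have [N2 h2] := vb _ t0.
exists (maxn N1 N2) => n; rewrite geq_max => /andP[/h1 n1 /h2 n2].
have -> : a * b - u n * v n = (a - u n) * b + u n * (b - v n) by ring.
apply: le_trans (le_normcD _ _) _; rewrite !normcM [leRHS](splitr e).
apply: lerD; apply: le_trans tM.
  apply: ler_pM; rewrite ?normc_ge0// /M -addrA addrC -addrA lerDl.
  by rewrite addr_ge0// normc_ge0.
rewrite mulrC; apply: ler_pM; rewrite ?normc_ge0//.
rewrite -(subKr a (u n)) (le_trans (le_normcB _ _))//.
have : normc (a - u n) <= 1 by rewrite (le_trans n1)// ge_min lexx.
by rewrite /M; have := normc_ge0 b; lra.
Qed.

Lemma ccvgB (u v : nat -> R[i]) a b :
  ccvg u a -> ccvg v b -> ccvg (fun n => u n - v n) (a - b).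
Proof.
move=> ua vb e e0; have e2 : 0 < e / 2 by rewrite divr_gt0.
have [N1 h1] := ua _ e2; have [N2 h2] := vb _ e2.
exists (maxn N1 N2) => n; rewrite geq_max => /andP[/h1 n1 /h2 n2].
have -> : a - b - (u n - v n) = (a - u n) - (b - v n) by ring.
by rewrite (le_trans (le_normcB _ _))// [leRHS](splitr e) lerD.
Qed.

Lemma ccvg_cst (a : R[i]) : ccvg (fun=> a) a.
Proof. by move=> e e0; exists 0%N => n _; rewrite subrr normc0 ltW. Qed.

Lemma ccvg_normc (u : nat -> R[i]) l : ccvg u l ->
  normc (u n) @[n --> \oo] --> normc l.
Proof.
move=> ul; apply: cvg_normc; apply/cvgrPdist_le => e e0.
have [N hN] := ul e e0; exists N => // n /= Nn.
by rewrite sub0r normrN ger0_norm ?normc_ge0// hN.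
Qed.

Variables (W : R[i] -> R) (rW C : R) (K : nat).
Hypothesis bW : borel_invariant W rW C.
Hypothesis hK : forall a b, disc a -> disc b ->
    W a * (1 - normc b) ^+ K <= C * W (mobius a b).
Local Notation mean := (weighted_integral W).

Lemma weighted_integral_fatou (p : R) (g : nat -> R[i] -> R[i]) F (c : \bar R) : 0 < p ->
  (forall n, measurable_fun (@plane_disc R) (fun u : R * R => normc (g n (of_plane u)))) ->
  measurable_fun (@plane_disc R) (fun u : R * R => normc (F (of_plane u))) ->
  (forall z, disc z -> ccvg (g ^~ z) (F z)) ->
  (forall n, (mean p (g n) <= c)%E) -> (mean p F <= c)%E.
Proof.
move=> p0 mg mF gF gc.
apply: (@fatou_bound _ _ R mu2 _ (@measurable_plane_disc R)
  (fun n u => normc (g n (of_plane u)) `^ p * W (of_plane u))).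
- by move=> n; exact: measurable_weighted bW _ _ (mg n).
- by move=> n u _; rewrite mulr_ge0 ?powR_ge0// (binv_ge0 bW).
- exact: measurable_weighted bW _ _ mF.
- by move=> u _; rewrite mulr_ge0 ?powR_ge0// (binv_ge0 bW).
- apply: aeW => u Du; have := ccvg_normc (gF _ Du).
  have [->|F0] := eqVneq (F (of_plane u)) 0 => hg.
    exists (fun=> 0) => [|n]; last by rewrite mulr_ge0 ?powR_ge0// (binv_ge0 bW).
    by rewrite normc0 powR0 ?gt_eqF// mul0r; exact: cvg_cst.
  exists (fun n => normc (g n (of_plane u)) `^ p * W (of_plane u)) => //.
  have Fp : normc (F (of_plane u)) \in `]0, +oo[ by rewrite in_itv/= normc_gt0 F0.
  have /derivable1_diffP/differentiable_continuous cp := @derivable_powR R 1 p _ Fp.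
  have hp := cvg_comp _ _ hg cp.
  apply: cvgM; [exact: hp|exact: cvg_cst].
- exact: gc.
Qed.

(** Factor polynomials approximating f with the zeros distributed between the
    two factors, and pass to the limit: the factors form normal families, and
    Fatou's lemma keeps both the bounds and the product. *)
Lemma weighted_factorization f (p p1 p2 : R) :
  0 < p -> p <= 2 -> 0 < p1 -> 0 < p2 -> p^-1 = p1^-1 + p2^-1 ->
  analytic_on_disc f -> (mean p f < +oo)%E ->
  (forall e : R, 0 < e -> exists q : {poly R[i]},
     (mean p (fun z => (f z - q.[z])%R) <= e%:E)%E) ->
  exists f1 f2, [/\ analytic_on_disc f1, analytic_on_disc f2,
    forall z, disc z -> f z = f1 z * f2 z,
    (mean p1 f1 <= (16 * growth_const C K p1)%:E * mean p f)%E &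
    (mean p2 f2 <= (16 * growth_const C K p2)%:E * mean p f)%E].
Proof.
move=> p0 p2' p10 p20 pE af If fq.
have C0 : 0 < C by exact: lt_le_trans ltr01 (binv_C1 bW).
have I0 := weighted_integral_ge0 bW p f.
have cf := analytic_continuous_on_disc af.
have G k : 0 < k -> 0 < 16 * growth_const C K k.
  by move=> k0; rewrite mulr_gt0// growth_const_gt0.
(* Polynomials whose error is below the mean of [f] have means of the order of
   that of [f]; this comparison needs the mean of [f] to be positive. *)
have [f0|fn0] := eqVneq (mean p f) 0%E.
  exists (fun=> 0), (fun=> 0); split.
  - by move=> z _; exact: derivable_cst.
  - by move=> z _; exact: derivable_cst.
  - move=> z hz; rewrite mulr0.
    by apply: (weighted_integral_eq0 bW hK p0 cf _ hz); rewrite f0.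
  - rewrite f0 mule0 [leLHS]integral0_eq// => u _.
    by rewrite normc0 powR0 ?gt_eqF// mul0r.
  - rewrite f0 mule0 [leLHS]integral0_eq// => u _.
    by rewrite normc0 powR0 ?gt_eqF// mul0r.
pose I := fine (mean p f).
have IE : mean p f = I%:E by rewrite fineK// ge0_fin_numE.
have Ip : 0 < I.
  by rewrite -lte_fin -IE lt0e fn0.
have /choice[q hq] : forall n : nat, exists q : {poly R[i]},
    (mean p (fun z => (f z - q.[z])%R) <= (Num.min I n.+1%:R^-1)%:E)%E.
  by move=> n; apply: fq; rewrite lt_min Ip invr_gt0 ltr0n.
have qI n : (mean p (fun z => (q n).[z]) <= (8 * I)%:E)%E.
  have cq := @continuous_on_disc_horner R (q n).
  apply: le_trans (weighted_integral_sub_le bW p0 p2' cf cq) _.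
  apply: (@le_trans _ _ (4%:E * (I%:E + I%:E))%E).
    rewrite lee_pmul2l// IE leeD2l// (le_trans (hq n))// lee_fin ge_min lexx//.
  by rewrite -EFinD -EFinM lee_fin; lra.
have /choice[g hg] : forall n, exists g : (R[i] -> R[i]) * (R[i] -> R[i]),
    [/\ poly_approx g.1, poly_approx g.2, forall z, disc z -> (q n).[z] = g.1 z * g.2 z,
      (mean p1 g.1 <= (16 * growth_const C K p1 * I)%:E)%E &
      (mean p2 g.2 <= (16 * growth_const C K p2 * I)%:E)%E].
  move=> n; have qy := le_lt_trans (qI n) (ltry _).
  have [g1 [g2 [a1 a2 g12 h1 h2]]] := poly_factorization bW hK p0 p10 p20 pE qy.
  have le k : 0 < k -> ((2 * growth_const C K k)%:E * mean p (fun z => (q n).[z]) <=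
      (16 * growth_const C K k * I)%:E)%E.
    move=> k0; rewrite (_ : 16 * _ * I = (2 * growth_const C K k) * (8 * I)); last by ring.
    by rewrite [leRHS]EFinM lee_pmul2l// lte_fin mulr_gt0// growth_const_gt0.
  exists (g1, g2); split => //=.
    by apply: le_trans h1 _; exact: le.
  by apply: le_trans h2 _; exact: le.
have nf k (h : nat -> R[i] -> R[i]) : 0 < k -> (forall n, poly_approx (h n)) ->
    (forall n, (mean k (h n) <= (16 * growth_const C K k * I)%:E)%E) -> locally_bounded h.
  move=> k0 ah hh s s1; have B0 : 0 <= 16 * growth_const C K k * I.
    by rewrite mulr_ge0 ?(ltW Ip)// ltW// G.
  have [M hM] := weighted_integral_locally_bounded bW hK k0 s1 B0.
  by exists M => n z; exact: hM.
have a1 n : poly_approx (g n).1 by have [] := hg n.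
have a2 n : poly_approx (g n).2 by have [] := hg n.
have b1 n : (mean p1 (g n).1 <= (16 * growth_const C K p1 * I)%:E)%E by have [] := hg n.
have b2 n : (mean p2 (g n).2 <= (16 * growth_const C K p2 * I)%:E)%E by have [] := hg n.
have [phi [F1 [hphi aF1 cF1]]] := montel a1 (nf p1 _ p10 a1 b1).
have [psi [F2 [hpsi aF2 cF2]]] := montel (fun n => a2 (phi n))
  (nf p2 (fun n => (g (phi n)).2) p20 (fun n => a2 (phi n)) (fun n => b2 (phi n))).
pose th j := phi (psi j).
have hth j : (j <= th j)%N by exact: leq_trans (hpsi j) (hphi _).
have mE h : continuous_on_disc h -> measurable_fun (@plane_disc R)
    (fun u : R * R => normc (h (of_plane u))) by exact: measurable_continuous_on_disc.
have cc1 := analytic_continuous_on_disc aF1.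
have cc2 := analytic_continuous_on_disc aF2.
have lim1 z : disc z -> ccvg (fun j => (g (th j)).1 z) (F1 z).
  by move=> hz; exact: (ccvg_subseq hpsi (cF1 z hz)).
have limq z : disc z -> ccvg (fun j => (q (th j)).[z]) (F1 z * F2 z).
  move=> hz; have := ccvgM (lim1 z hz) (cF2 z hz).
  by congr ccvg; apply/funext => j; have [_ _ ->] := hg (th j).
have cq n := @continuous_on_disc_horner R (q n).
have c12 := continuous_on_discM cc1 cc2.
(* The polynomials converge to [F1 * F2] pointwise and to [f] in mean. *)
have dE : (mean p (fun z => (F1 z * F2 z - f z)%R) <= 0)%E.
  apply/lee_addgt0Pr => e e0; rewrite add0e.
  have [N hN] := exists_invn_le e0.
  apply: (@weighted_integral_fatou p (fun j z => (q (th (j + N)%N)).[z] - f z)) => //.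
  - by move=> n; exact: (mE _ (continuous_on_discB (cq _) cf)).
  - exact: (mE _ (continuous_on_discB c12 cf)).
  - move=> z hz; apply: ccvgB; last exact: ccvg_cst.
    apply: (@ccvg_subseq (fun j => (q (th j)).[z]) _ (fun j => j + N)%N _ (limq z hz)).
    by move=> j; exact: leq_addr.
  - move=> n; have := hq (th (n + N)%N).
    rewrite (_ : mean p (fun z => (f z - (q (th (n + N)%N)).[z])%R) =
                 mean p (fun z => ((q (th (n + N)%N)).[z] - f z)%R)); last first.
      by apply: eq_integral => u _; rewrite normc_distC.
    move=> /le_trans; apply; rewrite lee_fin ge_min; apply/orP; right.
    by apply: hN; apply: leq_trans (hth _); rewrite leq_addl.
exists F1, F2; split => //.
- move=> z hz; apply/esym/eqP; rewrite -subr_eq0; apply/eqP.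
  exact: (weighted_integral_eq0 bW hK p0 (continuous_on_discB c12 cf) dE hz).
- rewrite IE -EFinM.
  apply: (weighted_integral_fatou p10 _ (mE _ cc1) cF1); last by move=> n; exact: b1.
  by move=> n; exact: measurable_poly_approx.
- rewrite IE -EFinM.
  apply: (weighted_integral_fatou p20 _ (mE _ cc2) cF2); last by move=> n; exact: b2.
  by move=> n; exact: measurable_poly_approx.
Qed.

End WeightedFactorization.

(** * Comparison of the two weights, and the constant *)

Section WeightComparison.
Variable R : realType.
Local Notation mu2 := (@lebesgue_measure R \x @lebesgue_measure R)%E.
Implicit Types (f : R[i] -> R[i]) (z : R[i]).
Variables (w W : R[i] -> R) (rW C : R).
Hypothesis bW : borel_invariant W rW C.
Hypothesis wW : forall z, disc z -> w z <= C * W z /\ W z <= C * w z.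
Local Notation mean := (weighted_integral W).

Let C0 : 0 < C. Proof. exact: lt_le_trans ltr01 (binv_C1 bW). Qed.

Lemma comparable_weight_ge0 z : disc z -> 0 <= w z.
Proof.
move=> hz; have [_ h] := wW hz; have := binv_ge0 bW z => h0.
by rewrite -(pmulr_rge0 _ C0) (le_trans h0).
Qed.

Lemma bergman_integral_ge0 (p : R) f : (0 <= bergman_integral p w f)%E.
Proof.
rewrite /bergman_integral/area_integral mule_ge0 ?lee_fin ?invr_ge0 ?pi_ge0//.
by apply: integral_ge0 => u Du; rewrite lee_fin mulr_ge0 ?powR_ge0 ?comparable_weight_ge0.
Qed.

Lemma bergman_integral_le (p : R) f : continuous_on_disc f ->
  (bergman_integral p w f <= (pi^-1 * C)%:E * mean p f)%E.
Proof.
move=> cf; rewrite EFinM -muleA.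
rewrite lee_pmul2l ?lte_fin ?invr_gt0 ?pi_gt0//.
rewrite -ge0_integralZl//; first last.
- by rewrite lee_fin ltW.
- by move=> u _; rewrite lee_fin mulr_ge0 ?powR_ge0// (binv_ge0 bW).
- apply/measurable_EFinP; apply: (measurable_weighted bW).
  exact: measurable_continuous_on_disc.
- exact: measurable_plane_disc.
apply: le_integral_nonneg => u Du; rewrite ?lee_fin.
  by rewrite mulr_ge0 ?powR_ge0 ?comparable_weight_ge0.
by rewrite mulrCA ler_wpM2l ?powR_ge0// (proj1 (wW Du)).
Qed.

Lemma mean_le_bergman_integral (p : R) f : continuous_on_disc f ->
  (mean p f <= (pi * C)%:E * bergman_integral p w f)%E.
Proof.
move=> cf; rewrite /bergman_integral/area_integral muleA -EFinM mulrAC mulfV ?gt_eqF ?pi_gt0//.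
rewrite mul1r -lee_pdivrMl//.
rewrite -ge0_integralZl//; first last.
- by rewrite lee_fin invr_ge0 ltW.
- by move=> u _; rewrite lee_fin mulr_ge0 ?powR_ge0// (binv_ge0 bW).
- apply/measurable_EFinP; apply: (measurable_weighted bW).
  exact: measurable_continuous_on_disc.
- exact: measurable_plane_disc.
apply: le_integral_nonneg => u Du; rewrite -EFinM lee_fin.
  by rewrite !mulr_ge0 ?invr_ge0 ?powR_ge0 ?(ltW C0)// (binv_ge0 bW).
by rewrite mulrCA ler_wpM2l ?powR_ge0// ler_pdivrMl// (proj2 (wW Du)).
Qed.

Lemma dense_mean_le (p : R) f : 0 < p -> polynomials_dense p w -> bergman p w f ->
  forall e : R, 0 < e -> exists q : {poly R[i]},
    (mean p (fun z => (f z - q.[z])%R) <= e%:E)%E.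
Proof.
move=> p0 hd bf e e0; have k0 : 0 < pi * C by rewrite mulr_gt0 ?pi_gt0.
have d0 : 0 < e / (pi * C) by rewrite divr_gt0.
have d0' : 0 < (e / (pi * C)) `^ p^-1 by rewrite powR_gt0.
have [q hq] := hd f bf _ d0'; exists q.
have cfq : continuous_on_disc (fun z => f z - q.[z]).
  apply: continuous_on_discB; last exact: continuous_on_disc_horner.
  by apply: analytic_continuous_on_disc; case: bf.
apply: le_trans (mean_le_bergman_integral p cfq) _.
rewrite -lee_pdivlMl// -EFinM.
have B0 := bergman_integral_ge0 p (fun z => f z - q.[z]).
rewrite -[leLHS]poweRe1// -(mulVf (lt0r_neq0 p0)) poweRrM.
have -> : (pi * C)^-1 * e = ((e / (pi * C)) `^ p^-1) `^ p.
  by rewrite -powRrM mulVf ?gt_eqF// powRr1 ?(ltW d0)// mulrC.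
rewrite -poweR_EFin; apply: gt0_ler_poweR; first exact: ltW.
- by rewrite in_itv/= poweR_ge0 leey.
- by rewrite in_itv/= leey andbT lee_fin ltW.
- exact: ltW.
Qed.

(** A polynomial in the exponent [p] has a root of order [p] bounded uniformly
    in [p], because [p + 1 <= expR p]. *)
Lemma growth_root_le (c p : R) n : 1 <= c -> 1 <= p ->
  (c * (expR 1 * (p + 1)) ^+ n) `^ p^-1 <= c * expR 2 ^+ n.
Proof.
move=> c1 p1; have p0 : 0 < p by exact: lt_le_trans p1.
have c0 : 0 < c by exact: lt_le_trans c1.
have x0 : 0 <= expR 1 * (p + 1) by rewrite mulr_ge0 ?expR_ge0// addr_ge0// ltW.
rewrite powRM ?exprn_ge0 ?(ltW c0)//; apply: ler_pM; rewrite ?powR_ge0//.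
  by apply: ler1_powR => //; rewrite invf_le1.
rewrite -powRXn//; apply: lerXn2r; rewrite ?nnegrE ?powR_ge0 ?expR_ge0//.
apply: (@le_trans _ _ (expR (1 + p) `^ p^-1)).
  apply: ge0_ler_powR; rewrite ?nnegrE ?invr_ge0 ?expR_ge0 ?(ltW p0)//.
  by rewrite expRD ler_wpM2l ?expR_ge0// addrC expR_ge1Dx.
rewrite /powR gt_eqF ?expR_gt0// expRK ler_expR mulrC ler_pdivrMr//.
by move: p1; lra.
Qed.

Lemma norm_product_le (A1 A2 n r1 r2 : R) (N1 N2 : \bar R) :
  0 <= A1 -> 0 <= A2 -> 0 <= n -> 0 < r1 -> 0 < r2 -> (0 <= N1)%E -> (0 <= N2)%E ->
  (N1 <= (A1 * n)%:E)%E -> (N2 <= (A2 * n)%:E)%E ->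
  (N1 `^ r1 * N2 `^ r2 <= (A1 `^ r1 * A2 `^ r2)%:E * n%:E `^ (r1 + r2))%E.
Proof.
move=> A10 A20 n0 r10 r20 N10 N20 h1 h2.
have le (A r : R) (N : \bar R) : 0 <= A -> 0 < r -> (0 <= N)%E -> (N <= (A * n)%:E)%E ->
    (N `^ r <= (A `^ r * n `^ r)%:E)%E.
  move=> A0 r0 N0 h; rewrite -powRM// -poweR_EFin.
  apply: gt0_ler_poweR => //; first exact: ltW.
    by rewrite in_itv/= N0 leey.
  by rewrite in_itv/= leey andbT lee_fin mulr_ge0.
apply: le_trans (lee_pmul (poweR_ge0 _ _) (poweR_ge0 _ _) (le _ _ _ A10 r10 N10 h1)
  (le _ _ _ A20 r20 N20 h2)) _.
have r12 : (r1 + r2 == 0) ==> (n != 0) by rewrite gt_eqF// addr_gt0.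
rewrite poweR_EFin -2!EFinM lee_fin (powRD r12).
by rewrite [leLHS]mulrACA.
Qed.

End WeightComparison.

Theorem corollary3p4 (R : realType) (w : complex R -> R) (p1 : R) :
  invariant_weight w -> 0 < p1 -> p1 <= 2 ->
  exists2 C : R, 0 < C &
    forall p p2 : R,
      0 < p -> p < 2 -> 2 < p2 ->
      p^-1 = p1^-1 + p2^-1 -> 2 * p <= p2 ->
      polynomials_dense p w ->
      forall f : complex R -> complex R, bergman p w f ->
        exists f1 f2 : complex R -> complex R,
          [/\ bergman p1 w f1, bergman p2 w f2,
              forall z, disc z -> f z = f1 z * f2 z &
              (bergman_norm p1 w f1 * bergman_norm p2 w f2
                 <= C%:E * bergman_norm p w f)%E].
Proof.
move=> iw p10 _.
have [W [r [C [bW wW]]]] := borel_comparable_weight iw.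
have [K hK] := invariant_weight_growth bW.
have C1 := binv_C1 bW; have C0 : 0 < C by exact: lt_le_trans C1.
pose A k := 16 * C ^+ 2 * growth_const C K k.
pose c := 16 * C ^+ 2 * (4 * 16 ^+ 2 * C ^+ 2).
have A0 k : 0 < k -> 0 < A k.
  by move=> k0; rewrite /A mulr_gt0 ?growth_const_gt0// mulr_gt0// exprn_gt0.
have c1 : 1 <= c.
  have C21 : 1 <= C ^+ 2 by rewrite exprn_ege1.
  have h : (1 : R) <= 16 by rewrite ler1n.
  have h4 : (1 : R) <= 4 by rewrite ler1n.
  by rewrite /c !mulr_ege1// exprn_ege1.
exists (A p1 `^ p1^-1 * (c * expR 2 ^+ (K + 2))).
  rewrite mulr_gt0 ?powR_gt0 ?A0// mulr_gt0 ?exprn_gt0 ?expR_gt0//.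
  exact: lt_le_trans c1.
move=> p p2 p0 p2' p22 pE _ dp f bf.
have p20 : 0 < p2 by exact: lt_trans p22.
have [af If] := bf; have cf := analytic_continuous_on_disc af.
have mf : (weighted_integral W p f < +oo)%E.
  apply: le_lt_trans (mean_le_bergman_integral bW wW p cf) _.
  by rewrite lte_mul_pinfty// ?lee_fin ?mulr_ge0 ?pi_ge0 ?(ltW C0).
have [f1 [f2 [a1 a2 f12 h1 h2]]] := weighted_factorization bW hK p0 (ltW p2') p10 p20 pE af mf
  (dense_mean_le bW wW p0 dp bf).
have N0 := bergman_integral_ge0 bW wW p f.
have NE : bergman_integral p w f = (fine (bergman_integral p w f))%:E.
  by rewrite fineK// ge0_fin_numE.
set n := fine _ in NE.
have n0 : 0 <= n by exact: fine_ge0.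
have bound k g : 0 < k -> analytic_on_disc g ->
    (weighted_integral W k g <= (16 * growth_const C K k)%:E * weighted_integral W p f)%E ->
    (bergman_integral k w g <= (A k * n)%:E)%E.
  move=> k0 ag hg.
  apply: le_trans (bergman_integral_le bW wW k (analytic_continuous_on_disc ag)) _.
  have G0 : 0 < 16 * growth_const C K k by apply: mulr_gt0; rewrite ?growth_const_gt0.
  apply: (@le_trans _ _ ((pi^-1 * C)%:E * ((16 * growth_const C K k)%:E * ((pi * C)%:E * n%:E)))%E).
    rewrite lee_pmul2l// ?lte_fin ?mulr_gt0 ?invr_gt0 ?pi_gt0//.
    apply: le_trans hg _; rewrite lee_pmul2l// ?lte_fin//.
    by rewrite -NE; exact: (mean_le_bergman_integral bW wW p cf).
  rewrite -!EFinM lee_fin le_eqVlt; apply/orP; left; apply/eqP.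
  have : (pi : R) != 0 by rewrite gt_eqF ?pi_gt0.
  by rewrite /A; move: pi (growth_const C K k) => a b a0; field.
have b1 := bound _ _ p10 a1 h1; have b2 := bound _ _ p20 a2 h2.
exists f1, f2; split.
- exact: (conj a1 (le_lt_trans b1 (ltry _))).
- exact: (conj a2 (le_lt_trans b2 (ltry _))).
- exact: f12.
have i1 : 0 < p1^-1 by rewrite invr_gt0.
have i2 : 0 < p2^-1 by rewrite invr_gt0.
have := norm_product_le (ltW (A0 _ p10)) (ltW (A0 _ p20)) n0 i1 i2
  (bergman_integral_ge0 bW wW p1 f1) (bergman_integral_ge0 bW wW p2 f2) b1 b2.
rewrite -pE -NE => /le_trans; apply.
apply: lee_wpmul2r; first exact: poweR_ge0.
rewrite lee_fin ler_wpM2l ?powR_ge0//.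
rewrite (_ : A p2 = c * (expR 1 * (p2 + 1)) ^+ (K + 2)).
  by apply: growth_root_le => //; move: p22; lra.
by rewrite /A /c /growth_const !mulrA.
Qed.
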